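(* Let $T>0$, $c_0>0$, let $V,g:\mathbb{R}\to\mathbb{R}$ be twice differentiable with $\sup_{z\in\mathbb{R}}(|V'(z)|+|V''(z)|)<\infty$ and $\sup_{z\in\mathbb{R}}(|g'(z)|+|g''(z)|)<\infty$, and let $\rho_0$ be (the density of) a compactly supported probability measure on $\mathbb{R}$ that is absolutely continuous with respect to Lebesgue measure. Then for all $Q\in L^2(0,T)$ the functional $$I[\omega]=\int_0^T Q(t)\omega(t)\,dt-\int_{\mathbb{R}}\phi_\omega(x)\rho_0(x)\,dx,\qquad \omega\in L^2(0,T),$$ admits a minimizer over $L^2(0,T)$. Moreover, every minimizer $\omega^*$ satisfies $\omega^*+c_0Q\in C^1([0,T])$ (that is, $\omega^*+c_0Q$ agrees a.e. with a $C^1([0,T])$ function). In particular, for every supply $Q\in L^2(0,T)$ there exists an equilibrium price $\omega^*\in L^2(0,T)$ which is as smooth as $Q$, up to $C^1([0,T])$, in the sense that $\omega^*$ differs from $-c_0Q$ by a function in $C^1([0,T])$.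
   Context: For $\omega\in L^2(0,T)$ and $x\in\mathbb{R}$ define $$\phi_\omega(x)=\inf\left\{\int_0^T\left[\tfrac{c_0}{2}\dot z(t)^2+\dot z(t)\omega(t)+V(z(t))\right]dt+g(z(T))\;:\;z\in H^1(0,T),\ z(0)=x\right\},\qquad(\ast)$$ where $H^1(0,T)$ functions are identified with their continuous representatives on $[0,T]$. Under the stated assumptions on $V,g$, problem $(\ast)$ has a minimizer for every $x$, the minimizer is unique for Lebesgue-a.e. $x$, and one can select minimizers $z^*_\omega(\cdot,x)$ of $(\ast)$, one for each $x\in\mathbb{R}$, so that $(t,x)\mapsto z^*_\omega(t,x)$ is Borel measurable; the optimal trading rate is $\alpha^*_{x,\omega}(t)=\dot z^*_\omega(t,x)$ (derivative in $t$, defined for a.e. $t$). Given a supply $Q\in L^2(0,T)$, a function $\omega^*\in L^2(0,T)$ is called an equilibrium price if the market clearing condition holds: $$\int_{\mathbb{R}}\alpha^*_{x,\omega^*}(t)\,\rho_0(x)\,dx=Q(t)\quad\text{for a.e. }t\in(0,T).$$ *)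

(* Defs.v *)
From mathcomp Require Import all_boot all_order all_algebra.
From mathcomp Require Import all_classical all_reals all_analysis.

Set Implicit Arguments.
Unset Strict Implicit.
Unset Printing Implicit Defensive.

Import Order.TTheory GRing.Theory Num.Theory.
Import numFieldNormedType.Exports.

Local Open Scope ring_scope.
Local Open Scope classical_set_scope.

(** Functions of time are represented by total functions [R -> R], whose values
    outside of [0, T] are irrelevant to all the definitions below.  Elements of
    L^2(0,T) are represented by functions rather than by classes modulo
    equality almost everywhere. *)

Section Spaces.
Context {R : realType} (T : R).
Local Notation mu := (@lebesgue_measure R).

(** f is in L^2(0,T) when its extension by zero is in L^2(R). *)
Definition L2 : set (R -> R) :=
  [set f | (f \_ `]0, T[%classic : R -> R) \in Lfun mu 2%:E].

Definition ae_eq_0T (f h : R -> R) : Prop :=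
  {ae mu, forall t, t \in `]0, T[ -> f t = h t}.

(** Test functions: C^1 functions with compact support in (0,T). *)
Definition C1c : set (R -> R) :=
  [set psi : R -> R | [/\ forall t : R, derivable psi t 1,
     continuous (derive1 psi) &
     exists K : set R, [/\ compact K, K `<=` `]0, T[%classic &
                          forall t : R, ~ K t -> psi t = 0]]].

Definition weak_derivative (z v : R -> R) : Prop :=
  forall psi, C1c psi ->
    \int[mu]_(t in `]0, T[) (z t * derive1 psi t) =
      - \int[mu]_(t in `]0, T[) (v t * psi t).

(** H^1(0,T), each element being given by its continuous representative. *)
Definition H1 : set (R -> R) :=
  [set z | [/\ L2 z, exists2 v, L2 v & weak_derivative z v &
               {within `[0, T], continuous z}]].

(** C^1([0,T]): the derivative on (0,T) extends continuously to [0,T]. *)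
Definition C1_0T : set (R -> R) :=
  [set h | derivable_oo_LRcontinuous h 0 T /\
     exists2 k : R -> R, {within `[0, T], continuous k} &
                         {in `]0, T[, derive1 h =1 k}].

Definition equal_ae_C1 (f : R -> R) : Prop := exists2 h, C1_0T h & ae_eq_0T f h.

End Spaces.

Section Assumptions.
Context {R : realType}.
Local Notation mu := (@lebesgue_measure R).

Definition bounded_derivatives2 (f : R -> R) : Prop :=
  [/\ forall z : R, derivable f z 1, forall z : R, derivable (derive1 f) z 1 &
      exists M, forall z, `|derive1 f z| + `|derive1n 2 f z| <= M].

Definition compactly_supported (P : probability (measurableTypeR R) R) : Prop :=
  exists2 K : set R, compact K & P (~` K) = 0%E.

Definition is_density (P : probability (measurableTypeR R) R) (rho : R -> R) :
    Prop :=
  measurable_fun [set: measurableTypeR R] rho /\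
  forall A : set (measurableTypeR R), measurable A ->
    P A = (\int[mu]_(x in A) (rho x)%:E)%E.

End Assumptions.

Section Problem.
Context {R : realType} (T c0 : R) (V g : R -> R).
Local Notation mu := (@lebesgue_measure R).

(** An H^1 function is differentiable almost everywhere, so the value that
    [derive1 z] takes where z is not differentiable does not matter. *)
Definition cost (w z : R -> R) : R :=
  \int[mu]_(t in `]0, T[)
     (c0 / 2 * (derive1 z t) ^+ 2 + derive1 z t * w t + V (z t)) + g (z T).

Definition admissible (x : R) : set (R -> R) := [set z | H1 T z /\ z 0 = x].

(** The infimum is a genuine one: the set is never empty, and it is bounded
    below when [0 < c0], [w] is in L^2(0,T) and V, g are Lipschitz. *)
Definition phi (w : R -> R) (x : R) : R := inf [set cost w z | z in admissible x].

Definition is_minimizer (w : R -> R) (x : R) (z : R -> R) : Prop :=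
  admissible x z /\ forall y, admissible x y -> cost w z <= cost w y.

(** [zs x] is the selected minimizer starting from x. *)
Definition measurable_selection (w : R -> R) (zs : R -> R -> R) : Prop :=
  (forall x, is_minimizer w x (zs x)) /\
  measurable_fun
    ((`[0, T]%classic : set (measurableTypeR R)) `*` [set: measurableTypeR R])
    (fun tx : measurableTypeR R * measurableTypeR R => zs tx.2 tx.1).

(** The integral is extended-real-valued, so that the equation includes the
    integrability in x of the aggregated trading rate. *)
Definition market_clearing (rho0 Q : R -> R) (zs : R -> R -> R) : Prop :=
  {ae mu, forall t, t \in `]0, T[ ->
     (\int[mu]_x (derive1 (zs x) t * rho0 x)%:E)%E = (Q t)%:E}.

(** Minimizers being unique for almost every x, the choice of the selection is
    immaterial: one exists, and the market clears for all of them. *)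
Definition equilibrium_price (rho0 Q w : R -> R) : Prop :=
  [/\ L2 T w,
      exists zs, measurable_selection w zs &
      forall zs, measurable_selection w zs -> market_clearing rho0 Q zs].

Definition I_functional (rho0 Q w : R -> R) : R :=
  \int[mu]_(t in `]0, T[) (Q t * w t) - \int[mu]_x (phi w x * rho0 x).

Definition minimizes_I (rho0 Q w : R -> R) : Prop :=
  L2 T w /\ forall w', L2 T w' -> I_functional rho0 Q w <= I_functional rho0 Q w'.

End Problem.

(* Main.v *)
(**
  Substituting [z = x + u1 - W], where [u1] is the primitive of [u] and [W] that
  of [w / c0], completes the square in the agent's problem: the cost becomes
  [c0/2 |u|^2] plus [int V(z) + g(z T)] minus [|w|^2 / (2 c0)].
  Completing the square once more, [I] becomes [|w + c0 Q|^2 / (2 c0)] minus the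
  averaged value function, up to a constant.  Both functionals are thus a squared
  L^2 norm plus a term that is Lipschitz in the sup norm of the primitive of the
  unknown.  Such a functional attains its minimum although it is not convex:
  along an ultrafilter the primitives of a minimizing sequence converge uniformly
  on [0,T], so the parallelogram law makes the sequence Cauchy in L^2.

  The minimizers of an agent satisfy [c0 u = p], where the momentum [p] solves
  [p' = V'(z)], [p(T) = - g'(z(T))].  Exchanging tails shows that two optimal
  trajectories that meet at an interior time have the same momentum there, hence
  coincide by uniqueness for the Hamiltonian system.  Optimal trajectories are
  therefore ordered by [x], which gives the measurable selection, and uniqueness
  but for countably many [x].  At points of uniqueness the value function is
  differentiable in [w], and the first-order condition for [I] reads
  [w + c0 Q = pbar], the average of the momenta.  The right-hand side is C^1, and
  averaging [z' = (p - w) / c0] turns this equation into market clearing.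
*)
Require Import Defs.
From mathcomp Require Import all_boot all_order all_algebra.
From mathcomp Require Import all_classical all_reals all_analysis.
From mathcomp Require Import measurable_realfun ring lra.

Import Order.TTheory GRing.Theory Num.Theory.
Import numFieldNormedType.Exports.

Local Open Scope classical_set_scope.
Local Open Scope ring_scope.
Set Implicit Arguments.
Unset Strict Implicit.
Unset Printing Implicit Defensive.

(** * Square-integrable functions and their primitives *)

(** The price is only in L^2, so an optimal [z] need not be differentiable at a given time.
    Subtracting the drift moves the irregular part into [W], which all agents share: [u] is then
    a.e. a continuous momentum divided by [c0], differences of optimal trajectories are C^1 on
    (0,T), and the exceptional null set of times depends on the price alone and serves all agents at
    once. The ordering argument and market clearing both rest on this. The compactness argument
    works twice. It gives existence, for an agent and for [I]; applied to near-minimizers that stay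
    away from a unique minimizer, it gives stability. Stability makes the value differentiable in
    the price at each starting point with a unique optimum, by an envelope argument, and the
    remaining starting points form a null set, which averaging against a density does not see. The
    second derivatives of [V] and [g] are bounded but not assumed continuous, so the estimates use
    Lipschitz bounds and a first-order expansion with quadratic remainder. *)

Section L2_calculus.
Context {R : realType} (T : R).
Local Notation mu := (@lebesgue_measure R).
Local Notation D := (`]0, T[%classic : set R).
Local Notation intg f := (mu.-integrable D (EFin \o f)).
Implicit Types f h v u : R -> R.

Lemma measurable_D : measurable (D : set (measurableTypeR R)).
Proof. exact: measurable_itv. Qed.
Hint Resolve measurable_D : core.

Lemma mu_D_lty : (mu D < +oo)%E.
Proof. by rewrite lebesgue_measure_itv/=; case: ifP; rewrite -?EFinB ltry. Qed.

Lemma intg_bounded f (M : R) : measurable_fun D f ->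
  (forall t, D t -> `|f t| <= M) -> intg f.
Proof.
move=> mf fM; apply: measurable_bounded_integrable => //; first exact: mu_D_lty.
exists M; split; first exact: num_real.
by move=> x Mx t Dt; exact: le_trans (fM t Dt) (ltW Mx).
Qed.

Lemma intgD f h : intg f -> intg h -> intg (fun t => f t + h t).
Proof. exact: integrableD. Qed.

Lemma intgZ a f : intg f -> intg (fun t => a * f t).
Proof. exact: integrableZl. Qed.

Lemma intgN f : intg f -> intg (fun t => - f t).
Proof. exact: integrableN. Qed.

Lemma intgB f h : intg f -> intg h -> intg (fun t => f t - h t).
Proof. by move=> fi hi; apply: intgD => //; exact: intgN. Qed.

Lemma intg_cst a : intg (cst a).
Proof. exact: (@intg_bounded _ `|a|). Qed.

Lemma intg_meas f : intg f -> measurable_fun D f.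
Proof. by move=> /measurable_int/measurable_EFinP. Qed.

Lemma intg_le f h : measurable_fun D f -> intg h ->
  (forall t, D t -> `|f t| <= h t) -> intg f.
Proof.
move=> mf hi fh; apply: (le_integrable _ _ _ hi) => //; first exact/measurable_EFinP.
by move=> t Dt /=; rewrite lee_fin (le_trans (fh t Dt))// ler_norm.
Qed.

Lemma L2P f : L2 T f <->
  measurable_fun D f /\ intg (fun t => f t ^+ 2).
Proof.
have E : EFin \o (fun t => (f \_ D) t ^+ 2) = (EFin \o (fun t => f t ^+ 2)) \_ D.
  apply/funext => t /=; rewrite !patchE; case: ifP => // _.
  by rewrite /= expr0n.
split=> [L|[mf fi]].
  split.
    move: (L); rewrite /L2/= => /sub_Lfun_mfun; rewrite inE/=.
    by move=> /(measurable_restrictT _ measurable_D).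
  by apply/(integrable_mkcond _ measurable_D); rewrite -E; exact: Lfun2_integrable_sqr.
rewrite /L2/=; have mfD : measurable_fun setT (f \_ D).
  exact/(measurable_restrictT _ measurable_D).
apply/andP; split; first by rewrite inE.
rewrite inE/= /finite_norm unlock/= poweR_lty//.
have /(integrable_mkcond _ measurable_D)/integrableP[_] := fi.
rewrite -E; apply: le_lt_trans; apply: ge0_le_integral => //.
- apply/measurable_EFinP.
  apply/(@measurableT_comp _ _ _ _ _ _ (fun x : R => x `^ 2)%R) => //.
  exact/measurableT_comp.
- apply: measurableT_comp => //; apply/measurable_EFinP; exact: measurable_funX.
- by move=> t _/=; rewrite lee_fin normrX powR_mulrn.
Qed.


Lemma L2_meas f : L2 T f -> measurable_fun D f.
Proof. by move=> /L2P[]. Qed.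

Lemma L2_sqr f : L2 T f -> intg (fun t => f t ^+ 2).
Proof. by move=> /L2P[]. Qed.

Lemma L2_bounded f (M : R) : measurable_fun D f ->
  (forall t, D t -> `|f t| <= M) -> L2 T f.
Proof.
move=> mf fM; apply/L2P; split=> //.
apply: (@intg_bounded _ (M ^+ 2)); first exact: measurable_funX.
by move=> t Dt; rewrite normrX lerXn2r ?nnegrE// ?fM// (le_trans _ (fM t Dt)).
Qed.

Lemma L2_mul_intg f h : L2 T f -> L2 T h -> intg (fun t => f t * h t).
Proof.
move=> /L2P[mf fi] /L2P[mh hi].
apply: (@intg_le _ (fun t => f t ^+ 2 + h t ^+ 2)).
- exact: measurable_funM.
- exact: intgD.
- move=> t _; rewrite normrM -(real_normK (num_real (f t))).
  rewrite -(real_normK (num_real (h t))).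
  have := sqr_ge0 (`|f t| - `|h t|); have := normr_ge0 (f t).
  have := normr_ge0 (h t); nra.
Qed.

Lemma L2_le f h : measurable_fun D f -> L2 T h ->
  (forall t, D t -> `|f t| <= `|h t|) -> L2 T f.
Proof.
move=> mf hL fh; apply/L2P; split=> //.
apply: (intg_le _ (L2_sqr hL)); first exact: measurable_funX.
move=> t Dt; rewrite normrX -[leRHS]real_normK ?num_real//.
by rewrite lerXn2r ?nnegrE// fh.
Qed.

Lemma L2_cst a : L2 T (cst a).
Proof. exact: (@L2_bounded _ `|a|). Qed.

Lemma L2_intg f : L2 T f -> intg f.
Proof.
move=> fL; apply: eq_integrable (L2_mul_intg (L2_cst 1) fL) => // t _.
by rewrite /= mul1r.
Qed.

Lemma L2Z a f : L2 T f -> L2 T (fun t => a * f t).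
Proof.
move=> /L2P[mf fi]; apply/L2P; split; first exact: measurable_funM.
apply: eq_integrable (intgZ (a ^+ 2) fi) => // t _.
by rewrite /= exprMn.
Qed.

Lemma L2D f h : L2 T f -> L2 T h -> L2 T (fun t => f t + h t).
Proof.
move=> fL hL; apply/L2P; split; first by apply: measurable_funD; exact: L2_meas.
have := intgD (intgD (L2_sqr fL) (intgZ 2 (L2_mul_intg fL hL))) (L2_sqr hL).
by apply: eq_integrable => // t _ /=; rewrite sqrrD mulr_natl.
Qed.

Lemma L2N f : L2 T f -> L2 T (fun t => - f t).
Proof. by move=> /(L2Z (-1)); under eq_fun do rewrite mulN1r. Qed.

Lemma L2B f h : L2 T f -> L2 T h -> L2 T (fun t => f t - h t).
Proof. by move=> fL hL; apply: L2D => //; exact: L2N. Qed.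

Lemma eq_L2 f h : (forall t, D t -> f t = h t) -> L2 T f -> L2 T h.
Proof.
move=> fh; rewrite /L2/=; suff -> : f \_ D = h \_ D by [].
by apply/eq_restrictP => t; rewrite inE => /fh.
Qed.

Definition ip f h : R := \int[mu]_(t in D) (f t * h t).

Lemma ipC f h : ip f h = ip h f.
Proof. by apply: eq_Rintegral => t _; rewrite mulrC. Qed.

Lemma eq_ip f f' h h' : (forall t, D t -> f t = f' t) ->
  (forall t, D t -> h t = h' t) -> ip f h = ip f' h'.
Proof. by move=> ff' hh'; apply: eq_Rintegral => t /set_mem Dt; rewrite ff'// hh'. Qed.

Lemma ipDl f f' h : L2 T f -> L2 T f' -> L2 T h ->
  ip (fun t => f t + f' t) h = ip f h + ip f' h.
Proof.
move=> fL f'L hL; rewrite /ip -RintegralD//; [|exact: L2_mul_intg..].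
by apply: eq_Rintegral => t _; rewrite mulrDl.
Qed.

Lemma ipZl a f h : L2 T f -> L2 T h -> ip (fun t => a * f t) h = a * ip f h.
Proof.
move=> fL hL; rewrite /ip -RintegralZl//; last exact: L2_mul_intg.
by apply: eq_Rintegral => t _; rewrite mulrA.
Qed.

Lemma ipNl f h : L2 T f -> L2 T h -> ip (fun t => - f t) h = - ip f h.
Proof.
by move=> fL hL; rewrite -mulN1r -ipZl//; apply: eq_ip => // t _; rewrite mulN1r.
Qed.

Lemma ipBl f f' h : L2 T f -> L2 T f' -> L2 T h ->
  ip (fun t => f t - f' t) h = ip f h - ip f' h.
Proof. by move=> fL f'L hL; rewrite ipDl ?ipNl//; exact: L2N. Qed.

Lemma ipDr f h h' : L2 T f -> L2 T h -> L2 T h' ->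
  ip f (fun t => h t + h' t) = ip f h + ip f h'.
Proof. by move=> *; rewrite ipC ipDl// ipC (ipC h'). Qed.

Lemma ipZr a f h : L2 T f -> L2 T h -> ip f (fun t => a * h t) = a * ip f h.
Proof. by move=> *; rewrite ipC ipZl// ipC. Qed.

Lemma ipNr f h : L2 T f -> L2 T h -> ip f (fun t => - h t) = - ip f h.
Proof. by move=> *; rewrite ipC ipNl// ipC. Qed.

Lemma ipBr f h h' : L2 T f -> L2 T h -> L2 T h' ->
  ip f (fun t => h t - h' t) = ip f h - ip f h'.
Proof. by move=> *; rewrite ipC ipBl// ipC (ipC h'). Qed.

Lemma ip_ge0 f : 0 <= ip f f.
Proof. by apply: Rintegral_ge0 => t _; rewrite -expr2 sqr_ge0. Qed.

Lemma ip_sqrD f h (a : R) : L2 T f -> L2 T h ->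
  ip (fun t => f t + a * h t) (fun t => f t + a * h t) =
  ip f f + 2 * a * ip f h + a ^+ 2 * ip h h.
Proof.
move=> fL hL; have aL := L2Z a hL; have fL' := L2D fL aL.
rewrite ipDl// ipZl// !ipDr// !ipZr// (ipC h f); ring.
Qed.

Lemma ip_CS f h : L2 T f -> L2 T h -> ip f h ^+ 2 <= ip f f * ip h h.
Proof.
move=> fL hL; have [h0|h0] := eqVneq (ip h h) 0.
  have P a : 0 <= ip f f + 2 * a * ip f h.
    by have := ip_ge0 (fun t => f t + a * h t); rewrite ip_sqrD// h0 mulr0 addr0.
  rewrite h0 mulr0; have [->|fh0] := eqVneq (ip f h) 0; first by rewrite expr0n.
  (* When [ip h h = 0] the expression in [P] is affine in [a]; this [a] would give it the value
     -1. *)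
  have := P (- (ip f f + 1) / (2 * ip f h)).
  rewrite (_ : 2 * _ * _ = - (ip f f + 1)); last by field.
  by rewrite opprD addrA subrr sub0r oppr_ge0 ler10.
have hp : 0 < ip h h by rewrite lt_neqAle eq_sym h0 ip_ge0.
have := ip_ge0 (fun t => f t + (- (ip f h / ip h h)) * h t); rewrite ip_sqrD//.
rewrite -(pmulr_rge0 _ hp) (_ : ip h h * _ = ip f f * ip h h - ip f h ^+ 2) ?subr_ge0//.
by field.
Qed.

Lemma ip_eq0_ae f : L2 T f -> ip f f = 0 ->
  {ae mu, forall t, t \in `]0, T[ -> f t = 0}.
Proof.
move=> fL f0.
have fi : intg (fun t => f t * f t) by exact: L2_mul_intg.
have : (\int[mu]_(t in D) `|(f t * f t)%:E| = 0)%E.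
  transitivity (\int[mu]_(t in D) (f t * f t)%:E)%E.
    by apply: eq_integral => t _ /=; rewrite ger0_norm// -expr2 sqr_ge0.
  by rewrite -[LHS]fineK ?integrable_fin_num//; congr (_%:E).
move=> /ae_eq_integral_abs; case=> //.
  by apply/measurable_EFinP; exact: intg_meas.
move=> N NP; exists N; move: NP => [mN N0 sN]; split=> //.
apply: subset_trans sN => t /= P Q; apply: P => tD; have /eqP := Q tD.
by rewrite eqe mulf_eq0 orbb => /eqP.
Qed.

Lemma ip_ae f f' h : L2 T f -> L2 T f' -> L2 T h ->
  {ae mu, forall t, t \in `]0, T[ -> f t = f' t} -> ip f h = ip f' h.
Proof.
move=> fL f'L hL ff'; rewrite /ip /Rintegral; congr fine.
apply: ae_eq_integral => //.
- by apply/measurable_EFinP; exact: intg_meas (L2_mul_intg fL hL).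
- by apply/measurable_EFinP; exact: intg_meas (L2_mul_intg f'L hL).
- move: ff'; apply: filterS; first exact: (ae_filter_ringOfSetsType mu).
  by move=> t P Dt; rewrite P.
Qed.

End L2_calculus.

Lemma Rintegral_eq0 (R : realType) (A : set (measurableTypeR R)) (f : R -> R) :
  measurable A -> (forall t, A t -> f t = 0) ->
  \int[@lebesgue_measure R]_(t in A) f t = 0.
Proof.
move=> mA f0; transitivity (\int[@lebesgue_measure R]_(t in A) (cst 0 t : R)).
  by apply: eq_Rintegral => t /set_mem/f0.
by rewrite Rintegral_cst// mul0r.
Qed.

(** * Fubini for real-valued integrals under a product bound *)

Section Fubini_real.
Context {R : realType}.
Local Notation mu := (@lebesgue_measure R).
Local Notation RR := (measurableTypeR R).

Lemma integrable_slice (h : RR -> R) (b : R -> R) (c : R) :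
  measurable_fun setT h -> mu.-integrable setT (EFin \o b) ->
  (forall y, `|h y| <= c * b y) -> mu.-integrable setT (EFin \o h).
Proof.
move=> mh bi hb; have /= cbi := integrableZl (measurableT : measurable [set: RR]) c bi.
apply: (le_integrable _ _ _ cbi) => //; first exact/measurable_EFinP.
by move=> y _ /=; rewrite lee_fin (le_trans (hb y))// ler_norm.
Qed.

Variables (F : RR * RR -> R) (a b : R -> R).
Hypotheses (mF : measurable_fun setT F).
Hypotheses (ai : mu.-integrable setT (EFin \o a))
  (bi : mu.-integrable setT (EFin \o b)).
Hypothesis Fab : forall x y, `|F (x, y)| <= a x * b y.

Lemma slice1 x : mu.-integrable setT (EFin \o (fun y => F (x, y))).
Proof.
by apply: integrable_slice bi (Fab x); exact: measurable_fun_pair2.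
Qed.

Lemma slice2 y : mu.-integrable setT (EFin \o (fun x => F (x, y))).
Proof.
apply: (@integrable_slice _ a (b y)) => //; first exact: measurable_fun_pair1.
by move=> x; rewrite mulrC.
Qed.

Let mEF : measurable_fun setT (EFin \o F).
Proof. exact/measurable_EFinP. Qed.

Let inner1 x : (\int[mu]_y (F (x, y))%:E)%E = (\int[mu]_y F (x, y))%:E.
Proof. by rewrite fineK//; apply: integrable_fin_num => //; exact: slice1. Qed.

Let inner2 y : (\int[mu]_x (F (x, y))%:E)%E = (\int[mu]_x F (x, y))%:E.
Proof. by rewrite fineK//; apply: integrable_fin_num => //; exact: slice2. Qed.

Lemma product_bounded_integrable : (mu \x mu)%E.-integrable setT (EFin \o F).
Proof.
have H := @integrable12ltyP _ _ RR RR R mu mu _ mEF; apply/H.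
pose B := \int[mu]_y `|b y|.
have abi := integrable_norm ai.
have bbi := integrable_norm bi.
have BE : B%:E = (\int[mu]_y (`|b y|)%:E)%E.
  by rewrite /B /Rintegral fineK// integrable_fin_num.
apply: (@le_lt_trans _ _ (\int[mu]_x (B%:E * (`|a x|)%:E))%E).
  apply: ge0_le_integral => //.
  - by move=> x _; exact: integral_ge0.
  - by apply: (measurable_fun_fubini_tonelli_F (fun z => `|(F z)%:E|)%E) => //; exact: measurableT_comp.
  - by apply: measurable_funeM; exact: measurable_int abi.
  - move=> x _; rewrite BE muleC -integralZl//.
    apply: ge0_le_integral => //.
    + by apply: measurableT_comp => //; have /measurable_int := slice1 x.
    + by apply: measurable_funeM; exact: measurable_int bbi.
    + move=> y _ /=; rewrite lee_fin (le_trans (Fab x y))//.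
      by rewrite (le_trans (ler_norm _))// normrM.
rewrite integralZl// lte_mul_pinfty//; last exact: integrable_lty.
by rewrite lee_fin; apply: Rintegral_ge0.
Qed.

Lemma Rfubini : \int[mu]_x \int[mu]_y F (x, y) = \int[mu]_y \int[mu]_x F (x, y).
Proof.
have := Fubini product_bounded_integrable.
rewrite /= [in X in X = _](eq_integral _ _ (fun x _ => inner1 x)).
by rewrite [in X in _ = X](eq_integral _ _ (fun x _ => inner2 x)) /Rintegral => ->.
Qed.

Lemma measurable_Rintegral1 : measurable_fun setT (fun x => \int[mu]_y F (x, y)).
Proof.
have := measurable_fubini_F product_bounded_integrable.
rewrite /fubini_F /= (_ : (fun _ => _) = EFin \o (fun x => \int[mu]_y F (x, y))).
  by move=> /measurable_EFinP.
by apply/funext => x /=; rewrite inner1.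
Qed.

End Fubini_real.

(** * Primitives of L^2 functions *)

Section Primitive.
Context {R : realType} (T : R).
Local Notation mu := (@lebesgue_measure R).
Local Notation D := (`]0, T[%classic : set R).
Local Notation intg f := (mu.-integrable D (EFin \o f)).
Implicit Types f h v u : R -> R.
Hypothesis T0 : 0 < T.

Let mD : measurable (D : set (measurableTypeR R)). Proof. exact: measurable_itv. Qed.

Definition step (t : R) : R -> R := fun s => (s <= t)%R%:R.
(* With this definition [prim] is the primitive vanishing at 0 on [0,T], and is constant on each side of [0,T]. *)
Definition prim v t := ip T (step t) v.
(** The integral of [v] from [s] to [T]. It is the adjoint of [prim] for the pairing [ip]. *)
Definition cprim v s := ip T (fun t => (s <= t)%R%:R) v.

Lemma le_indicE (A : set R) (p : R -> bool) : (forall s, A s <-> p s) ->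
  (fun s => (p s)%:R) = \1_A :> (R -> R).
Proof.
move=> Ap; apply/funext => s; rewrite indicE; congr (nat_of_bool _)%:R.
by apply/idP/idP => [/Ap/mem_set|/set_mem/Ap].
Qed.

Lemma stepE t : step t = \1_(`]-oo, t]%classic).
Proof. by apply: le_indicE => s /=; rewrite in_itv. Qed.

Lemma rstepE s : (fun t => (s <= t)%R%:R) = \1_(`[s, +oo[%classic) :> (R -> R).
Proof. by apply: le_indicE => t /=; rewrite in_itv/= andbT. Qed.

Lemma indic_L2 (A : set R) : measurable A -> L2 T (\1_A : R -> R).
Proof.
move=> mA; apply: (@L2_bounded _ _ _ 1); first exact: measurable_indic.
by move=> t _; rewrite indicE; case: (_ \in _); rewrite ?normr1 ?normr0.
Qed.

Lemma step_L2 t : L2 T (step t).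
Proof. by rewrite stepE; apply: indic_L2; exact: measurable_itv. Qed.

Lemma rstep_L2 s : L2 T (fun t => (s <= t)%R%:R).
Proof. by rewrite rstepE; apply: indic_L2; exact: measurable_itv. Qed.
Hint Resolve step_L2 rstep_L2 : core.

Lemma primD v u t : L2 T v -> L2 T u ->
  prim (fun s => v s + u s) t = prim v t + prim u t.
Proof. by move=> vL uL; rewrite /prim ipDr. Qed.

Lemma primB v u t : L2 T v -> L2 T u ->
  prim (fun s => v s - u s) t = prim v t - prim u t.
Proof. by move=> vL uL; rewrite /prim ipBr. Qed.

Lemma primZ a v t : L2 T v -> prim (fun s => a * v s) t = a * prim v t.
Proof. by move=> vL; rewrite /prim ipZr. Qed.

Lemma prim_le0 v t : t <= 0 -> prim v t = 0.
Proof.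
move=> t0; rewrite /prim /ip.
apply: Rintegral_eq0 => // s /=.
by rewrite in_itv/= /step => /andP[s0 _]; rewrite leNgt (le_lt_trans t0 s0) mul0r.
Qed.

Lemma prim_geT v t : T <= t -> prim v t = ip T (cst 1) v.
Proof.
move=> Tt; apply: eq_ip => // s /=; rewrite in_itv/= => /andP[_ sT].
by rewrite /step (le_trans (ltW sT) Tt).
Qed.

Lemma ip_indic (A : set R) : measurable A ->
  ip T (\1_A : R -> R) (\1_A : R -> R) = fine (mu (A `&` D)).
Proof.
move=> mA; rewrite /ip /Rintegral; congr fine.
transitivity (\int[mu]_(t in D) (\1_A t)%:E)%E; last by rewrite integral_indic.
by apply: eq_integral => t _; rewrite indicE; case: (_ \in _); rewrite /= ?mulr1 ?mulr0.
Qed.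

Lemma ip_step_le s t : s <= t ->
  ip T (fun r => step t r - step s r) (fun r => step t r - step s r) <= t - s.
Proof.
move=> st.
have -> : (fun r => step t r - step s r) = \1_(`]s, t]%classic).
  apply/funext => r; rewrite indicE /step mem_setE in_itv/=.
  by have [rs|rs] := leP r s; [rewrite (le_trans rs st) subrr|rewrite subr0].
have mst : measurable (`]s, t]%classic : set (measurableTypeR R)).
  exact: measurable_itv.
rewrite (ip_indic mst) -lee_fin.
have h : (mu (`]s, t]%classic `&` D) <= (t - s)%:E)%E.
  apply: (@le_trans _ _ (mu `]s, t]%classic)).
    apply: le_measure; rewrite ?inE.
    - by apply: measurableI => //; exact: measurable_itv.
    - exact: measurable_itv.
    - exact: subIsetl.
  by rewrite lebesgue_measure_itv/=; case: ifP; rewrite // lee_fin subr_ge0.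
by rewrite fineK// ge0_fin_numE ?measure_ge0// (le_lt_trans h)// ltry.
Qed.

(** Cauchy-Schwarz against the indicator of the interval between [s] and [t]. Kept squared, the
    bound needs no square root. *)
Lemma prim_holder v s t : L2 T v ->
  (prim v t - prim v s) ^+ 2 <= `|t - s| * ip T v v.
Proof.
move=> vL; wlog st : s t / s <= t => [H|].
  have [/H//|/ltW/H] := leP s t; by rewrite distrC -sqrrN opprB.
rewrite ger0_norm ?subr_ge0// /prim -ipBl//.
apply: le_trans (ip_CS _ vL) _; first exact: L2B.
by apply: ler_wpM2r; [exact: ip_ge0|exact: ip_step_le].
Qed.

Lemma prim_bound v t : L2 T v -> prim v t ^+ 2 <= T * ip T v v.
Proof.
move=> vL; have [t0|t0] := leP t 0.
  by rewrite prim_le0// expr0n/= mulr_ge0 ?ip_ge0 ?ltW.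
wlog tT : t t0 / t <= T => [H|].
  have [/H->//|/ltW Tt] := leP t T.
  by rewrite prim_geT// -(@prim_geT v T)// H.
have := prim_holder 0 t vL; rewrite (@prim_le0 v 0)// !subr0 => /le_trans; apply.
by rewrite gtr0_norm// ler_wpM2r// ip_ge0.
Qed.

Lemma prim_continuous v : L2 T v -> continuous (prim v).
Proof.
move=> vL t; apply/cvgrPdist_lt => e e0; near=> s.
rewrite -(@ltr_pXn2r _ 2)// ?nnegrE// ?ltW// real_normK ?num_real//.
apply: le_lt_trans (prim_holder s t vL) _.
have h : `|t - s| < e ^+ 2 / (ip T v v + 1).
  near: s; apply/nbhs_ballP; exists (e ^+ 2 / (ip T v v + 1)) => //=.
  by rewrite divr_gt0 ?exprn_gt0// ltr_pwDr// ip_ge0.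
apply: (@le_lt_trans _ _ (`|t - s| * (ip T v v + 1))).
  by rewrite ler_wpM2l// lerDl.
by rewrite -ltr_pdivlMr// ltr_pwDr// ip_ge0.
Unshelve. all: by end_near. Qed.

Lemma prim_meas v : L2 T v -> measurable_fun setT (prim v).
Proof. by move=> /prim_continuous; exact: continuous_measurable_fun. Qed.

Lemma prim_L2 v : L2 T v -> L2 T (prim v).
Proof.
move=> vL; apply: (@L2_bounded _ _ _ (1 + T * ip T v v)).
  by apply: measurable_funTS; exact: prim_meas.
move=> t _; have := prim_bound t vL; rewrite -real_normK ?num_real//.
by have := normr_ge0 (prim v t); nra.
Qed.

(** Integration by parts, obtained from Fubini on the triangle of pairs [(t, s)] with [s <= t]. *)
Lemma ip_prim v h : L2 T v -> L2 T h -> ip T (prim v) h = ip T v (cprim h).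
Proof.
move=> vL hL.
pose A := [set z : measurableTypeR R * measurableTypeR R | z.2 <= z.1].
have mA : measurable A.
  have := @measurable_fun_ler _ _ R setT (@snd (measurableTypeR R) (measurableTypeR R))
    (@fst (measurableTypeR R) (measurableTypeR R)) measurable_snd measurable_fst measurableT.
  by move=> /(_ [set true]); rewrite setTI; exact.
pose F (z : measurableTypeR R * measurableTypeR R) : R :=
  (\1_A z : R) * ((v \_ D) z.2 * (h \_ D) z.1).
have viT : mu.-integrable setT (EFin \o (v \_ D)).
  by rewrite -restrict_EFin; apply/(integrable_mkcond _ mD); exact: L2_intg.
have hiT : mu.-integrable setT (EFin \o (h \_ D)).
  by rewrite -restrict_EFin; apply/(integrable_mkcond _ mD); exact: L2_intg.
have mF : measurable_fun setT F.
  apply: measurable_funM; first exact: measurable_indic.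
  apply: measurable_funM; apply: measurableT_comp => //.
    by have /measurable_int/measurable_EFinP := viT.
  by have /measurable_int/measurable_EFinP := hiT.
have FE t s : F (t, s) = step t s * ((v \_ D) s * (h \_ D) t).
  rewrite /F indicE /step; congr ((nat_of_bool _)%:R * _).
  by apply/idP/idP => [/set_mem|/mem_set].
have := @Rfubini _ F (fun t => `|(h \_ D) t|) (fun t => `|(v \_ D) t|) mF.
move=> /(_ (integrable_norm hiT) (integrable_norm viT)) E.
transitivity (\int[mu]_t \int[mu]_s F (t, s)).
  rewrite /ip Rintegral_mkcond; apply: eq_Rintegral => t _.
  rewrite patchE; case: ifPn => tD.
    rewrite /prim /ip -RintegralZr//; last exact: L2_mul_intg.
    rewrite Rintegral_mkcond; apply: eq_Rintegral => s _.
    rewrite FE !patchE tD; case: ifPn => sD; last by rewrite mul0r mulr0.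
    by rewrite mulrA.
  apply/esym/Rintegral_eq0 => // s _.
  by rewrite FE !patchE (negbTE tD) !mulr0.
rewrite E; last first.
  move=> t s; rewrite FE normrM normrM [X in _ <= X]mulrC ler_piMl ?mulr_ge0//.
  by rewrite /step; case: (s <= t); rewrite ?normr1 ?normr0.
rewrite /ip [RHS]Rintegral_mkcond; apply: eq_Rintegral => s _.
rewrite patchE; case: ifPn => sD.
  rewrite /cprim /ip -RintegralZl//; last exact: L2_mul_intg.
  rewrite [RHS]Rintegral_mkcond; apply: eq_Rintegral => t _.
  rewrite FE !patchE sD; case: ifPn => tD; last by rewrite !mulr0.
  by rewrite mulrCA.
apply: Rintegral_eq0 => // t _.
by rewrite FE !patchE (negbTE sD) mul0r mulr0.
Qed.

(** Puts [prim] in the form to which the fundamental theorem of calculus applies. *)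
Lemma primE v t : L2 T v -> prim v t = \int[mu]_(s in `]-oo, t]) (v \_ D) s.
Proof.
move=> vL; rewrite /prim /ip [LHS]Rintegral_mkcond [RHS]Rintegral_mkcond.
apply: eq_Rintegral => s _; rewrite !patchE !mem_setE !in_itv/= /step.
by case: (0 < s < T); case: (s <= t); rewrite ?mul1r ?mul0r.
Qed.

Let primEf v : L2 T v ->
  prim v = (fun t => \int[mu]_(s in `]-oo, t]) (v \_ D) s).
Proof. by move=> vL; apply/funext => t; rewrite primE. Qed.

Let restr_integrable v y : L2 T v -> mu.-integrable `]-oo, y] (EFin \o (v \_ D)).
Proof.
move=> vL; apply: (@integrableS _ _ _ _ setT) => //.
by rewrite -restrict_EFin; apply/(integrable_mkcond _ mD); exact: L2_intg.
Qed.

Lemma prim_derivable_ae v : L2 T v -> {ae mu, forall t, t \in `]0, T[ ->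
  derivable (prim v) t 1 /\ derive1 (prim v) t = v t}.
Proof.
move=> vL.
have := FTC1Ny (fun y => restr_integrable y vL) (integrable_locally mD (L2_intg vL)).
rewrite /= -(primEf vL).
apply: filterS; first exact: (ae_filter_ringOfSetsType mu).
by move=> t [dt ->] tD; split=> //; rewrite patchE mem_setE tD.
Qed.

Lemma prim_derivable v t : L2 T v -> t \in `]0, T[ -> {for t, continuous v} ->
  derivable (prim v) t 1 /\ derive1 (prim v) t = v t.
Proof.
move=> vL tD vt.
have near_eq : \near t, v t = (v \_ D) t.
  have : nbhs t D by apply: open_nbhs_nbhs; split; [exact: interval_open|].
  by apply: filterS => s sD; rewrite patchE mem_set.
have := @continuous_FTC1 _ (v \_ D) -oo%O t (t + 1).
rewrite ltrDl ltr01 => /(_ isT (restr_integrable _ vL)).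
rewrite /= -(primEf vL).
move=> /(_ _ _)[].
- by rewrite ltNyr.
- rewrite /prop_for /continuous_at patchE mem_setE tD.
  by apply: cvg_trans vt; exact: near_eq_cvg near_eq.
- by rewrite patchE mem_setE tD.
Qed.

Lemma prim_is_derive v t : L2 T v -> t \in `]0, T[ -> {for t, continuous v} ->
  is_derive t 1 (prim v) (v t).
Proof.
move=> vL tD vt; have [d1 d2] := prim_derivable vL tD vt.
by apply: DeriveDef; [exact: d1|rewrite -d2 derive1E].
Qed.

End Primitive.

(** * Completeness of L^2(0,T) *)

Section Completeness.
Context {R : realType} (T : R).
Local Notation mu := (@lebesgue_measure R).
Local Notation RR := (measurableTypeR R).
Local Notation D := (`]0, T[%classic : set R).
Local Notation intg f := (mu.-integrable D (EFin \o f)).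
Implicit Types f h v u : R -> R.

Let mD : measurable (D : set (measurableTypeR R)). Proof. exact: measurable_itv. Qed.

Definition nm f : R := Num.sqrt (ip T f f).

Lemma nm_ge0 f : 0 <= nm f. Proof. exact: sqrtr_ge0. Qed.

Lemma nm_sqr f : nm f ^+ 2 = ip T f f. Proof. by rewrite sqr_sqrtr ?ip_ge0. Qed.

Lemma nm_le f (e : R) : 0 <= e -> ip T f f <= e ^+ 2 -> nm f <= e.
Proof. by move=> e0 fe; rewrite -(ler_pXn2r (n := 2)) ?nnegrE ?nm_ge0// nm_sqr. Qed.

Lemma ip_le_nm f h : L2 T f -> L2 T h -> `|ip T f h| <= nm f * nm h.
Proof.
move=> fL hL; rewrite -(ler_pXn2r (n := 2)) ?nnegrE ?mulr_ge0 ?nm_ge0//.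
by rewrite real_normK ?num_real// exprMn !nm_sqr ip_CS.
Qed.

Lemma nm_triangle f h : L2 T f -> L2 T h -> nm (fun t => f t + h t) <= nm f + nm h.
Proof.
move=> fL hL; apply: nm_le; first by rewrite addr_ge0 ?nm_ge0.
rewrite sqrrD !nm_sqr.
have -> : ip T (fun t => f t + h t) (fun t => f t + h t) =
    ip T f f + 2 * 1 * ip T f h + 1 ^+ 2 * ip T h h.
  by rewrite -ip_sqrD//; apply: eq_ip => t _; rewrite mul1r.
have := ip_le_nm fL hL; have := ler_norm (ip T f h); lra.
Qed.

Lemma L2_norm f : L2 T f -> L2 T (fun t => `|f t|).
Proof.
move=> fL; apply/L2P; split; first by apply: measurableT_comp => //; exact: L2_meas.
by apply: eq_integrable (L2_sqr fL) => // t _ /=; rewrite real_normK ?num_real.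
Qed.

Lemma ip_norm f : ip T (fun t => `|f t|) (fun t => `|f t|) = ip T f f.
Proof. by apply: eq_Rintegral => t _; rewrite -!expr2 real_normK ?num_real. Qed.

Lemma int_norm_le f : L2 T f ->
  (\int[mu]_(t in D) (`|f t|)%:E <= (nm (cst 1) * nm f)%:E)%E.
Proof.
move=> fL; have fn := L2_norm fL.
have -> : (\int[mu]_(t in D) (`|f t|)%:E = (ip T (cst 1) (fun t => `|f t|))%:E)%E.
  rewrite /ip /Rintegral fineK; last first.
    by apply: integrable_fin_num => //; apply: L2_mul_intg => //; exact: L2_cst.
  by apply: eq_integral => t _; rewrite /= mul1r.
rewrite lee_fin (le_trans (ler_norm _))// (le_trans (ip_le_nm (L2_cst T 1) fn))//.
by rewrite /nm ip_norm.
Qed.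

Lemma sum_half n : \sum_(k < n) (2^-1 : R) ^+ k = 2 - 2 * 2^-1 ^+ n.
Proof.
elim: n => [|n IH]; first by rewrite big_ord0 expr0; ring.
by rewrite big_ord_recr /= IH exprS; field.
Qed.

Section Cauchy.
Variable v : nat -> R -> R.
Hypothesis vL : forall n, L2 T (v n).
Hypothesis vC : forall n, nm (fun t => v n.+1 t - v n t) <= 2^-1 ^+ n.

Let vBL n m : L2 T (fun t => v n t - v m t). Proof. exact: L2B. Qed.

Let tail n k : nm (fun t => v (n + k)%N t - v n t) <= 2^-1 ^+ n * (2 - 2 * 2^-1 ^+ k).
Proof.
elim: k => [|k IH].
  rewrite addn0 /nm (_ : ip _ _ _ = 0) ?sqrtr0.
    by rewrite expr0 mulr1 subrr mulr0.
  by apply: Rintegral_eq0 => // t _; rewrite subrr mul0r.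
rewrite addnS (_ : (fun t => _) = (fun t =>
  (v (n + k).+1 t - v (n + k)%N t) + (v (n + k)%N t - v n t))); last first.
  by apply/funext => t; ring.
apply: le_trans (nm_triangle (vBL _ _) (vBL _ _)) _.
apply: le_trans (lerD (vC _) IH) _.
by rewrite exprD exprS le_eqVlt; apply/orP; left; apply/eqP; field.
Qed.

Let d n t : \bar R := (`|v n.+1 t - v n t|)%:E.
(** The sum of the increments has a finite integral, because the norms of the increments decay
    geometrically. It is therefore finite almost everywhere, and where it is finite [v n t]
    converges. *)
Let G t : \bar R := (\sum_(0 <= n <oo) d n t)%E.

Let md n : measurable_fun D (d n).
Proof. by apply/measurable_EFinP; exact: L2_meas (L2_norm (vBL _ _)). Qed.

Let mG : measurable_fun D G.
Proof. by apply: ge0_emeasurable_sum => // n t _ _; rewrite lee_fin. Qed.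

Let G_ge0 t : (0 <= G t)%E.
Proof. by apply: nneseries_ge0 => n _ _; rewrite lee_fin. Qed.

Let Gi : mu.-integrable D G.
Proof.
apply/integrableP; split=> //.
have -> : (\int[mu]_(t in D) `|G t| = \int[mu]_(t in D) G t)%E.
  by apply: eq_integral => t _; rewrite gee0_abs.
rewrite /G integral_nneseries//; last by move=> n t _; rewrite lee_fin.
apply: (@le_lt_trans _ _ (2 * nm (cst 1))%:E); last exact: ltry.
apply: lime_le.
  by apply: is_cvg_nneseries => n _ _; apply: integral_ge0 => t _; rewrite lee_fin.
apply: nearW => n.
apply: (@le_trans _ _ (\sum_(0 <= k < n) (nm (cst 1) * 2^-1 ^+ k)%:E)%E).
  apply: lee_sum => k _; apply: le_trans (int_norm_le (vBL _ _)) _.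
  by rewrite lee_fin ler_wpM2l ?nm_ge0.
rewrite sumEFin lee_fin big_mkord -mulr_sumr sum_half mulrC.
by rewrite ler_wpM2r ?nm_ge0// gerBl mulr_ge0// exprn_ge0.
Qed.

Let A : set R := D `&` [set t | G t \is a fin_num].

Let mA : measurable (A : set (measurableTypeR R)).
Proof. exact: emeasurable_fin_num. Qed.

Let muDA : mu (D `\` A) = 0%E.
Proof.
have [N [mN N0 sN]] := integrable_ae mD Gi.
apply: (@subset_measure0 _ _ _ mu _ N) => //; first exact: measurableD.
by move=> t [Dt nAt]; apply: sN => /= /(_ Dt) h; apply: nAt.
Qed.

Let cvgA t : A t -> cvgn (fun n => v n t).
Proof.
move=> [Dt Gt].
have c : cvgn (series (telescope (fun n => v n t))).
  apply: normed_cvg; apply: nondecreasing_is_cvgn.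
    apply/nondecreasing_seqP => n; by rewrite /= seriesSr lerDl normr_ge0.
  exists (fine (G t)) => _ [n _ <-]; move: Gt => /= Gt.
  rewrite -lee_fin fineK// /series/= -sumEFin.
  by apply: nneseries_lim_ge => k _ _; rewrite lee_fin.
rewrite (_ : (fun n => v n t) = (cst (v 0%N t)) \+ series (telescope (fun n => v n t))).
  by apply: is_cvgD => //; exact: is_cvg_cst.
by apply/funext => n; exact: (eq_sum_telescope (fun n => v n t)).
Qed.

Let w t : R := if pselect (A t) is left _ then limn (fun n => v n t) else 0.

Let cvgw t : A t -> v n t @[n --> \oo] --> w t.
Proof. by move=> At; rewrite /w; case: pselect => // _; exact: cvgA. Qed.

Let mw : measurable_fun D w.
Proof.
have -> : w = (w \_ A).
  apply/funext => t; rewrite patchE; case: ifPn => // tA.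
  by rewrite /w; case: pselect => // /mem_set; rewrite (negbTE tA).
apply: measurable_funTS.
apply/(measurable_restrictT _ mA).
apply: (@measurable_fun_cvg _ _ _ _ v) => // n.
apply: measurable_funS (L2_meas (vL n)) => //; exact: subIsetl.
Qed.

Let mvw n : measurable_fun D (fun t => (v n t - w t) ^+ 2).
Proof. by apply: measurable_funX; apply: measurable_funB => //; exact: L2_meas. Qed.

(** Fatou's lemma applied to the squares of [v n - v (n + k)] as [k] grows, using [tail]. *)
Let bound n :
  (\int[mu]_(t in D) ((v n t - w t) ^+ 2)%:E <= ((2 * 2^-1 ^+ n) ^+ 2)%:E)%E.
Proof.
rewrite (ge0_negligible_integral _ _ _ _ muDA)//; last 3 first.
- exact: measurableD.
- by apply/measurable_EFinP; exact: mvw.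
- by move=> t _; rewrite lee_fin sqr_ge0.
rewrite setDD (_ : D `&` A = A); last by rewrite /A setIA setIid.
pose f k t := ((v n t - v (n + k)%N t) ^+ 2)%:E.
have mf k : measurable_fun D (f k).
  by apply/measurable_EFinP/measurable_funX; exact: L2_meas (vBL _ _).
have mfA k : measurable_fun A (f k).
  by apply: measurable_funS (mf k) => //; exact: subIsetl.
have f0 k t : A t -> (0 <= f k t)%E by rewrite lee_fin sqr_ge0.
have -> : (\int[mu]_(t in A) ((v n t - w t) ^+ 2)%:E =
    \int[mu]_(t in A) limn_einf (f^~ t))%E.
  apply: eq_integral => t /set_mem At; symmetry.
  suff : f k t @[k --> \oo] --> ((v n t - w t) ^+ 2)%:E by move=> /cvg_limn_einf_sup[].
  apply/fine_cvgP; split; first exact: nearW.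
  rewrite /comp/=; under eq_fun do rewrite expr2; rewrite expr2.
  have c : v n t - v (n + k)%N t @[k --> \oo] --> v n t - w t.
    apply: cvgB; first exact: cvg_cst.
    have := cvgw At; rewrite -(cvg_shiftn n (fun k => v k t)).
    rewrite /= (_ : (fun k => v (k + n)%N t) = (fun k => v (n + k)%N t))//.
    by apply/funext => k; rewrite addnC.
  exact: cvgM.
apply: le_trans (fatou mu mA mfA f0) _.
rewrite limn_einf_lim; apply: lime_le; first exact: is_cvg_einfs.
apply: nearW => k; apply: (@le_trans _ _ (\int[mu]_(t in A) f k t)%E).
  by apply: ereal_inf_lbound; exists k => /=.
apply: (@le_trans _ _ (\int[mu]_(t in D) f k t)%E).
  apply: (@ge0_subset_integral _ RR R mu A D mA mD (f k) (mf k)); last exact: subIsetl.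
  by move=> t _; rewrite lee_fin sqr_ge0.
have -> : (\int[mu]_(t in D) f k t = (ip T (fun t => v (n + k)%N t - v n t) (fun t => v (n + k)%N t - v n t))%:E)%E.
  rewrite /ip /Rintegral fineK.
    by apply: eq_integral => t _; rewrite /f -expr2 -sqrrN opprB.
  by apply: integrable_fin_num => //; exact: L2_mul_intg.
rewrite lee_fin -nm_sqr lerXn2r ?nnegrE ?nm_ge0 ?mulr_ge0 ?exprn_ge0//.
apply: le_trans (tail n k) _; rewrite mulrC ler_wpM2r ?exprn_ge0//.
by rewrite gerBl mulr_ge0// exprn_ge0.
Qed.

Lemma L2_complete : exists2 w, L2 T w &
  forall n, nm (fun t => v n t - w t) <= 2 * 2^-1 ^+ n.
Proof.
have dL n : L2 T (fun t => v n t - w t).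
  apply/L2P; split; first by apply: measurable_funB => //; exact: L2_meas.
  apply/integrableP; split; first by apply/measurable_EFinP; exact: mvw.
  apply: (@le_lt_trans _ _ (\int[mu]_(t in D) ((v n t - w t) ^+ 2)%:E)%E).
    by under eq_integral do rewrite /= ger0_norm ?sqr_ge0//.
  by apply: le_lt_trans (bound n) _; exact: ltry.
exists w.
  apply: eq_L2 (L2B (vL 0) (dL 0%N)) => t _; ring.
move=> n; apply: nm_le; first by rewrite mulr_ge0// exprn_ge0.
rewrite -lee_fin; apply: le_trans (bound n).
rewrite /ip /Rintegral fineK; first by under eq_integral do rewrite -expr2.
by apply: integrable_fin_num => //; exact: L2_mul_intg.
Qed.

End Cauchy.

End Completeness.

Lemma filter_forall_lt (X : Type) (F : set_system X) (A : nat -> set X) n :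
  Filter F -> (forall i, F (A i)) -> F [set x | forall i, (i < n)%N -> A i x].
Proof.
move=> FF FA; elim: n => [|n IH]; first by apply: filterS filterT.
apply: filterS (filterI IH (FA n)) => x [h An] i; rewrite ltnS leq_eqVlt.
by move=> /predU1P[->|/h].
Qed.

(** * Minimization of a squared norm plus a compact perturbation *)

Section Minimization.
Context {R : realType} (T : R).
Local Notation mu := (@lebesgue_measure R).
Local Notation D := (`]0, T[%classic : set R).
Local Notation nrm2 f := (ip T f f).
Implicit Types f h v u w : R -> R.
Hypothesis T0 : 0 < T.

(** Compactness of the segment gives a cluster point. An ultrafilter contains either a set of
    indices or its complement, so the cluster point is a limit; one ultrafilter thus serves
    countless sequences without diagonal extraction. *)
Lemma cluster_ultra (U : set_system nat) (p : nat -> R) (M : R) :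
  UltraFilter U -> (forall n, `|p n| <= M) ->
  exists l, forall e, 0 < e -> U [set n | `|p n - l| < e].
Proof.
move=> UU pM.
have /(_ (p @ U)) := @segment_compact R (- M) M.
case.
  by rewrite /nbhs/=; apply: filterS filterT => n _ /=; rewrite in_itv/= -ler_norml.
move=> l [_ lU]; exists l => e e0.
have [//|h] := in_ultra_setVsetC [set n | `|p n - l| < e] UU.
have pU : U (p @^-1` (p @` ~` [set n | `|p n - l| < e])).
  by apply: filterS h => n nl; exists n.
have [_ [/= [n nl <-] le]] := lU _ _ pU (nbhsx_ballx l e e0).
by exfalso; apply: nl => /=; move: le; rewrite /ball/= distrC.
Qed.

Variables (c C : R) (a : R -> R) (G : (R -> R) -> R).
Hypotheses (c0 : 0 < c) (C0 : 0 <= C) (aL : L2 T a).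
Hypothesis GC : forall u v d, L2 T u -> L2 T v -> 0 <= d ->
  (forall t, 0 <= t <= T -> `|prim T u t - prim T v t| <= d) ->
  `|G u - G v| <= C * d.

(** Used twice: with [a = 0] and the trajectory cost for an agent, and with [a = c0 Q] and minus the
    averaged value for the price. *)
Definition energy v : R := c * nrm2 (fun t => v t + a t) + G v.

Lemma prim_norm_le v t (d : R) : L2 T v -> 0 <= d -> T * nrm2 v <= d ^+ 2 ->
  `|prim T v t| <= d.
Proof.
move=> vL d0 vd; rewrite -(ler_pXn2r (n := 2)) ?nnegrE// real_normK ?num_real//.
exact: le_trans (prim_bound T0 t vL) vd.
Qed.

Lemma G_lip u v (d : R) : L2 T u -> L2 T v -> 0 <= d ->
  T * nrm2 (fun t => u t - v t) <= d ^+ 2 -> `|G u - G v| <= C * d.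
Proof.
move=> uL vL d0 uvd; apply: GC => // t _.
by rewrite -primB//; apply: prim_norm_le => //; exact: L2B.
Qed.

Lemma energy_coercive : exists K, forall v, L2 T v ->
  c / 2 * nrm2 (fun t => v t + a t) <= energy v + K.
Proof.
(* The Lipschitz term costs at most [C] times the square root of [T s], which is below
   [d s + T / (4 d)] for every positive [d]. This [d] makes [C d <= c / 2], so half of the quadratic
   term absorbs the loss; [C + 1] covers [C = 0]. *)
pose d := c / (2 * (C + 1)).
have C1 : 0 < C + 1 by rewrite ltr_pwDr.
have d0 : 0 < d by rewrite divr_gt0// mulr_gt0.
exists (C * (T / (4 * d)) - G (fun t => - a t)) => v vL.
set s := nrm2 _; have s0 : 0 <= s by exact: ip_ge0.
have e0 : 0 <= d * s + T / (4 * d).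
  apply: addr_ge0; first exact: mulr_ge0 (ltW d0) s0.
  by apply: divr_ge0; [exact: ltW|apply: mulr_ge0 => //; exact: ltW].
have := G_lip (L2N aL) vL e0.
have -> : nrm2 (fun t => - a t - v t) = s.
  by apply: eq_Rintegral => t _; rewrite -opprD mulrNN addrC.
have h : (d * s + T / (4 * d)) ^+ 2 = T * s + (d * s - T / (4 * d)) ^+ 2.
  by field; rewrite gt_eqF.
rewrite h lerDl sqr_ge0 => /(_ isT); rewrite ler_norml => /andP[_].
have Cd : C * d <= c / 2.
  rewrite /d [C * _]mulrA ler_pdivrMr ?mulr_gt0//.
  have -> : c / 2 * (2 * (C + 1)) = C * c + c by field.
  by rewrite lerDl ltW.
rewrite /energy -/s mulrDr mulrA.
have : C * d * s <= c / 2 * s by rewrite ler_wpM2r.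
have -> : c * s = c / 2 * s + c / 2 * s by field.
lra.
Qed.

Section Minimizing_sequence.
Variables (m : R) (v : nat -> R -> R).
Hypotheses (vL : forall n, L2 T (v n)).
Hypothesis m_lb : forall u, L2 T u -> m <= energy u.
Hypothesis vm : forall n, energy (v n) <= m + n.+1%:R^-1.

Let va n : R -> R := fun t => v n t + a t.
Let vaL n : L2 T (va n). Proof. exact: L2D. Qed.

Let bounded : exists2 B, 0 < B & forall n, nrm2 (va n) <= B.
Proof.
have [K HK] := energy_coercive.
exists (1 + `|2 / c * (m + 1 + K)|); first by rewrite ltr_pwDl.
move=> n; have := HK _ (vL n); rewrite -/(va n) => h.
apply: (@le_trans _ _ (2 / c * (m + 1 + K))); last by rewrite (le_trans (ler_norm _))// lerDr.
rewrite -ler_pdivrMl ?divr_gt0//.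
have -> : (2 / c)^-1 * nrm2 (va n) = c / 2 * nrm2 (va n) by field; rewrite gt_eqF.
apply: le_trans h _; rewrite lerD2r (le_trans (vm n))// lerD2l.
by rewrite invf_le1// ler1n.
Qed.

(** The norm bound is on the shifted functions [va n], whose primitives have the same differences as
    those of [v n]. *)
Let prim_va n k t : prim T (va n) t - prim T (va k) t = prim T (v n) t - prim T (v k) t.
Proof. by rewrite /va !primD//; ring. Qed.

(* By Hölder continuity of the primitives it suffices to control them on a finite grid, where they converge along the ultrafilter. *)
Let prim_Cauchy (U : set_system nat) : UltraFilter U -> forall e, 0 < e ->
  exists2 A, U A & forall n k, A n -> A k -> forall t, 0 <= t <= T ->
    `|prim T (v n) t - prim T (v k) t| <= e.
Proof.
move=> UU e e0; have [B B0 vB] := bounded.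
have e40 : 0 < e / 4 by rewrite divr_gt0.
(* On a cell of length [T / K] a primitive varies by at most [e / 4]. For two indices there are two
   such errors and two distances to the limit at the node, each at most [e / 4]. *)
pose K := (Num.truncn (B * T / (e / 4) ^+ 2)).+1.
have K0 : 0 < K%:R :> R by rewrite ltr0n.
have BK : B * (T / K%:R) <= (e / 4) ^+ 2.
  rewrite mulrA ler_pdivrMr// [leRHS]mulrC -ler_pdivrMr ?exprn_gt0//.
  have x0 : 0 <= B * T / (e / 4) ^+ 2.
    by apply: divr_ge0; [apply: mulr_ge0; exact: ltW|exact: sqr_ge0].
  by have /andP[_ /ltW] := truncn_itv x0.
have l t : {l | forall e, 0 < e -> U [set n | `|prim T (va n) t - l| < e]}.
  apply: cid; apply: (@cluster_ultra U _ (1 + T * B)) => // n.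
  apply: prim_norm_le => //; first by rewrite addr_ge0 ?mulr_ge0 ?ltW.
  apply: (@le_trans _ _ (T * B)).
    by apply: ler_wpM2l; [exact: ltW|exact: vB].
  have : 0 <= T * B by rewrite mulr_ge0 ?ltW.
  nra.
pose grid (i : nat) : R := T * (i%:R / K%:R).
pose good i := [set n | `|prim T (va n) (grid i) - sval (l (grid i))| < e / 4].
(* The nodes run from 0 to [K] inclusive, since [t = T] has node index [K]. *)
exists [set n | forall i, (i < K.+1)%N -> good i n].
  by apply: filter_forall_lt => i; exact: (svalP (l (grid i))).
move=> n k An Ak t /andP[t0 tT]; rewrite -prim_va.
pose i := Num.truncn (t * K%:R / T).
have x0 : 0 <= t * K%:R / T.
  by apply: divr_ge0; [exact: mulr_ge0|exact: ltW].
have /andP[ix xi] := truncn_itv x0.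
have iK : (i < K.+1)%N.
  rewrite ltnS -(ler_nat R) (le_trans ix)// ler_pdivrMr// mulrC.
  by apply: ler_wpM2l => //; exact: ltW.
have it : `|t - grid i| <= T / K%:R.
  have g0 : grid i <= t.
    by rewrite /grid mulrA ler_pdivrMr// -ler_pdivlMl// mulrC.
  rewrite ger0_norm ?subr_ge0// lerBlDl /grid.
  have -> : T * (i%:R / K%:R) + T / K%:R = i.+1%:R * T / K%:R.
    by rewrite -natr1; field; rewrite pnatr_eq0.
  by rewrite ler_pdivlMr// -ler_pdivrMr// ltW.
have close j : `|prim T (va j) t - prim T (va j) (grid i)| <= e / 4.
  rewrite -(ler_pXn2r (n := 2)) ?nnegrE ?(ltW e40)// real_normK ?num_real//.
  apply: le_trans (prim_holder _ _ (vaL j)) _; apply: le_trans BK; rewrite mulrC.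
  by apply: ler_pM => //; exact: ip_ge0.
have /= h1 := An _ iK; have /= h2 := Ak _ iK.
have h3 := close n; have h4 := close k.
move: h1 h2 h3 h4; rewrite /good /= !ltr_norml !ler_norml => /andP[? ?] /andP[? ?] /andP[? ?] /andP[? ?].
by apply/andP; split; lra.
Qed.

(** The midpoint of [v n] and [v k] gains a quarter of their squared distance in the quadratic part,
    while its primitive is within [d / 2] of both, so the lack of convexity of [G] costs only
    [C d / 2]. Its energy being at least [m], the gain is bounded. *)
Let parallelogram n k d : 0 <= d -> (forall t, 0 <= t <= T ->
    `|prim T (v n) t - prim T (v k) t| <= d) ->
  c / 4 * nrm2 (fun t => v n t - v k t) <=
    (n.+1%:R^-1 + k.+1%:R^-1) / 2 + C * d / 2.
Proof.
move=> d0 nkd; pose w := fun t => 2^-1 * (v n t + v k t).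
have wL : L2 T w by apply: L2Z; exact: L2D.
have Gw j : (j = n \/ j = k) -> `|G w - G (v j)| <= C * (d / 2).
  move=> jnk; apply: GC => //; first by rewrite divr_ge0.
  move=> t tT; rewrite /w primZ ?primD//; last exact: L2D.
  have := nkd _ tT; rewrite !ler_norml => /andP[? ?].
  by apply/andP; case: jnk => ->; split; lra.
have := Gw n (or_introl erefl); have := Gw k (or_intror erefl).
rewrite !ler_norml => /andP[_ g1] /andP[_ g2].
have := m_lb wL; have := vm n; have := vm k; rewrite /energy.
have -> : nrm2 (fun t => w t + a t) =
    (nrm2 (va n) + nrm2 (va k)) / 2 - nrm2 (fun t => v n t - v k t) / 4.
  have -> : nrm2 (fun t => v n t - v k t) = nrm2 (fun t => va n t + (-1) * va k t).
    by apply: eq_ip => t _; rewrite /va; ring.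
  have -> : nrm2 (fun t => w t + a t) =
      2^-1 ^+ 2 * nrm2 (fun t => va n t + 1 * va k t).
    rewrite expr2 -mulrA -ipZl -?ipZr//; last by apply: L2D => //; exact: L2Z.
    - by apply: eq_ip => t _; rewrite /va /w; field.
    - by apply: L2Z; apply: L2D => //; exact: L2Z.
    - by apply: L2D => //; exact: L2Z.
    - by apply: L2D => //; exact: L2Z.
  by rewrite !ip_sqrD//; field.
rewrite -/(va n) -/(va k).
move: (n.+1%:R^-1) (k.+1%:R^-1) => n' k'.
move: (nrm2 (va n)) (nrm2 (va k)) (nrm2 _) => x y z ? ? ?; lra.
Qed.

Let L2_Cauchy (U : set_system nat) : UltraFilter U -> (\oo `<=` U) ->
  forall e, 0 < e -> exists2 A, U A & forall n k, A n -> A k ->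
    nrm2 (fun t => v n t - v k t) <= e.
Proof.
move=> UU ooU e e0.
have C1 : 0 < C + 1 by rewrite ltr_pwDr.
pose d := c * e / (8 * (C + 1)).
have d0 : 0 < d by rewrite divr_gt0 ?mulr_gt0.
have [A UA Ad] := prim_Cauchy UU d0.
pose B := [set n : nat | n.+1%:R^-1 <= c * e / 8].
exists (A `&` B).
  apply: filterI => //; apply: ooU; rewrite /B/=.
  have e80 : 0 < c * e / 8 by rewrite divr_gt0 ?mulr_gt0.
  have := near_infty_natSinv_lt (PosNum e80); apply: filterS => n /= /ltW.
  by [].
move=> n k [An Bn] [Ak Bk].
have := parallelogram (ltW d0) (Ad _ _ An Ak).
have : C * d <= c * e / 8.
  rewrite /d mulrA ler_pdivrMr ?mulr_gt0//.
  have := mulr_gt0 c0 e0; nra.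
move: Bn Bk; rewrite /B /= => Bn Bk h1.
move: Bn Bk; move: (n.+1%:R^-1) (k.+1%:R^-1) => n' k' Bn Bk h2.
have := mulr_gt0 c0 e0 => ce.
have : c / 4 * nrm2 (fun t => v n t - v k t) <= c / 4 * e by lra.
by rewrite ler_pM2l// divr_gt0.
Qed.

(** Besides a minimizer, this records that the minimizer is approached in norm by the given
    sequence. The last clause is what the stability argument uses. *)
Lemma minimizing_cluster : exists w, [/\ L2 T w, energy w <= m &
  forall e, 0 < e -> exists n, nrm2 (fun t => v n t - w t) <= e].
Proof.
have [U [UU ooU]] := ultraFilterLemma eventually_filter.
have half k : 0 < (2^-1 ^+ k) ^+ 2 :> R by rewrite exprn_gt0// exprn_gt0.
have HA k : {A | U A /\ forall n j, A n -> A j ->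
    nrm2 (fun t => v n t - v j t) <= (2^-1 ^+ k) ^+ 2}.
  by apply: cid; have [A UA HA] := L2_Cauchy UU ooU (half k); exists A.
pose A k := sval (HA k).
(* A choice in [B k] lies in every earlier [A i], which makes consecutive choices geometrically
   close; [k <= n] makes the energies tend to [m]. The chosen indices need not increase. *)
pose B k := [set n | forall i, (i < k.+1)%N -> A i n] `&` [set n | (k <= n)%N].
have UB k : U (B k).
  apply: filterI; last by apply: ooU; exists k.
  by apply: filter_forall_lt => i; exact: (svalP (HA i)).1.
have [s sB] : {s : nat -> nat & forall k, B k (s k)}.
  by apply: choice => k; exact: filter_ex (UB k).
have sk k : (k <= s k)%N by have [] := sB k.
have sA k j : (k <= j)%N -> A k (s j).
  by move=> kj; have [+ _] := sB j; apply; rewrite /= ltnS.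
have vsC k : nm T (fun t => v (s k.+1) t - v (s k) t) <= 2^-1 ^+ k.
  apply: nm_le; first by rewrite exprn_ge0.
  by apply: (svalP (HA k)).2; exact: sA.
have [w wL vw] := L2_complete (fun k => vL (s k)) vsC.
have small e : 0 < e -> exists n, nm T (fun t => v n t - w t) <= e /\ n.+1%:R^-1 <= e.
  move=> e0; have e20 : 0 < e / 2 by rewrite divr_gt0.
  have : \forall k \near \oo, (2^-1 : R) ^+ k < e / 2.
    have := @cvg_expr R 2^-1; rewrite ger0_norm// invf_lt1 ?ltr1n// => /(_ isT).
    by move=> /cvgr0_norm_lt /(_ _ e20); apply: filterS => k; rewrite ger0_norm ?exprn_ge0.
  move=> [N1 _ h1]; have [N2 _ h2] := near_infty_natSinv_lt (PosNum e0).
  exists (s (N1 + N2)%N); split.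
    apply: le_trans (vw _) _; rewrite mulrC -ler_pdivlMr// ltW//.
    by apply: h1 => /=; exact: leq_addr.
  by apply/ltW/h2 => /=; apply: leq_trans (sk _); exact: leq_addl.
exists w; split=> //; last first.
  move=> e e0; have se0 : 0 < Num.sqrt e by rewrite sqrtr_gt0.
  have [n [h _]] := small _ se0; exists n; rewrite -nm_sqr.
  have es : Num.sqrt e ^+ 2 = e by rewrite sqr_sqrtr// ltW.
  by rewrite -es lerXn2r ?nnegrE ?nm_ge0 ?sqrtr_ge0.
have [B0 B00 vB0] := bounded.
(* If [v n] is within [d <= 1] of [w] and has energy at most [m + d], then [w] has energy at most
   [m + L d]. The summands account for the excess of [v n], the quadratic part and the Lipschitz
   part. *)
pose L := 1 + c * (2 * (1 + B0) + 1) + C * (1 + T).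
have L0 : 0 < L.
  rewrite /L -addrA ltr_pwDl// addr_ge0//; apply: mulr_ge0; rewrite ?(ltW c0)//.
    by have := B00; lra.
  by have := T0; lra.
apply/ler_addgt0Pr => e e0.
pose d := Num.min 1 (e / L).
have d0 : 0 < d by rewrite lt_min ltr01 divr_gt0.
have d1 : d <= 1 by rewrite ge_min lexx.
have Ld : L * d <= e by rewrite mulrC -ler_pdivlMr// ge_min lexx orbT.
have [n [nd nn]] := small _ d0.
pose r t := w t - v n t.
have rL : L2 T r by exact: L2B.
have rd : nrm2 r <= d ^+ 2.
  have -> : nrm2 r = nrm2 (fun t => v n t - w t).
    by apply: eq_Rintegral => t _; rewrite /r; ring.
  by rewrite -nm_sqr lerXn2r ?nnegrE ?nm_ge0// ltW.
(* [1 + T] stands in for the square root of [T]. *)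
have G1 : G w - G (v n) <= C * ((1 + T) * d).
  apply: le_trans (ler_norm _) _; apply: G_lip => //.
    by rewrite mulr_ge0 ?addr_ge0 ?ltW.
  rewrite -/r; apply: (@le_trans _ _ (T * d ^+ 2)); first by apply: ler_wpM2l => //; exact: ltW.
  by rewrite exprMn ler_wpM2r ?sqr_ge0//; have := T0; nra.
have Q1 : nrm2 (fun t => w t + a t) <= nrm2 (va n) + 2 * ((1 + B0) * d) + d ^+ 2.
  have -> : nrm2 (fun t => w t + a t) = nrm2 (fun t => va n t + 1 * r t).
    by apply: eq_ip => t _; rewrite /va /r; ring.
  rewrite ip_sqrD// expr1n mul1r mulr1; apply: lerD => //; rewrite lerD2l ler_pM2l//.
  apply: le_trans (ler_norm _) _; apply: le_trans (ip_le_nm _ _) _ => //.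
  apply: ler_pM; rewrite ?nm_ge0//.
    by apply: nm_le; [rewrite addr_ge0// ltW|rewrite (le_trans (vB0 n))//; have := B00; nra].
  by apply: nm_le => //; exact: ltW.
have := vm n; rewrite /energy -/(va n) => h.
have Q2 : c * nrm2 (fun t => w t + a t) <=
    c * nrm2 (va n) + c * (2 * ((1 + B0) * d) + d ^+ 2).
  by rewrite -mulrDr ler_pM2l// addrA.
have Q3 : c * (2 * ((1 + B0) * d) + d ^+ 2) <= c * (2 * (1 + B0) + 1) * d.
  by rewrite -mulrA ler_pM2l//; have := d0; nra.
apply: (@le_trans _ _ (m + L * d)); last by rewrite lerD2l.
rewrite /L; move: h nn G1 Q2 Q3.
move: (n.+1%:R^-1) (nrm2 _) (nrm2 _) (G w) (G (v n)) (c * (2 * (1 + B0) + 1)).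
move=> n' x y z z' q; lra.
Qed.

End Minimizing_sequence.

Lemma energy_bounded_below : has_inf [set energy u | u in L2 T].
Proof.
split; first by exists (energy (cst 0)); exists (cst 0) => //; exact: L2_cst.
have [K HK] := energy_coercive; exists (- K) => _ [u uL <-].
rewrite -subr_ge0 opprK (le_trans _ (HK _ uL))// mulr_ge0 ?ip_ge0//.
by rewrite divr_ge0 ?ltW.
Qed.

Lemma energy_min_exists : exists2 w, L2 T w & forall u, L2 T u -> energy w <= energy u.
Proof.
pose m := inf [set energy u | u in L2 T].
have ml u : L2 T u -> m <= energy u.
  by move=> uL; apply: ge_inf; [exact: energy_bounded_below.2|exists u].
have [v vP] : {v : nat -> R -> R & forall n, L2 T (v n) /\ energy (v n) <= m + n.+1%:R^-1}.
  apply: (@choice _ _ (fun n u => L2 T u /\ energy u <= m + n.+1%:R^-1)) => n.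
  have n0 : 0 < n.+1%:R^-1 :> R by rewrite invr_gt0.
  have [_ [u uL <-] h] := inf_adherent n0 energy_bounded_below.
  by exists u; split=> //; exact: ltW.
have [w [wL wm _]] := minimizing_cluster (fun n => (vP n).1) ml (fun n => (vP n).2).
by exists w => // u uL; apply: le_trans wm (ml _ uL).
Qed.

(** Otherwise some minimizing sequence stays at squared distance more than [e] from [w]; it clusters
    in norm at a minimizer, which by uniqueness coincides with [w]. This serves to show that the
    optimal control moves little when the price is perturbed. *)
Lemma energy_min_stable w : L2 T w -> (forall u, L2 T u -> energy w <= energy u) ->
  (forall u, L2 T u -> energy u <= energy w -> nrm2 (fun t => u t - w t) = 0) ->
  forall e, 0 < e -> exists2 d, 0 < d & forall u, L2 T u ->
    energy u <= energy w + d -> nrm2 (fun t => u t - w t) <= e.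
Proof.
move=> wL wmin wuniq e e0; apply: contrapT => H.
have Hn (n : nat) : exists u, [/\ L2 T u, energy u <= energy w + n.+1%:R^-1 &
    e < nrm2 (fun t => u t - w t)].
  apply: contrapT => H'; apply: H; exists n.+1%:R^-1; first by rewrite invr_gt0.
  by move=> u uL uw; rewrite leNgt; apply/negP => eu; apply: H'; exists u.
have [v vP] := choice Hn.
have vL n : L2 T (v n) by have [] := vP n.
have vw n : energy (v n) <= energy w + n.+1%:R^-1 by have [] := vP n.
have [w' [w'L w'm cl]] := minimizing_cluster vL wmin vw.
have e40 : 0 < e / 4 by rewrite divr_gt0.
have [n hn] := cl _ e40; have [_ _] := vP n.
have h0 := wuniq _ w'L w'm.
have : nm T (fun t => v n t - w t) <= Num.sqrt (e / 4) + 0.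
  rewrite (_ : (fun t => _) = fun t => (v n t - w' t) + (w' t - w t)); last first.
    by apply/funext => t; ring.
  apply: le_trans (nm_triangle (L2B (vL n) w'L) (L2B w'L wL)) _.
  by apply: lerD; rewrite /nm ?h0 ?sqrtr0// ler_sqrt// ltW.
rewrite addr0 -(ler_pXn2r (n := 2)) ?nnegrE ?nm_ge0 ?sqrtr_ge0//.
rewrite nm_sqr sqr_sqrtr; last exact: ltW.
move=> h1 h2; lra.
Qed.

End Minimization.

(** * The problem of a single agent *)

Section C11_functions.
Context {R : realType}.
Implicit Types f : R -> R.

(** The consequences of bounded first and second derivatives used for [V] and [g]. The last clause
    is a Taylor bound that comes from the mean value theorem and the Lipschitz bound on [f']. *)
Definition C11 (M : R) f f' : Prop := [/\ 0 <= M, forall z, `|f' z| <= M,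
  forall a b, `|f a - f b| <= M * `|a - b|,
  forall a b, `|f' a - f' b| <= M * `|a - b| &
  forall a h, `|f (a + h) - f a - f' a * h| <= M * h ^+ 2].

Lemma C11_le (M M' : R) f f' : M <= M' -> C11 M f f' -> C11 M' f f'.
Proof.
move=> MM' [M0 h1 h2 h3 h4]; split=> [|z|a b|a b|a h].
- exact: le_trans MM'.
- exact: le_trans (h1 z) MM'.
- by apply: le_trans (h2 a b) _; rewrite ler_wpM2r.
- by apply: le_trans (h3 a b) _; rewrite ler_wpM2r.
- by apply: le_trans (h4 a h) _; rewrite ler_wpM2r ?sqr_ge0.
Qed.

Lemma mean_value f f' (a b : R) : (forall z : R, is_derive z 1 f (f' z)) ->
  exists2 c, f b - f a = f' c * (b - a) & `|c - a| <= `|b - a|.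
Proof.
move=> df; have cf z : {for z, continuous f}.
  by apply: differentiable_continuous; apply/derivable1_diffP; have [] := df z.
have [ab|ba|->] := ltgtP a b; last by exists b; rewrite ?subrr ?mulr0.
- have [|c] := @MVT _ f f' a b ab (fun z _ => df z).
    by apply: continuous_subspaceT => z; exact: cf.
  rewrite in_itv/= => /andP[ac cb] ->; exists c => //.
  by rewrite !ger0_norm ?subr_ge0 ?lerB ?(ltW ac) ?(ltW ab) ?(ltW cb).
- have [|c] := @MVT _ f f' b a ba (fun z _ => df z).
    by apply: continuous_subspaceT => z; exact: cf.
  rewrite in_itv/= => /andP[bc ca] fba; exists c; first by rewrite -opprB fba; ring.
  by rewrite !ler0_norm ?subr_le0 ?(ltW ca) ?(ltW ba)// !opprB lerB ?(ltW bc).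
Qed.

Lemma bounded_derivatives2_C11 f : bounded_derivatives2 f ->
  exists M, C11 M f (derive1 f).
Proof.
move=> [df ddf [M fM]]; have M0 : 0 <= M.
  by apply: le_trans (fM 0); rewrite addr_ge0.
have f1 z : `|derive1 f z| <= M by apply: le_trans (fM z); rewrite lerDl.
have f2 z : `|derive1 (derive1 f) z| <= M by apply: le_trans (fM z); rewrite lerDr.
have D1 (z : R) : is_derive z 1 f (derive1 f z).
  by apply: DeriveDef; [exact: df|rewrite derive1E].
have D2 (z : R) : is_derive z 1 (derive1 f) (derive1 (derive1 f) z).
  by apply: DeriveDef; [exact: ddf|rewrite derive1E].
have lip2 a b : `|derive1 f a - derive1 f b| <= M * `|a - b|.
  by have [c -> _] := mean_value b a D2; rewrite normrM ler_wpM2r.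
exists M; split=> //.
  by move=> a b; have [c -> _] := mean_value b a D1; rewrite normrM ler_wpM2r.
move=> a h; have [c] := mean_value a (a + h) D1; rewrite addrAC subrr add0r => -> ca.
rewrite -mulrBl normrM -real_normK ?num_real// expr2 mulrA ler_wpM2r//.
by apply: le_trans (lip2 _ _) _; rewrite ler_wpM2l.
Qed.

Lemma lip_continuous (M : R) f : (forall a b, `|f a - f b| <= M * `|a - b|) ->
  continuous f.
Proof.
move=> fM a; apply/cvgrPdist_lt => e e0; near=> b.
have M1 : 0 < `|M| + 1 by rewrite ltr_pwDr.
apply: le_lt_trans (fM a b) _.
have h : `|a - b| < e / (`|M| + 1).
  by near: b; apply/nbhs_ballP; exists (e / (`|M| + 1)) => //=; rewrite divr_gt0.
apply: (@le_lt_trans _ _ ((`|M| + 1) * `|a - b|)).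
  by rewrite ler_wpM2r// (le_trans (ler_norm _))// lerDl.
by rewrite mulrC -ltr_pdivlMr.
Unshelve. all: by end_near. Qed.

End C11_functions.

Section Agent.
Context {R : realType} (T c0 M : R) (V V' g g' : R -> R).
Local Notation mu := (@lebesgue_measure R).
Local Notation D := (`]0, T[%classic : set R).
Local Notation intg f := (mu.-integrable D (EFin \o f)).
Local Notation nrm2 f := (ip T f f).
Implicit Types f h v u z W : R -> R.
Hypothesis T0 : 0 < T.
Hypothesis c00 : 0 < c0.
Hypotheses (hV : C11 M V V') (hg : C11 M g g').

Let mD : measurable (D : set (measurableTypeR R)). Proof. exact: measurable_itv. Qed.
Let M0 : 0 <= M. Proof. by have [] := hV. Qed.
Let cV : continuous V. Proof. by have [_ _ /lip_continuous] := hV. Qed.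
Let cV' : continuous V'. Proof. by have [_ _ _ /lip_continuous] := hV. Qed.

Let muD : mu D = T%:E.
Proof. by rewrite lebesgue_measure_itv/= lte_fin T0 -EFinB subr0. Qed.

Lemma Rintegral_cst_D (k : R) : \int[mu]_(t in D) (cst k t : R) = k * T.
Proof.
rewrite Rintegral_cst//; transitivity (k * fine T%:E) => //.
by congr (_ * fine _); exact: muD.
Qed.

Lemma V_L2 z : L2 T z -> L2 T (V \o z).
Proof.
move=> zL; have mVz : measurable_fun D (V \o z).
  by apply: measurableT_comp (L2_meas zL); exact: continuous_measurable_fun.
have h : L2 T (fun t => `|V 0| + M * `|z t|).
  by apply: L2D; [exact: L2_cst|apply: L2Z; exact: L2_norm].
apply: L2_le mVz h _ => t _ /=.
rewrite [leRHS]ger0_norm ?addr_ge0 ?mulr_ge0//.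
have [_ _ /(_ (z t) 0) + _ _] := hV; rewrite subr0 => hz.
rewrite -lerBlDl (le_trans _ hz)//.
by rewrite (le_trans _ (lerB_normD _ _))// ?opprK ?normrN// lerB_dist.
Qed.

Lemma V'_L2 z : L2 T z -> L2 T (V' \o z).
Proof.
move=> zL; apply: (@L2_bounded _ _ _ M).
  by apply: measurableT_comp (L2_meas zL); exact: continuous_measurable_fun.
by move=> t _ /=; have [_ /(_ (z t))] := hV.
Qed.

Definition tcost z : R := \int[mu]_(t in D) V (z t) + g (z T).

Lemma tcost_lip z1 z2 (d : R) : L2 T z1 -> L2 T z2 -> 0 <= d ->
  (forall t, 0 <= t <= T -> `|z1 t - z2 t| <= d) ->
  `|tcost z1 - tcost z2| <= M * (T + 1) * d.
Proof.
move=> z1L z2L d0 h; rewrite /tcost opprD addrACA.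
rewrite -RintegralB//; [|exact: L2_intg (V_L2 _)..].
rewrite (le_trans (ler_normD _ _))// mulrDr mulrDl mulr1; apply: lerD; last first.
  have [_ _ lg _ _] := hg; apply: le_trans (lg _ _) _.
  by rewrite ler_wpM2l// h// lexx ltW.
have i1 : intg (fun t => V (z1 t) - V (z2 t)).
  by apply: intgB; exact: L2_intg (V_L2 _).
apply: le_trans (le_normr_Rintegral _ i1) _ => //.
rewrite (_ : M * T * d = \int[mu]_(t in D) (cst (M * d) t : R)); last first.
  rewrite Rintegral_cst_D; ring.
apply: le_Rintegral => //; [exact: (integrable_norm i1)|exact: intg_cst|].
move=> t; rewrite /= in_itv/= => /andP[t0 tT].
have [_ _ lV _ _] := hV; apply: le_trans (lV _ _) _.
by rewrite ler_wpM2l// h// !ltW.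
Qed.

(** The derivative of [tcost] at [z] in the direction [h]. *)
Definition dtcost z h : R := ip T (V' \o z) h + g' (z T) * h T.

Lemma tcost_taylor z h : L2 T z -> L2 T h ->
  `|tcost (fun t => z t + h t) - tcost z - dtcost z h| <= M * (nrm2 h + h T ^+ 2).
Proof.
move=> zL hL; rewrite /tcost /dtcost.
have Vzh := L2_intg (V_L2 (L2D zL hL)); have Vz := L2_intg (V_L2 zL).
have V'h := L2_mul_intg (V'_L2 zL) hL.
set A := \int[mu]_(t in D) _; set B := \int[mu]_(t in D) _.
have -> : A + g (z T + h T) - (B + g (z T)) - (ip T (V' \o z) h + g' (z T) * h T) =
  (A - B - ip T (V' \o z) h) + (g (z T + h T) - g (z T) - g' (z T) * h T) by ring.
apply: le_trans (ler_normD _ _) _; rewrite mulrDr; apply: lerD; last by have [] := hg.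
rewrite /A /B /ip -RintegralB// -RintegralB//; last exact: intgB.
apply: le_trans (le_normr_Rintegral _ _) _ => //; first by apply: intgB => //; exact: intgB.
rewrite -RintegralZl//; last exact: L2_mul_intg.
apply: le_Rintegral => //.
- exact: (integrable_norm (intgB (intgB Vzh Vz) V'h)).
- by apply: intgZ; exact: L2_mul_intg.
- by move=> t _; have [_ _ _ _] := hV; apply.
Qed.

Lemma cprimE v s : L2 T v -> cprim T v s = prim T v T - prim T v s.
Proof.
move=> vL; rewrite (@prim_geT _ T v T)//.
have -> : cprim T v s = ip T (fun t => 1 - step s t) v.
  apply: ip_ae => //; [exact: rstep_L2|by apply: L2B; [exact: L2_cst|exact: step_L2]|].
  (* The two indicator functions differ at [t = s] only. *)
  exists [set s]; split; [exact: measurable_set1|exact: lebesgue_measure_set1|].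
  move=> t /=; apply: contra_notP => ts _; rewrite /step.
  by have [st|st|st] := ltgtP s t; rewrite ?subr0 ?subrr//; case: ts.
by rewrite ipBl//; [exact: L2_cst|exact: step_L2].
Qed.

(* The costate: [mom z] has derivative [V' (z s)] and equals [- g' (z T)] at [T]. *)
Definition mom z s : R := prim T (V' \o z) s - prim T (V' \o z) T - g' (z T).

(** Turns a linear functional of the primitive, with terminal weight [G], into an L^2 pairing with
    [v] itself. The costate appears in this way, both for one agent and for the population
    average. *)
Lemma ip_prim_mom k v (G : R) : L2 T k -> L2 T v ->
  ip T k (prim T v) + G * prim T v T =
  - ip T v (fun s => prim T k s - prim T k T - G).
Proof.
move=> kL vL; have pL := prim_L2 T0 kL; have oL := L2_cst T 1.
rewrite ipC ip_prim//.
have -> : ip T v (cprim T k) =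
    ip T v (fun s => - prim T k s + prim T k T * cst 1 s).
  by apply: eq_ip => // s _; rewrite cprimE//= mulr1 addrC.
have -> : ip T v (fun s => prim T k s - prim T k T - G) =
    ip T v (fun s => prim T k s + (- (prim T k T + G)) * cst 1 s).
  by apply: eq_ip => // s _ /=; ring.
rewrite (@prim_geT _ T v T)// !ipDr//; try exact: L2Z; try exact: L2N.
by rewrite !ipZr// ipNr// (ipC T v (cst 1)); ring.
Qed.

Lemma dtcost_prim z v : L2 T z -> L2 T v -> dtcost z (prim T v) = - ip T v (mom z).
Proof. by move=> zL vL; rewrite /dtcost ip_prim_mom//; exact: V'_L2. Qed.

Lemma mom_continuous z : L2 T z -> continuous (mom z).
Proof.
move=> zL s; apply: cvgB; last exact: cvg_cst.
by apply: cvgB; [exact: (prim_continuous (V'_L2 zL))|exact: cvg_cst].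
Qed.

Lemma mom_bound z s : L2 T z -> `|mom z s| <= M * (1 + 2 * T).
Proof.
move=> zL; have P t : `|prim T (V' \o z) t| <= T * M.
  apply: prim_norm_le => //; [exact: V'_L2|by rewrite mulr_ge0// ltW|].
  rewrite exprMn expr2 -mulrA; apply: ler_wpM2l; first exact: ltW.
  rewrite (_ : T * M ^+ 2 = \int[mu]_(t in D) (cst (M ^+ 2) t : R)); last first.
    rewrite Rintegral_cst_D; ring.
  apply: le_Rintegral => //; [by apply: L2_mul_intg; exact: V'_L2|exact: intg_cst|].
  move=> r _; rewrite -expr2 /= -real_normK ?num_real// lerXn2r ?nnegrE//.
  by have [_ h _ _ _] := hV; exact: h.
rewrite /mom; have := P s; have := P T; have [_ /(_ (z T)) + _ _ _] := hg.
rewrite !ler_norml => /andP[? ?] /andP[? ?] /andP[? ?].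
have -> : M * (1 + 2 * T) = M + T * M + T * M by ring.
by apply/andP; split; lra.
Qed.

Lemma mom_L2 z : L2 T z -> L2 T (mom z).
Proof.
move=> zL; apply: (@L2_bounded _ _ _ (M * (1 + 2 * T))); last by move=> t _; exact: mom_bound.
by apply: measurable_funTS; apply: continuous_measurable_fun; exact: mom_continuous.
Qed.

Definition traj (x : R) W u : R -> R := fun t => x + prim T u t - W t.

Lemma traj_L2 x W u : L2 T W -> L2 T u -> L2 T (traj x W u).
Proof.
move=> WL uL; apply: L2B => //; apply: L2D; [exact: L2_cst|exact: prim_L2].
Qed.

Definition Psi (x : R) W u : R := c0 / 2 * nrm2 u + tcost (traj x W u).

Definition is_min (x : R) W u : Prop :=
  L2 T u /\ forall v, L2 T v -> Psi x W u <= Psi x W v.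

Let C := M * (T + 1).
Let C_ge0 : 0 <= C. Proof. by rewrite mulr_ge0// addr_ge0// ltW. Qed.
Let c02 : 0 < c0 / 2. Proof. by rewrite divr_gt0. Qed.

Let PsiE x W u : Psi x W u = energy T (c0 / 2) (cst 0) (fun v => tcost (traj x W v)) u.
Proof. by congr (_ * _ + _); apply: eq_ip => t _; rewrite addr0. Qed.

Let Psi_lip x W : L2 T W -> forall u v d, L2 T u -> L2 T v -> 0 <= d ->
  (forall t, 0 <= t <= T -> `|prim T u t - prim T v t| <= d) ->
  `|tcost (traj x W u) - tcost (traj x W v)| <= C * d.
Proof.
move=> WL u v d uL vL d0 h; apply: tcost_lip => //; [exact: traj_L2..|].
move=> t tT; rewrite /traj (_ : _ - _ = prim T u t - prim T v t) ?h//; ring.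
Qed.

Lemma is_min_exists x W : L2 T W -> exists u, is_min x W u.
Proof.
move=> WL; have [u uL h] := energy_min_exists T0 c02 C_ge0 (L2_cst T 0) (Psi_lip x WL).
by exists u; split=> // v vL; rewrite !PsiE; exact: h.
Qed.

Lemma is_min_stable x W u : L2 T W -> is_min x W u ->
  (forall v, is_min x W v -> nrm2 (fun t => v t - u t) = 0) ->
  forall e, 0 < e -> exists2 d, 0 < d & forall v, L2 T v ->
    Psi x W v <= Psi x W u + d -> nrm2 (fun t => v t - u t) <= e.
Proof.
move=> WL [uL umin] uniq e e0.
have [||d d0 h] := energy_min_stable T0 c02 C_ge0 (L2_cst T 0) (Psi_lip x WL) uL _ _ e0.
- by move=> v vL; rewrite -!PsiE; exact: umin.
- move=> v vL; rewrite -!PsiE => vu; apply: uniq; split=> // w wL.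
  by apply: le_trans vu _; exact: umin.
- by exists d => // v vL; rewrite !PsiE; exact: h.
Qed.

Definition psi (x : R) W : R := inf [set Psi x W u | u in L2 T].

Lemma psi_min x W u : is_min x W u -> psi x W = Psi x W u.
Proof.
move=> [uL umin]; apply/eqP; rewrite eq_le; apply/andP; split.
  apply: ge_inf; last by exists u.
  by exists (Psi x W u) => _ [v vL <-]; exact: umin.
apply: lb_le_inf; first by exists (Psi x W u); exists u.
by move=> _ [v vL <-]; exact: umin.
Qed.

Lemma psi_le x W u : L2 T W -> L2 T u -> psi x W <= Psi x W u.
Proof. by move=> WL uL; have [v vm] := is_min_exists x WL; rewrite (psi_min vm) vm.2. Qed.

(** The start and the drift enter only through [x - W t], so one estimate covers both: it gives
    measurability in [x] and Lipschitz dependence on the price. An optimal control of either problem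
    is tested in the other. *)
Lemma psi_lip x x' W W' (d : R) : L2 T W -> L2 T W' -> 0 <= d ->
  (forall t, 0 <= t <= T -> `|(x - W t) - (x' - W' t)| <= d) ->
  `|psi x W - psi x' W'| <= C * d.
Proof.
move=> WL W'L d0 h.
have H y y' Y Y' : L2 T Y -> L2 T Y' ->
    (forall t, 0 <= t <= T -> `|(y - Y t) - (y' - Y' t)| <= d) ->
    psi y Y <= psi y' Y' + C * d.
  move=> YL Y'L hd; have [u um] := is_min_exists y' Y'L.
  rewrite (psi_min um); apply: le_trans (psi_le y YL um.1) _.
  rewrite /Psi -addrA lerD2l -lerBlDl.
  apply: le_trans (ler_norm _) _; apply: tcost_lip => //; [exact: traj_L2 um.1..|].
  move=> t tT; rewrite /traj (_ : _ - _ = (y - Y t) - (y' - Y' t)) ?hd//; ring.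
have h1 := H _ _ _ _ WL W'L h.
have h2 : psi x' W' <= psi x W + C * d.
  by apply: H => // t tT; rewrite distrC h.
by rewrite ler_norml; apply/andP; split; lra.
Qed.

Lemma psi_measurable W : L2 T W ->
  measurable_fun [set: measurableTypeR R] (fun x => psi x W).
Proof.
move=> WL; apply: continuous_measurable_fun; apply: (@lip_continuous _ C) => x y.
apply: psi_lip => // t _.
by rewrite (_ : _ - _ = x - y)//; ring.
Qed.

Lemma psi_bounded W (B : R) : L2 T W ->
  exists K, forall x, `|x| <= B -> `|psi x W| <= K.
Proof.
move=> WL; exists (`|psi 0 W| + C * B) => x xB.
have x0 : `|psi x W - psi 0 W| <= C * `|x|.
  by apply: psi_lip => // t _; rewrite (_ : _ - _ = x)//; ring.
rewrite -lerBlDl; apply: le_trans (lerB_dist _ _) _; apply: le_trans x0 _.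
by rewrite ler_wpM2l.
Qed.

(** [eta] is minus the gradient of [Psi] at [u]. Moving by [e] along it changes the cost by at most
    [- e N + e^2 K], with [N] the squared norm of [eta], so minimality gives [N <= e K] for every
    positive [e]. *)
Lemma Euler_Lagrange x W u : L2 T W -> is_min x W u ->
  {ae mu, forall t, t \in `]0, T[ -> u t = c0^-1 * mom (traj x W u) t}.
Proof.
move=> WL [uL umin]; set z := traj x W u.
have zL : L2 T z by exact: traj_L2.
have mL := mom_L2 zL.
pose eta t := mom z t - c0 * u t.
have cuL := L2Z c0 uL.
have etaL : L2 T eta by exact: L2B.
have pL := prim_L2 T0 etaL.
pose N := nrm2 eta.
pose K := c0 / 2 * N + M * (nrm2 (prim T eta) + prim T eta T ^+ 2).
have K0 : 0 <= K.
  by rewrite addr_ge0 ?mulr_ge0 ?addr_ge0 ?ip_ge0 ?sqr_ge0// ltW.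
have step e : 0 < e -> N <= e * K.
  move=> e0; have veL : L2 T (fun t => u t + e * eta t) by apply: L2D => //; exact: L2Z.
  have := umin _ veL; rewrite /Psi ip_sqrD// -/z.
  have -> : traj x W (fun t => u t + e * eta t) = fun t => z t + e * prim T eta t.
    apply/funext => t; rewrite /traj primD//; last exact: L2Z.
    by rewrite primZ// /z /traj; ring.
  have := tcost_taylor zL (L2Z e pL).
  have -> : dtcost z (fun t => e * prim T eta t) = - (e * ip T eta (mom z)).
    rewrite -mulrN -dtcost_prim// /dtcost ipZr//; last exact: V'_L2.
    by ring.
  rewrite ipZl//; last exact: L2Z.
  rewrite ipZr//.
  have : N = ip T eta (mom z) - c0 * ip T u eta.
    by rewrite (ipC T u) -ipZr// -ipBr.
  rewrite ler_norml => NE /andP[_ h1] h2.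
  rewrite -(ler_pM2l e0) mulrA /K.
  move: NE h1 h2; rewrite -/N.
  move: (ip T u eta) (ip T eta (mom z)) (nrm2 (prim T eta)) (prim T eta T) (nrm2 u).
  move=> a b p q r NE h1 h2; rewrite NE; rewrite NE in h2; nra.
have N0 : N <= 0.
  rewrite leNgt; apply/negP => N0.
  have K1 : 0 < 2 * (K + 1) by rewrite mulr_gt0// ltr_pwDr.
  have := step _ (divr_gt0 N0 K1); rewrite mulrAC ler_pdivlMr//.
  have := N0; have := K0; nra.
have := ip_eq0_ae etaL; rewrite -/N => /(_ _)/[dup].
have NE : N = 0 by apply/eqP; rewrite eq_le N0 ip_ge0.
move=> /(_ NE) + _; apply: filterS; first exact: (ae_filter_ringOfSetsType mu).
move=> t h tD; have /eqP := h tD; rewrite /eta subr_eq0 => /eqP ->.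
by rewrite mulKf ?gt_eqF.
Qed.

(** Turns an identity valid almost everywhere into one valid at every time. The integrand on the
    right is continuous, so the primitive can be differentiated at each interior time. *)
Lemma is_min_prim x W u : L2 T W -> is_min x W u ->
  prim T u = prim T (fun t => c0^-1 * mom (traj x W u) t).
Proof.
move=> WL um; apply/funext => t; rewrite /prim ipC [RHS]ipC; have [uL _] := um.
apply: ip_ae => //; [|exact: step_L2|exact: Euler_Lagrange].
by apply: L2Z; apply: mom_L2; exact: traj_L2.
Qed.

End Agent.

(** * Ordering of the optimal trajectories *)

Section Real_analysis.
Context {R : realType}.
Implicit Types f h A : R -> R.

Lemma continuous_eq_left f h (a b : R) : a < b -> continuous f -> continuous h ->
  (forall t, a < t < b -> f t = h t) -> f b = h b.
Proof.
move=> ab cf ch fh.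
have A : f t @[t --> b^'-] --> f b by apply: cvg_at_left_filter; exact: cf.
have B : f t @[t --> b^'-] --> h b.
  apply: cvg_trans (cvg_at_left_filter (ch b)); apply: near_eq_cvg.
  near=> t; symmetry; apply: fh; apply/andP; split; last by near: t; exact: nbhs_left_lt.
  by near: t; exact: nbhs_left_gt.
exact: norm_cvg_unique A B.
Unshelve. all: by end_near. Qed.

Lemma continuous_eq_right f h (a b : R) : a < b -> continuous f -> continuous h ->
  (forall t, a < t < b -> f t = h t) -> f a = h a.
Proof.
move=> ab cf ch fh.
have A : f t @[t --> a^'+] --> f a by apply: cvg_at_right_filter; exact: cf.
have B : f t @[t --> a^'+] --> h a.
  apply: cvg_trans (cvg_at_right_filter (ch a)); apply: near_eq_cvg.
  near=> t; symmetry; apply: fh; apply/andP; split; first by near: t; exact: nbhs_right_gt.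
  by near: t; exact: nbhs_right_lt.
exact: norm_cvg_unique A B.
Unshelve. all: by end_near. Qed.

(** [A t] times [exp (- K t)] is nonincreasing and [A t] times [exp (K t)] is nondecreasing, so the
    zero at [s] propagates forward and backward. *)
Lemma gronwall_eq0 A dA (K a b s : R) : continuous A -> (forall t, 0 <= A t) ->
  (forall t, a < t < b -> is_derive t 1 A (dA t)) ->
  (forall t, a < t < b -> `|dA t| <= K * A t) ->
  a <= s <= b -> A s = 0 -> forall t, a <= t <= b -> A t = 0.
Proof.
move=> cA A0 AdA AK /andP[as_ sb] As t /andP[at_ tb].
have dexp (k r : R) : is_derive r 1 (fun x => expR (k * x)) (k * expR (k * r)).
  have h1 : is_derive r 1 (fun x : R => k * x) k.
    by apply: is_derive_eq; rewrite /GRing.scale/= mulr1.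
  by have := is_derive1_comp (is_derive_expR (k * r)) h1; rewrite mulrC.
have dB (k r : R) : a < r < b -> is_derive r 1 (A * (fun x => expR (k * x)))
    ((dA r + k * A r) * expR (k * r)).
  move=> rab; have := is_deriveM (AdA _ rab) (dexp k r).
  by rewrite /GRing.scale/= (_ : _ + _ = (dA r + k * A r) * expR (k * r))//; ring.
have cB (k : R) : continuous (A * (fun x => expR (k * x))).
  move=> r; apply: cvgM; first exact: cA.
  have : {for r, continuous (fun x => expR (k * x))}.
    by apply: differentiable_continuous; apply/derivable1_diffP; have [] := dexp k r.
  exact.
have mv (k x y : R) : x < y -> a <= x -> y <= b -> exists2 r, a < r < b &
   A y * expR (k * y) - A x * expR (k * x) = (dA r + k * A r) * expR (k * r) * (y - x).
  move=> xy ax yb.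
  have dBx r : r \in `]x, y[ -> is_derive r 1 (A * (fun x => expR (k * x)))
      ((dA r + k * A r) * expR (k * r)).
    rewrite in_itv/= => /andP[xr ry]; apply: dB.
    by rewrite (le_lt_trans ax xr) (lt_le_trans ry yb).
  have [r] := MVT xy dBx (continuous_subspaceT (cB k)).
  rewrite in_itv/= => /andP[xr ry] E; exists r => //.
  by rewrite (le_lt_trans ax xr) (lt_le_trans ry yb).
have [st|ts|<-//] := ltgtP s t.
- have [r rab] := mv (- K) _ _ st as_ tb; rewrite As mul0r subr0 => E.
  apply/eqP; rewrite eq_le A0 andbT -(pmulr_lle0 _ (expR_gt0 (- K * t))) E.
  rewrite -mulrA; apply: mulr_le0_ge0; last first.
    by rewrite mulr_ge0 ?expR_ge0// subr_ge0 ltW.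
  by have := AK _ rab; rewrite ler_norml => /andP[_]; lra.
- have [r rab] := mv K _ _ ts at_ sb; rewrite As mul0r sub0r => E.
  apply/eqP; rewrite eq_le A0 andbT -(pmulr_lle0 _ (expR_gt0 (K * t))).
  rewrite -oppr_ge0 E -mulrA; apply: mulr_ge0; last first.
    by rewrite mulr_ge0 ?expR_ge0// subr_ge0 ltW.
  by have := AK _ rab; rewrite ler_norml => /andP[+ _]; lra.
Qed.

End Real_analysis.

(** * Concatenation of two controls *)

Section Glue.
Context {R : realType} (T : R).
Local Notation D := (`]0, T[%classic : set R).
Local Notation nrm2 f := (ip T f f).
Hypothesis T0 : 0 < T.
Implicit Types f h u v z : R -> R.

Definition glue (s : R) u v : R -> R := fun t => if t <= s then u t else v t.

Lemma glue_split s u v t : glue s u v t = step s t * u t + (1 - step s t) * v t.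
Proof. by rewrite /glue /step; case: ifP => _ /=; ring. Qed.

Lemma step_mul_L2 s u : L2 T u -> L2 T (fun t => step s t * u t).
Proof.
move=> uL; apply: (L2_le _ uL).
  by apply: measurable_funM; [exact: L2_meas (step_L2 T s)|exact: L2_meas].
move=> t _; rewrite normrM /step; case: (t <= s); first by rewrite normr1 mul1r.
by rewrite normr0 mul0r.
Qed.

Lemma glue_L2 s u v : L2 T u -> L2 T v -> L2 T (glue s u v).
Proof.
move=> uL vL; have h : L2 T (fun t => step s t * u t + (v t - step s t * v t)).
  by apply: L2D; [exact: step_mul_L2|apply: L2B => //; exact: step_mul_L2].
by apply: eq_L2 h => t _; rewrite glue_split; ring.
Qed.

Lemma prim_glue_le s u v t : t <= s -> prim T (glue s u v) t = prim T u t.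
Proof.
move=> ts; apply: eq_Rintegral => r _; rewrite /step /glue.
by have [rt|_] := leP r t; [rewrite (le_trans rt ts)|rewrite !mul0r].
Qed.

Lemma prim_glue_ge s u v t : L2 T u -> L2 T v -> s <= t ->
  prim T (glue s u v) t = prim T u s + (prim T v t - prim T v s).
Proof.
move=> uL vL st; rewrite /prim -ipBl//; [|exact: step_L2..].
rewrite /ip -RintegralD//; last 2 first.
- by apply: L2_mul_intg => //; exact: step_L2.
- by apply: L2_mul_intg => //; apply: L2B; exact: step_L2.
apply: eq_Rintegral => r _; rewrite /glue /step.
have [rs|sr] /= := leP r s; last by ring.
by rewrite (le_trans rs st) /=; ring.
Qed.

Lemma nrm2_glue s u v : L2 T u -> L2 T v ->
  nrm2 (glue s u v) + nrm2 (glue s v u) = nrm2 u + nrm2 v.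
Proof.
move=> uL vL; rewrite /ip -!RintegralD//; try (by apply: L2_mul_intg => //; exact: glue_L2).
by apply: eq_Rintegral => t _; rewrite /glue; case: ifP => _ //; rewrite addrC.
Qed.

Lemma prim_eq_continuous f h (a b c : R) : L2 T f -> L2 T h ->
  continuous f -> continuous h -> 0 <= a -> b <= T ->
  (forall t, a < t < b -> prim T f t = prim T h t + c) ->
  forall t, a < t < b -> f t = h t.
Proof.
move=> fL hL cf ch a0 bT fh t /andP[at_ tb].
have tD : t \in `]0, T[ by rewrite in_itv/= (le_lt_trans a0 at_) (lt_le_trans tb bT).
have [_ <-] := prim_is_derive fL tD (cf t).
rewrite (@near_eq_derive _ _ _ (prim T f) (fun s => prim T h s + c)).
  have [_ ->] := is_deriveD (prim_is_derive hL tD (ch t)) (is_derive_cst c t 1).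
  by rewrite addr0.
have : nbhs t `]a, b[%classic.
  by apply: open_nbhs_nbhs; split; [exact: interval_open|rewrite /= in_itv/= at_].
by apply: filterS => s /=; rewrite in_itv/= => /fh.
Qed.

End Glue.

(** * Crossing of optimal trajectories *)

Section Crossing.
Context {R : realType} (T c0 M : R) (V V' g g' : R -> R).
Local Notation mu := (@lebesgue_measure R).
Local Notation D := (`]0, T[%classic : set R).
Local Notation nrm2 f := (ip T f f).
Implicit Types f h v u z : R -> R.
Hypothesis T0 : 0 < T.
Hypothesis c00 : 0 < c0.
Hypotheses (hV : C11 M V V') (hg : C11 M g g').
Variable W : R -> R.
Hypotheses (WL : L2 T W) (cW : continuous W).
Local Notation is_min := (is_min T c0 V g).
Local Notation mom := (mom T V' g').
Local Notation trj x u := (traj T x W u).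

Let mD : measurable (D : set (measurableTypeR R)). Proof. exact: measurable_itv. Qed.
Let M0 : 0 <= M. Proof. by have [] := hV. Qed.
Let cV' : continuous V'. Proof. by have [_ _ _ /lip_continuous] := hV. Qed.
Let zL x u : L2 T u -> L2 T (trj x u). Proof. exact: traj_L2. Qed.
Let cmL u x : L2 T u -> L2 T (fun t => c0^-1 * mom (trj x u) t).
Proof. by move=> uL; apply: L2Z; exact: (mom_L2 T0 hV hg (zL x uL)). Qed.

Lemma traj_continuous x u : L2 T u -> continuous (trj x u).
Proof.
move=> uL t; apply: cvgB; last exact: cW.
by apply: cvgD; [exact: cvg_cst|exact: prim_continuous].
Qed.

Let cm_continuous u x : L2 T u -> continuous (fun t => c0^-1 * mom (trj x u) t).
Proof.
move=> uL t; apply: cvgM; first exact: cvg_cst.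
exact: (mom_continuous hV (zL x uL)).
Qed.

Lemma mom_derive z t : L2 T z -> continuous z -> t \in `]0, T[ ->
  is_derive t 1 (mom z) (V' (z t)).
Proof.
move=> zL' cz tD; have cVz : {for t, continuous (V' \o z)}.
  by apply: continuous_comp; [exact: cz|exact: cV'].
have h : is_derive t 1 (prim T (V' \o z)) (V' (z t)).
  exact: (prim_is_derive (V'_L2 hV zL') tD cVz).
have := is_deriveB (is_deriveB h (is_derive_cst (prim T (V' \o z) T) t 1)) (is_derive_cst (g' (z T)) t 1).
by rewrite !subr0.
Qed.

Lemma Hamilton_unique x1 x2 u1 u2 s : is_min x1 W u1 -> is_min x2 W u2 ->
  0 <= s <= T -> trj x1 u1 s = trj x2 u2 s ->
  mom (trj x1 u1) s = mom (trj x2 u2) s ->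
  forall t, 0 <= t <= T -> trj x1 u1 t = trj x2 u2 t.
Proof.
move=> m1 m2 sT; set z1 := trj x1 u1; set z2 := trj x2 u2 => z12 m12 t tT.
have [u1L _] := m1; have [u2L _] := m2.
pose d r := z1 r - z2 r; pose q r := mom z1 r - mom z2 r.
pose k r := V' (z1 r) - V' (z2 r).
(* The common drift [W] cancels, so [d] is differentiable at each interior time even where the two
   trajectories are not. *)
have dE : d = fun r => (x1 - x2) + (prim T (fun t => c0^-1 * mom z1 t) r - prim T (fun t => c0^-1 * mom z2 t) r).
  apply/funext => r; rewrite /d /z1 /z2 -(is_min_prim T0 c00 hV hg WL m1).
  by rewrite -(is_min_prim T0 c00 hV hg WL m2) /traj; ring.
have dd r : 0 < r < T -> is_derive r 1 d (c0^-1 * q r).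
  move=> rT; have rD : r \in `]0, T[ by rewrite in_itv.
  have d1 := prim_is_derive (cmL x1 u1L) rD (@cm_continuous u1 x1 u1L r).
  have d2 := prim_is_derive (cmL x2 u2L) rD (@cm_continuous u2 x2 u2L r).
  rewrite dE; have -> : c0^-1 * q r = 0 + (c0^-1 * mom z1 r - c0^-1 * mom z2 r).
    by rewrite /q; ring.
  exact: (is_deriveD (is_derive_cst (x1 - x2) r 1) (is_deriveB d1 d2)).
have dq r : 0 < r < T -> is_derive r 1 q (k r).
  move=> rT; have rD : r \in `]0, T[ by rewrite in_itv.
  by apply: is_deriveB; apply: mom_derive => //; (exact: zL||exact: traj_continuous).
pose A : R -> R := d * d + q * q.
have AE r : A r = d r ^+ 2 + q r ^+ 2 by rewrite !expr2.
have dA r : 0 < r < T -> is_derive r 1 A (2 * d r * (c0^-1 * q r) + 2 * q r * k r).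
  move=> rT; have := is_deriveD (is_deriveM (dd _ rT) (dd _ rT)) (is_deriveM (dq _ rT) (dq _ rT)).
  rewrite /GRing.scale/= (_ : _ + _ = 2 * d r * (c0^-1 * q r) + 2 * q r * k r)//; ring.
have cA : continuous A.
  have cd : continuous d.
    by move=> r; apply: cvgB; exact: traj_continuous.
  have cq : continuous q.
    by move=> r; apply: cvgB; [exact: (mom_continuous hV (zL x1 u1L))|exact: (mom_continuous hV (zL x2 u2L))].
  by move=> r; apply: cvgD; apply: cvgM; (exact: cd||exact: cq).
(* Since [2 |d| |q| <= A], the term in [d q] contributes the rate [1 / c0], and the term in [q k]
   the rate [M], by the Lipschitz bound on [V']. *)
have := @gronwall_eq0 _ A _ (c0^-1 + M) 0 T s cA _ dA _ sT _ _ tT.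
have : forall t, 0 <= A t by move=> r; rewrite AE addr_ge0 ?sqr_ge0.
move=> /[swap]/[apply].
have : forall t, 0 < t < T -> `|2 * d t * (c0^-1 * q t) + 2 * q t * k t| <= (c0^-1 + M) * A t.
  move=> r rT; apply: le_trans (ler_normD _ _) _; rewrite [leRHS]mulrDl; apply: lerD.
    have -> : 2 * d r * (c0^-1 * q r) = c0^-1 * (2 * d r * q r) by ring.
    rewrite normrM gtr0_norm ?invr_gt0// ler_pM2l ?invr_gt0// AE ler_norml.
    have := sqr_ge0 (d r - q r); have := sqr_ge0 (d r + q r).
    by move=> ? ?; apply/andP; split; nra.
  have : `|k r| <= M * `|d r| by have [_ _ _ h _] := hV; exact: h.
  rewrite normrM normrM (ger0_norm (ler0n R 2)) AE => kd.
  rewrite -(real_normK (num_real (d r))) -(real_normK (num_real (q r))).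
  have := sqr_ge0 (`|d r| - `|q r|); have := normr_ge0 (q r); have := normr_ge0 (d r).
  move: M0 kd; move: (`|k r|) (`|d r|) (`|q r|) => a b c M0' h b0 c00' h2.
  apply: (@le_trans _ _ (2 * c * (M * b))); first by rewrite ler_wpM2l// mulr_ge0.
  nra.
move=> /[swap]/[apply].
have : A s = 0 by rewrite AE /d /q z12 m12 !subrr expr0n addr0.
move=> /[swap]/[apply] At.
have : d t ^+ 2 = 0.
  by apply/eqP; move: At; rewrite AE => /eqP; rewrite paddr_eq0 ?sqr_ge0// => /andP[].
by move=> /eqP; rewrite sqrf_eq0 subr_eq0 => /eqP.
Qed.

Lemma traj_glue x1 x2 u1 u2 s : L2 T u1 -> L2 T u2 -> trj x1 u1 s = trj x2 u2 s ->
  trj x1 (glue s u1 u2) = glue s (trj x1 u1) (trj x2 u2).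
Proof.
move=> u1L u2L z12; apply/funext => t; rewrite /glue; case: ifPn => [ts|].
  by rewrite /traj -/(glue s u1 u2) prim_glue_le.
rewrite -ltNge => st; rewrite /traj -/(glue s u1 u2) prim_glue_ge// ?ltW//.
by move: z12; rewrite /traj; lra.
Qed.

Lemma tcost_glue s z1 z2 : s < T -> L2 T z1 -> L2 T z2 ->
  tcost T V g (glue s z1 z2) + tcost T V g (glue s z2 z1) = tcost T V g z1 + tcost T V g z2.
Proof.
move=> sT z1L z2L; rewrite /tcost addrACA [RHS]addrACA; congr (_ + _); last first.
  by rewrite /glue leNgt sT/= addrC.
rewrite -!RintegralD//; try (by apply: L2_intg; apply: (V_L2 hV) => //; exact: glue_L2).
by apply: eq_Rintegral => t _; rewrite /glue; case: ifP => _ //; rewrite addrC.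
Qed.

(** The two exchanged paths together cost as much as the two optimal ones, and neither can beat the
    optimum for its own starting point; so each is optimal. *)
Lemma is_min_glue x1 x2 u1 u2 s : is_min x1 W u1 -> is_min x2 W u2 -> s < T ->
  trj x1 u1 s = trj x2 u2 s -> is_min x1 W (glue s u1 u2).
Proof.
move=> [u1L m1] [u2L m2] sT z12; split; first exact: glue_L2.
move=> v vL; apply: le_trans (m1 _ vL).
have := m2 _ (glue_L2 s u2L u1L).
have := nrm2_glue s u1L u2L; have := tcost_glue sT (zL x1 u1L) (zL x2 u2L).
rewrite /Psi (traj_glue u1L u2L z12) (traj_glue u2L u1L (esym z12)) => e1 e2.
have {}e2 : c0 / 2 * nrm2 (glue s u1 u2) + c0 / 2 * nrm2 (glue s u2 u1) =
  c0 / 2 * nrm2 u1 + c0 / 2 * nrm2 u2 by rewrite -!mulrDr e2.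
lra.
Qed.

(* The trajectory following the first one up to [s] and the second one afterwards is again optimal, so its momentum, being continuous, agrees at [s] with both. *)
Lemma crossing x1 x2 u1 u2 s : is_min x1 W u1 -> is_min x2 W u2 -> 0 < s < T ->
  trj x1 u1 s = trj x2 u2 s ->
  forall t, 0 <= t <= T -> trj x1 u1 t = trj x2 u2 t.
Proof.
move=> m1 m2 /andP[s0 sT] z12.
have m := is_min_glue m1 m2 sT z12; set u := glue s u1 u2 in m.
have [u1L _] := m1; have [u2L _] := m2; have [uL _] := m.
have P := is_min_prim T0 c00 hV hg WL m.
have P1 := is_min_prim T0 c00 hV hg WL m1.
have P2 := is_min_prim T0 c00 hV hg WL m2.
have e1 : c0^-1 * mom (trj x1 u) s = c0^-1 * mom (trj x1 u1) s.
  apply: (continuous_eq_left s0 (cm_continuous (x := x1) uL) (cm_continuous (x := x1) u1L)).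
  apply: (@prim_eq_continuous _ T _ _ 0 s 0 (cmL x1 uL) (cmL x1 u1L)) => //.
  - exact: cm_continuous.
  - exact: cm_continuous.
  - exact: ltW.
  move=> t /andP[_ ts]; rewrite -P -P1 addr0; apply: prim_glue_le; exact: ltW.
have e2 : c0^-1 * mom (trj x1 u) s = c0^-1 * mom (trj x2 u2) s.
  apply: (continuous_eq_right sT (cm_continuous (x := x1) uL) (cm_continuous (x := x2) u2L)).
  apply: (@prim_eq_continuous _ T _ _ s T (prim T u1 s - prim T u2 s) (cmL x1 uL) (cmL x2 u2L)) => //.
  - exact: cm_continuous.
  - exact: cm_continuous.
  - exact: ltW.
  by move=> t /andP[st _]; rewrite -P -P2 /u prim_glue_ge// ?ltW//; ring.
apply: (Hamilton_unique m1 m2 _ z12); first by rewrite !ltW.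
by apply: (mulfI (x := c0^-1)); rewrite ?invr_eq0 ?gt_eqF// -e1 -e2.
Qed.

Lemma traj0 x u : trj x u 0 = x - W 0.
Proof. by rewrite /traj prim_le0// addr0. Qed.

Lemma no_crossing x1 x2 u1 u2 s : is_min x1 W u1 -> is_min x2 W u2 -> x1 < x2 ->
  0 < s < T -> trj x1 u1 s <> trj x2 u2 s.
Proof.
move=> m1 m2 x12 sT z12; have := crossing m1 m2 sT z12.
move=> /(_ 0); rewrite lexx ltW// => /(_ isT); rewrite !traj0 => /addIr.
by move/eqP; rewrite lt_eqF.
Qed.

(** A reversal of order would force a meeting strictly between 0 and [t], by the intermediate value
    theorem. The order is only weak because meeting at [T] itself leaves no tail to exchange and is
    not excluded. *)
Lemma traj_order x1 x2 u1 u2 t : is_min x1 W u1 -> is_min x2 W u2 -> x1 < x2 ->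
  0 <= t <= T -> trj x1 u1 t <= trj x2 u2 t.
Proof.
move=> m1 m2 x12 /andP[t0 tT]; rewrite leNgt; apply/negP => z21.
pose d r := trj x2 u2 r - trj x1 u1 r.
have cd : continuous d.
  by move=> r; apply: cvgB; apply: traj_continuous; [case: m2|case: m1].
have d0 : 0 < d 0 by rewrite /d !traj0; lra.
have dt : d t < 0 by rewrite /d subr_lt0.
have [|r] := @IVT _ d 0 t 0 t0 (continuous_subspaceT cd).
  by rewrite ge_min (ltW dt) orbT le_max (ltW d0).
rewrite in_itv/= => /andP[r0 rt] dr; apply: (@no_crossing x1 x2 u1 u2 r) => //; last first.
  by move/eqP: dr; rewrite subr_eq0 => /eqP.
rewrite lt_neqAle r0 andbT; apply/andP; split.
  by apply: contraTneq d0 => E; rewrite {2}E dr ltxx.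
apply: lt_le_trans tT; rewrite lt_neqAle rt andbT.
by apply: contraTneq dt => <-; rewrite dr ltxx.
Qed.

Lemma traj_order_lt x1 x2 u1 u2 t : is_min x1 W u1 -> is_min x2 W u2 -> x1 < x2 ->
  0 < t < T -> trj x1 u1 t < trj x2 u2 t.
Proof.
move=> m1 m2 x12 tT; rewrite lt_neqAle; apply/andP; split.
  by apply/eqP; exact: no_crossing tT.
by apply: traj_order => //; case/andP: tT => *; rewrite !ltW.
Qed.

Definition unique_min x : Prop := forall u v, is_min x W u -> is_min x W v ->
  nrm2 (fun t => u t - v t) = 0.

(** The trajectory determines the primitive of the control, hence the continuous momentum, hence the
    control almost everywhere. *)
Lemma unique_min_traj x u v : is_min x W u -> is_min x W v ->
  (forall t, 0 <= t <= T -> trj x u t = trj x v t) -> nrm2 (fun t => u t - v t) = 0.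
Proof.
move=> mu_ mv uv; have [uL _] := mu_; have [vL _] := mv.
have EL w := Euler_Lagrange T0 c00 hV hg WL (x := x) (u := w).
have cuL := cmL x uL; have cvL := cmL x vL.
have puv t : 0 <= t <= T -> prim T u t = prim T v t.
  by move=> /uv; rewrite /traj => /addIr/addrI.
have e : forall t, 0 < t < T -> c0^-1 * mom (trj x u) t = c0^-1 * mom (trj x v) t.
  apply: (@prim_eq_continuous _ T _ _ 0 T 0 cuL cvL) => //; [exact: cm_continuous..|].
  move=> t /andP[t0 tT]; rewrite addr0.
  by rewrite -(is_min_prim T0 c00 hV hg WL mu_) -(is_min_prim T0 c00 hV hg WL mv) puv// !ltW.
have uvL := L2B uL vL.
rewrite (@ip_ae _ T _ (cst 0)) => //; last 2 first.
- exact: L2_cst.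
- have := EL _ mv; apply: filterS2 (EL _ mu_); first exact: (ae_filter_ringOfSetsType mu).
  move=> t hu hv tD; rewrite hu// hv// e ?subrr//.
by apply: Rintegral_eq0 => // t _; rewrite mul0r.
Qed.

(* Distinct minimizers from [x] are separated at time [T / 2] by a rational, and by monotonicity different [x] get different rationals. *)
Lemma ae_unique_min : {ae mu, forall x, unique_min x}.
Proof.
pose N := [set x | ~ unique_min x].
have h2 : 0 < T / 2 < T by rewrite divr_gt0//= ltr_pdivrMr// ltr_pMr// ltr1n.
have HN x : N x -> exists q : rat, exists u v, [/\ is_min x W u, is_min x W v &
    trj x u (T / 2) < ratr q < trj x v (T / 2)].
  move=> Nx; apply: contrapT => H; apply: Nx => u v mu_ mv.
  have K u' v' : is_min x W u' -> is_min x W v' ->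
      ~ trj x u' (T / 2) < trj x v' (T / 2).
    by move=> m1 m2 /rat_in_itvoo[q]; rewrite in_itv/= => hq; apply: H; exists q, u', v'.
  apply: (unique_min_traj mu_ mv) => t tT; apply: (crossing mu_ mv h2 _ tT).
  by have [h|h|//] := ltgtP (trj x u (T / 2)) (trj x v (T / 2)); exfalso; [exact: (K u v)|exact: (K v u)].
have /choice[q qP] : forall x, exists q : rat, N x -> exists u v, [/\ is_min x W u, is_min x W v &
    trj x u (T / 2) < ratr q < trj x v (T / 2)].
  move=> x; have [/HN[q Hq]|nx] := pselect (N x); first by exists q.
  by exists 0.
have lt_q x y : N x -> N y -> x < y -> q x < q y.
  move=> Nx Ny xy; have [_ [v [_ mv /andP[_ h1]]]] := qP _ Nx.
  have [u [_ [mu_ _ /andP[h3 _]]]] := qP _ Ny.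
  rewrite -(ltr_rat R); apply: lt_trans h1 _; apply: lt_trans h3.
  exact: traj_order_lt.
have cN : countable N.
  apply/countable_injP; exists (fun x => pickle (q x)) => x y /set_mem Nx /set_mem Ny.
  move=> /(pcan_inj pickleK) qxy; have [h|h|//] := ltgtP x y.
    by have := lt_q _ _ Nx Ny h; rewrite qxy ltxx.
  by have := lt_q _ _ Ny Nx h; rewrite qxy ltxx.
exists N; split=> //; last exact: countable_lebesgue_measure0.
exact: countable_measurable.
Qed.

End Crossing.

(** * From H^1 trajectories to controls *)

Section Nonmeasurable_ae.
Context {R : realType}.
Local Notation mu := (@lebesgue_measure R).
Local Notation RR := (measurableTypeR R).
Import HBNNSimple.

Let ge0_le_ae (f h : RR -> \bar R) (N : set RR) : measurable N -> mu N = 0%E ->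
  (forall t, (0 <= f t)%E) -> (forall t, (0 <= h t)%E) ->
  (forall t, ~ N t -> f t = h t) -> (\int[mu]_t f t <= \int[mu]_t h t)%E.
Proof.
move=> mN N0 f0 h0 fh; rewrite (ge0_integralTE mu f0) (ge0_integralTE mu h0).
apply: ge_ereal_sup => _ [p /= pf <-].
(* Cut off on the null set, the simple function [p] keeps its integral and lies below [h]
   everywhere. *)
pose p' := proj_nnsfun p (measurableC mN).
have -> : sintegral mu p = sintegral mu p'.
  rewrite -!integralT_nnsfun; apply: ge0_ae_eq_integral => //.
  - exact/measurable_EFinP.
  - exact/measurable_EFinP.
  - by move=> t _; rewrite lee_fin.
  - by move=> t _; rewrite lee_fin.
  exists N; split=> // t /=; apply: contra_notP => Nt _.
  by rewrite /p' /= mindicE mem_set// mulr1.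
apply: ereal_sup_ubound; exists p' => //= t.
rewrite mindicE; have [Nt|Nt] := pselect (N t).
  by rewrite memNset ?mulr0//; apply.
by rewrite mem_set// mulr1 -fh.
Qed.

Let ge0_eq_ae (f h : RR -> \bar R) (N : set RR) : measurable N -> mu N = 0%E ->
  (forall t, (0 <= f t)%E) -> (forall t, (0 <= h t)%E) ->
  (forall t, ~ N t -> f t = h t) -> (\int[mu]_t f t = \int[mu]_t h t)%E.
Proof.
move=> mN N0 f0 h0 fh; apply/eqP; rewrite eq_le; apply/andP; split.
  exact: ge0_le_ae fh.
by apply: ge0_le_ae mN N0 h0 f0 _ => t /fh.
Qed.

(* The integral of a function that is not known to be measurable is a supremum over the simple functions below it, hence insensitive to null sets. *)
Lemma integral_ae_eq_fin (D : set RR) (f h : R -> R) :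
  {ae mu, forall t, D t -> f t = h t} ->
  (\int[mu]_(t in D) (f t)%:E = \int[mu]_(t in D) (h t)%:E)%E.
Proof.
move=> [N [mN N0 sN]].
have e t : ~ N t -> ((EFin \o f) \_ D) t = ((EFin \o h) \_ D) t.
  move=> Nt; rewrite !patchE; case: ifPn => // /set_mem Dt /=; congr EFin.
  by apply: contrapT => fh; apply: Nt; apply: sN => /= /(_ Dt).
rewrite integral_mkcond [RHS]integral_mkcond integralE [RHS]integralE.
by congr (_ - _)%E; apply: ge0_eq_ae mN N0 _ _ _ => // t /e et; rewrite ?funeposE ?funenegE et.
Qed.

Lemma Rintegral_ae_eq (D : set RR) (f h : R -> R) :
  {ae mu, forall t, D t -> f t = h t} ->
  \int[mu]_(t in D) f t = \int[mu]_(t in D) h t.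
Proof. by move=> fh; rewrite /Rintegral (integral_ae_eq_fin fh). Qed.

End Nonmeasurable_ae.

(** * Explicit C^1 test functions *)

Section Test_functions.
Context {R : realType}.

Lemma quadratic_is_derive (f : R -> R) (a d K : R) :
  (forall h, `|f (a + h) - f a - d * h| <= K * h ^+ 2) -> is_derive a 1 f d.
Proof.
move=> H; have c : h^-1 *: (f (h *: 1 + a) - f a) @[h --> 0^'] --> d.
  apply/cvgrPdist_lt => e e0; near=> h.
  have h0 : h != 0 by near: h; exact: nbhs_dnbhs_neq.
  have he : `|h| < e / (`|K| + 1).
    near: h; apply: dnbhs0_lt; rewrite divr_gt0// ltr_pwDr//.
  rewrite /GRing.scale/= mulr1 (addrC h a).
  have -> : d - h^-1 * (f (a + h) - f a) = - (h^-1 * (f (a + h) - f a - d * h)) by field.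
  rewrite normrN normrM normfV mulrC ltr_pdivrMr ?normr_gt0//.
  apply: le_lt_trans (H h) _; rewrite -real_normK ?num_real// expr2 mulrA.
  rewrite ltr_pM2r ?normr_gt0//; apply: (@le_lt_trans _ _ ((`|K| + 1) * `|h|)).
    by rewrite ler_wpM2r// (le_trans (ler_norm _))// lerDl.
  by rewrite mulrC -ltr_pdivlMr// ltr_pwDr.
apply: DeriveDef; first by apply/cvg_ex; exists d.
by rewrite /derive; apply/cvg_lim => //; exact: Rhausdorff.
Unshelve. all: by end_near. Qed.

Definition pos (x : R) : R := Num.max 0 x.

Lemma posE x : pos x = if 0 <= x then x else 0.
Proof. by rewrite /pos; case: leP. Qed.

Lemma pos_sqr_derive (x : R) : is_derive x 1 (fun y => pos y ^+ 2) (2 * pos x).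
Proof.
apply: (@quadratic_is_derive _ _ _ 1) => h; rewrite mul1r ler_norml !posE.
by case: (lerP 0 (x + h)) => ?; case: (lerP 0 x) => ?; apply/andP; split; nra.
Qed.

Lemma pos_continuous : continuous pos.
Proof.
apply: (@lip_continuous _ 1) => a b; rewrite mul1r !posE ler_norml.
have := ler_norm (a - b); have := ler_norm (b - a); rewrite (distrC b) => ? ?.
by case: (lerP 0 a) => ?; case: (lerP 0 b) => ?; apply/andP; split; lra.
Qed.

(* The primitive of [tent e]: [bump e (y - a) - bump e (y - b)] is a C^1 test function whose derivative has mass concentrated near [a] and [b]. *)
Definition bump (e x : R) : R := pos (x + e) ^+ 2 - 2 * pos x ^+ 2 + pos (x - e) ^+ 2.
Definition tent (e x : R) : R := 2 * pos (x + e) - 2 * (2 * pos x) + 2 * pos (x - e).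

Let shift_derive (a e x : R) : is_derive x 1 (fun y => pos (y - a + e) ^+ 2) (2 * pos (x - a + e)).
Proof.
have h : is_derive x 1 (fun y : R => y - a + e) 1.
  by apply: is_derive_eq; rewrite subr0 addr0.
have := @is_derive1_comp _ (fun y => pos y ^+ 2) (fun y => y - a + e) x _ _
  (pos_sqr_derive (x - a + e)) h.
by rewrite mulr1.
Qed.

Lemma bump_derive (a e x : R) : is_derive x 1 (fun y => bump e (y - a)) (tent e (x - a)).
Proof.
have h0 := shift_derive a e x; have h1 := shift_derive a 0 x; have h2 := shift_derive a (- e) x.
have h3 : is_derive x 1 (fun y => 2 * pos (y - a) ^+ 2) (2 * (2 * pos (x - a))).
  by have := is_deriveZ 2 h1; under eq_fun do rewrite addr0; rewrite addr0.
exact: (is_deriveD (is_deriveB h0 h3) h2).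
Qed.

Lemma bump_left (e x : R) : 0 < e -> x <= - e -> bump e x = 0.
Proof.
move=> e0 xe; rewrite /bump !posE.
by case: (lerP 0 (x + e)) => ?; case: (lerP 0 x) => ?; case: (lerP 0 (x - e)) => ?; nra.
Qed.

Lemma bump_right (e x : R) : 0 < e -> e <= x -> bump e x = 2 * e ^+ 2.
Proof.
move=> e0 xe; rewrite /bump !posE.
case: (lerP 0 (x + e)) => ?; case: (lerP 0 x) => ?; case: (lerP 0 (x - e)) => ?; try (exfalso; lra).
ring.
Qed.

Lemma tent_out (e x : R) : 0 < e -> e <= `|x| -> tent e x = 0.
Proof.
move=> e0; rewrite ler_normr /tent !posE => /orP[xe|xe];
by case: (lerP 0 (x + e)) => ?; case: (lerP 0 x) => ?; case: (lerP 0 (x - e)) => ?; lra.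
Qed.

Lemma tent_in (e x : R) : `|x| < e -> tent e x = 2 * (e - `|x|).
Proof.
rewrite /tent !posE => /[dup]; rewrite {1}ltr_norml => /andP[? ?] _.
case: (lerP 0 (x + e)) => ?; case: (lerP 0 (x - e)) => ?; try (exfalso; lra).
by case: (lerP 0 x) => ?; [rewrite ger0_norm//; lra|rewrite ltr0_norm//; lra].
Qed.

Lemma tent_continuous (a e : R) : continuous (fun x => tent e (x - a)).
Proof.
have P (b : R) : continuous (fun x : R => pos (x - a + b)).
  move=> x; apply: (@continuous_comp _ _ _ (fun x : R => x - a + b) pos).
    by apply: cvgD; [apply: cvgB; [exact: cvg_id|exact: cvg_cst]|exact: cvg_cst].
  exact: pos_continuous.
have P0 : continuous (fun x : R => pos (x - a)).
  by have := P 0; under eq_fun do rewrite addr0.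
move=> x; apply: cvgD; last by apply: cvgM; [exact: cvg_cst|exact: P].
apply: cvgB; first by apply: cvgM; [exact: cvg_cst|exact: P].
apply: cvgM; first exact: cvg_cst.
by apply: cvgM; [exact: cvg_cst|exact: P0].
Qed.

Lemma C1c_bump (T a b e : R) : 0 < e -> 0 < a - e -> a < b -> b + e < T ->
  C1c T (fun x => bump e (x - a) - bump e (x - b)).
Proof.
move=> e0 ae ab be.
have d x := is_deriveB (bump_derive a e x) (bump_derive b e x).
split.
- by move=> x; have [] := d x.
- have -> : derive1 (fun x => bump e (x - a) - bump e (x - b)) =
      fun x => tent e (x - a) - tent e (x - b).
    by apply/funext => x; rewrite derive1E; have [_ ->] := d x.
  by move=> x; apply: cvgB; exact: tent_continuous.
- exists `[a - e, b + e]%classic; split; first exact: segment_compact.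
    move=> x /=; rewrite !in_itv/= => /andP[? ?]; apply/andP; split; lra.
  move=> x /= xK; have [xa|ax] := lerP x (a - e).
    by rewrite !bump_left ?subrr//; lra.
  have bx : b + e < x.
    by rewrite ltNge; apply/negP => xb; apply: xK; rewrite in_itv/= xb ltW.
  by rewrite !bump_right ?subrr//; lra.
Qed.

End Test_functions.

(** * H^1 functions are primitives of L^2 functions *)

Section H1_functions.
Context {R : realType} (T : R).
Local Notation mu := (@lebesgue_measure R).
Local Notation RR := (measurableTypeR R).
Local Notation D := (`]0, T[%classic : set R).
Local Notation intg f := (mu.-integrable D (EFin \o f)).
Hypothesis T0 : 0 < T.
Implicit Types f h u v w z : R -> R.

Let mD : measurable (D : set RR). Proof. exact: measurable_itv. Qed.

Lemma continuous_L2 f : continuous f -> L2 T f.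
Proof.
move=> cf; apply/L2P; split.
  by apply: measurable_funTS; exact: continuous_measurable_fun.
have i : mu.-integrable `[0, T] (EFin \o (fun t => f t ^+ 2)).
  apply: continuous_compact_integrable; first exact: segment_compact.
  by apply: continuous_subspaceT => t; apply: cvgM; exact: cf.
by apply: integrableS i => //; exact: subset_itv_oo_cc.
Qed.

Lemma prim_derive1 f t : (forall s, derivable f s 1) -> continuous (derive1 f) ->
  0 <= t <= T -> prim T (derive1 f) t = f t - f 0.
Proof.
move=> df cf' /andP[t0 tT]; have f'L := continuous_L2 cf'.
have [->|tn0] := eqVneq t 0; first by rewrite prim_le0// subrr.
have {}t0 : 0 < t by rewrite lt_neqAle eq_sym tn0.
have cf : continuous f.
  by move=> s; apply: differentiable_continuous; apply/derivable1_diffP; exact: df.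
have dd s : s \in `]0, t[ -> is_derive s 1 (prim T (derive1 f) - f) (derive1 f s - derive1 f s).
  rewrite in_itv/= => /andP[s0 st]; apply: is_deriveB.
    have sD : s \in `]0, T[ by rewrite in_itv/= s0 (lt_le_trans st).
    exact: (prim_is_derive f'L sD (cf' s)).
  by apply: DeriveDef; [exact: df|rewrite derive1E].
have cc : continuous (prim T (derive1 f) - f).
  by move=> s; apply: cvgB; [exact: prim_continuous|exact: cf].
have [s _] := MVT t0 dd (continuous_subspaceT cc).
rewrite subrr mul0r => /eqP; rewrite subr_eq0 => /eqP.
have -> : (prim T (derive1 f) - f) t = prim T (derive1 f) t - f t by [].
have -> : (prim T (derive1 f) - f) 0 = prim T (derive1 f) 0 - f 0 by [].
by rewrite (@prim_le0 _ T (derive1 f) 0)// => h; lra.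
Qed.

Lemma C1c_ends psi : C1c T psi -> psi 0 = 0 /\ psi T = 0.
Proof.
move=> [_ _ [K [_ KD Kpsi]]]; split; apply: Kpsi => /KD /=.
  by rewrite in_itv/= ltxx.
by rewrite in_itv/= ltxx andbF.
Qed.

Lemma C1c_L2 psi : C1c T psi -> L2 T psi /\ L2 T (derive1 psi).
Proof.
move=> [d c _]; split; apply: continuous_L2 => //.
by move=> s; apply: differentiable_continuous; apply/derivable1_diffP; exact: d.
Qed.

Lemma C1c_prim psi t : C1c T psi -> 0 <= t <= T -> prim T (derive1 psi) t = psi t.
Proof.
by move=> /[dup] /C1c_ends[p0 _] [d c _] tT; rewrite (prim_derive1 d c tT) p0 subr0.
Qed.

Lemma ip_prim_C1c v psi : L2 T v -> C1c T psi ->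
  ip T (prim T v) (derive1 psi) = - ip T v psi.
Proof.
move=> vL cp; have [pL p'L] := C1c_L2 cp; rewrite ip_prim// -ipNr//.
apply: eq_ip => // s; rewrite /= in_itv/= => /andP[s0 sT].
have hT : 0 <= T <= T by rewrite lexx ltW.
have hs : 0 <= s <= T by rewrite !ltW.
rewrite cprimE// (C1c_prim cp hT) (C1c_prim cp hs).
by have [_ ->] := C1c_ends cp; rewrite sub0r.
Qed.

Lemma ip_cst_C1c k psi : C1c T psi -> ip T (cst k) (derive1 psi) = 0.
Proof.
move=> cp; have [pL p'L] := C1c_L2 cp.
have -> : ip T (cst k) (derive1 psi) = ip T (fun t => k * cst 1 t) (derive1 psi).
  by apply: eq_ip => // t _; rewrite mulr1.
rewrite ipZl//; last exact: L2_cst.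
rewrite -(@prim_geT _ T _ T)// C1c_prim ?lexx ?ltW//.
by have [_ ->] := C1c_ends cp; rewrite mulr0.
Qed.

(** Suppose [f a < c < f b]. Against a tent at [a] minus a tent at [b], the function [c - f] has a
    nonnegative product that does not vanish near [a]. The product integrates to zero, so it
    vanishes almost everywhere, a contradiction. *)
Lemma du_Bois_Reymond f : L2 T f -> {in `]0, T[, continuous f} ->
  (forall psi, C1c T psi -> ip T f (derive1 psi) = 0) ->
  forall a b, 0 < a < T -> 0 < b < T -> f a = f b.
Proof.
suff H f' : L2 T f' -> {in `]0, T[, continuous f'} ->
    (forall psi, C1c T psi -> ip T f' (derive1 psi) = 0) ->
    forall a b, 0 < a -> a < b -> b < T -> ~ f' a < f' b.
  move=> fL cf fpsi a b aT bT.
  have cNf : {in `]0, T[, continuous (fun t => - f t)}.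
    by move=> t tD; apply: cvgN; exact: cf.
  have Nfpsi psi : C1c T psi -> ip T (fun t => - f t) (derive1 psi) = 0.
    by move=> cp; rewrite ipNl ?fpsi ?oppr0//; have [] := C1c_L2 cp.
  have K x y : 0 < x < T -> 0 < y < T -> x < y -> f x = f y.
    move=> /andP[x0 _] /andP[_ yT] xy.
    have [xy'|yx|//] := ltgtP (f x) (f y).
      by have := H _ fL cf fpsi x y x0 xy yT; case.
    by have := H _ (L2N fL) cNf Nfpsi x y x0 xy yT; rewrite ltrN2; case.
  by have [ab|ba|->//] := ltgtP a b; [exact: K|apply/esym/K].
move=> fL cf fpsi a b a0 ab bT fab.
pose c := (f' a + f' b) / 2.
have fac : f' a < c by rewrite /c; lra.
have cfb : c < f' b by rewrite /c; lra.
have ca : {for a, continuous f'} by apply: cf; rewrite in_itv/= a0 (lt_trans ab).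
have cb : {for b, continuous f'} by apply: cf; rewrite in_itv/= bT andbT (lt_trans a0).
have [e1 /= e10 he1] : \forall x \near a, f' x < c by apply: (cvgr_lt _ ca).
have [e2 /= e20 he2] : \forall x \near b, c < f' x by apply: (cvgr_gt _ cb).
(* Each tent must lie in the neighbourhood where [f'] stays on its side of [c], which also makes the
   two tents disjoint, and their supports must lie inside (0,T). *)
pose e := Num.min (Num.min e1 e2) (Num.min a (T - b)) / 2.
have e0 : 0 < e by rewrite /e divr_gt0// !lt_min e10 e20 a0 subr_gt0.
have [ee1 ee2 eea eeb] : [/\ e < e1, e < e2, e < a & e < T - b].
  have h : e < Num.min (Num.min e1 e2) (Num.min a (T - b)).
    by rewrite /e ltr_pdivrMr// ltr_pMr ?ltr1n// !lt_min e10 e20 a0 subr_gt0.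
  by move: h; rewrite !lt_min => /andP[/andP[-> ->] /andP[-> ->]].
have cp : C1c T (fun x => bump e (x - a) - bump e (x - b)).
  by apply: C1c_bump => //; lra.
set psi := (fun x => _) in cp; have [_ p'L] := C1c_L2 cp.
have p'E x : derive1 psi x = tent e (x - a) - tent e (x - b).
  by rewrite derive1E; have [_ ->] := is_deriveB (bump_derive a e x) (bump_derive b e x).
have tent0 x : 0 <= tent e x.
  have [xe|ex] := ltP `|x| e; last by rewrite tent_out.
  by rewrite tent_in//; lra.
have kL : L2 T (fun x => c - f' x) by apply: L2B => //; exact: L2_cst.
have I0 : ip T (fun x => c - f' x) (derive1 psi) = 0.
  rewrite (_ : (fun x => c - f' x) = fun x => cst c x - f' x)// ipBl//; last exact: L2_cst.
  by rewrite ip_cst_C1c// fpsi// subrr.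
have k0 x : 0 <= (c - f' x) * derive1 psi x.
  rewrite p'E mulrBr; have [xa|ax] := ltP `|x - a| e.
    have h1 : f' x < c by apply: he1; rewrite /ball_/= distrC; exact: lt_trans xa _.
    rewrite (_ : tent e (x - b) = 0) ?mulr0 ?subr0 ?mulr_ge0// ?subr_ge0 ?ltW//.
    apply: tent_out => //; rewrite leNgt; apply/negP => xb.
    have : c < f' x by apply: he2; rewrite /ball_/= distrC; exact: lt_trans xb _.
    by rewrite ltNge (ltW h1).
  rewrite (@tent_out _ e (x - a))// mulr0 sub0r -mulNr opprB.
  have [xb|bx] := ltP `|x - b| e; last by rewrite tent_out// mulr0.
  rewrite mulr_ge0// subr_ge0 ltW//; apply: he2; rewrite /ball_/= distrC.
  exact: lt_trans xb _.
have kpos x : `|x - a| < e -> (c - f' x) * derive1 psi x != 0.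
  move=> xa; have h1 : f' x < c by apply: he1; rewrite /ball_/= distrC; exact: lt_trans xa _.
  rewrite p'E (@tent_out _ e (x - b))//.
    by rewrite subr0 tent_in// gt_eqF// mulr_gt0 ?subr_gt0// mulr_gt0// subr_gt0.
  rewrite leNgt; apply/negP => xb.
  have : c < f' x by apply: he2; rewrite /ball_/= distrC; exact: lt_trans xb _.
  by rewrite ltNge (ltW h1).
have ki : intg (fun x => (c - f' x) * derive1 psi x) by exact: L2_mul_intg.
have : (\int[mu]_(t in D) `|((c - f' t) * derive1 psi t)%:E| = 0)%E.
  transitivity (\int[mu]_(t in D) ((c - f' t) * derive1 psi t)%:E)%E.
    by apply: eq_integral => t _ /=; rewrite ger0_norm.
  by rewrite -[LHS]fineK ?integrable_fin_num//; congr (_%:E).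
move=> /ae_eq_integral_abs; case=> //; first by apply/measurable_EFinP; exact: intg_meas.
move=> N [mN N0 sN].
have : (mu (`](a - e)%R, (a + e)%R[%classic : set RR) <= mu N)%E.
  apply: le_measure; rewrite ?inE//.
  move=> x /=; rewrite in_itv/= => /andP[xa xb]; apply: sN => /= H.
  have xD : D x by rewrite /= in_itv/=; apply/andP; split; lra.
  have xae : `|x - a| < e by rewrite ltr_norml; apply/andP; split; lra.
  by have /eqP := H xD; rewrite eqe; apply/negP; exact: kpos.
rewrite N0 lebesgue_measure_itv/= lte_fin (_ : a - e < a + e); last lra.
by rewrite -EFinB lee_fin leNgt; apply/negP; rewrite negbK; lra.
Qed.

(** The difference of [z] and the primitive of its weak derivative has zero weak derivative, so it
    is constant on (0,T); one-sided continuity extends this to the endpoints. *)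
Lemma H1_prim z : H1 T z -> exists2 v, L2 T v &
  forall t, 0 <= t <= T -> z t = z 0 + prim T v t.
Proof.
move=> [zL [v vL wd] cz]; exists v => //.
have [czi cz0 czT] := (continuous_within_itvP z T0).1 cz.
pose f t := z t - prim T v t.
have pL := prim_L2 T0 vL; have pc := prim_continuous vL.
have fL : L2 T f by exact: L2B.
have cf : {in `]0, T[, continuous f}.
  by move=> t tD; apply: cvgB; [exact: czi|exact: pc].
have fpsi psi : C1c T psi -> ip T f (derive1 psi) = 0.
  move=> cp; have [psL p'L] := C1c_L2 cp; rewrite ipBl// ip_prim_C1c// opprK.
  by have := wd _ cp; rewrite -/(ip T z (derive1 psi)) -/(ip T v psi) => ->; rewrite addNr.
have fc := du_Bois_Reymond fL cf fpsi.
have f0 t : 0 < t < T -> f t = f 0.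
  move=> tT; have A : f s @[s --> 0^'+] --> f 0.
    by apply: cvgB => //; apply: cvg_at_right_filter; exact: pc.
  have B : f s @[s --> 0^'+] --> f t.
    apply: (@cvg_trans _ (cst (f t) @ 0^'+)); last exact: cvg_cst.
    apply: near_eq_cvg; near=> s.
    by apply: fc => //; apply/andP; split; near: s; [exact: nbhs_right_gt|exact: nbhs_right_lt].
  exact: norm_cvg_unique B A.
have h2 : 0 < T / 2 < T by rewrite divr_gt0//= ltr_pdivrMr// ltr_pMr// ltr1n.
have fT : f T = f 0.
  rewrite -(f0 _ h2).
  have A : f s @[s --> T^'-] --> f T.
    by apply: cvgB => //; apply: cvg_at_left_filter; exact: pc.
  have B : f s @[s --> T^'-] --> f (T / 2).
    apply: (@cvg_trans _ (cst (f (T / 2)) @ T^'-)); last exact: cvg_cst.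
    apply: near_eq_cvg; near=> s.
    by apply: fc => //; apply/andP; split; near: s; [exact: nbhs_left_gt|exact: nbhs_left_lt].
  exact: norm_cvg_unique A B.
move=> t /andP[t0 tT].
have : f t = f 0.
  have [->//|tn0] := eqVneq t 0; have [->//|tnT] := eqVneq t T.
  by apply: f0; rewrite !lt_neqAle eq_sym tn0 t0 tnT tT.
by rewrite /f (@prim_le0 _ T v 0)// subr0 => <-; ring.
Unshelve. all: by end_near. Qed.

Lemma prim_H1 x v z : L2 T v -> (forall t, 0 <= t <= T -> z t = x + prim T v t) ->
  H1 T z.
Proof.
move=> vL zE; have pL := prim_L2 T0 vL; have pc := prim_continuous vL.
have zED t : D t -> x + prim T v t = z t.
  by rewrite /= in_itv/= => /andP[t0 tT]; rewrite zE// !ltW.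
have xpL : L2 T (fun t => x + prim T v t) by apply: L2D => //; exact: L2_cst.
split; first exact: eq_L2 xpL.
- exists v => // psi cp; have [psL p'L] := C1c_L2 cp.
  rewrite -/(ip T z (derive1 psi)) -/(ip T v psi).
  rewrite -(@eq_ip _ T (fun t => cst x t + prim T v t) z (derive1 psi) (derive1 psi))//.
  by rewrite ipDl// ?ip_cst_C1c// ?ip_prim_C1c// ?add0r//; exact: L2_cst.
- apply: (@subspace_eq_continuous _ _ _ (fun t => x + prim T v t)).
    by move=> t; rewrite inE/= in_itv/= => tT; symmetry; exact: zE.
  by apply: continuous_subspaceT => t; apply: cvgD; [exact: cvg_cst|exact: pc].
Qed.

Lemma derive1_prim_near x v z t : (forall t, 0 <= t <= T -> z t = x + prim T v t) ->
  t \in `]0, T[ -> derive1 z t = derive1 (prim T v) t.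
Proof.
move=> zE tD; rewrite !derive1E.
rewrite (@near_eq_derive _ _ _ z (fun s => prim T v s + x)); last first.
  have : nbhs t D by apply: open_nbhs_nbhs; split; [exact: interval_open|].
  apply: filterS => s; rewrite /= in_itv/= => /andP[s0 sT].
  have sT' : 0 <= s <= T by rewrite !ltW.
  by rewrite (zE _ sT') addrC.
(* The difference quotients coincide, so the values of [derive1] agree even at times where there is
   no derivative. *)
have E : (fun h : R => h^-1 *: ((prim T v (h *: 1 + t) + x) - (prim T v t + x))) =
    (fun h : R => h^-1 *: (prim T v (h *: 1 + t) - prim T v t)).
  by apply/funext => h; rewrite opprD addrACA subrr addr0.
exact: (congr1 (fun k => lim (k @ 0^')) E).
Qed.

Lemma derive1_prim_ae x v z : L2 T v ->
  (forall t, 0 <= t <= T -> z t = x + prim T v t) ->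
  {ae mu, forall t, D t -> derive1 z t = v t}.
Proof.
move=> vL zE; have := prim_derivable_ae vL; apply: filterS; first exact: (ae_filter_ringOfSetsType mu).
by move=> t h tD; rewrite (derive1_prim_near zE)//; have [] := h tD.
Qed.

End H1_functions.

(** * Reduction of the cost to the control [u] *)

Section Cost.
Context {R : realType} (T c0 M : R) (V V' g g' : R -> R).
Local Notation mu := (@lebesgue_measure R).
Local Notation D := (`]0, T[%classic : set R).
Local Notation intg f := (mu.-integrable D (EFin \o f)).
Local Notation nrm2 f := (ip T f f).
Implicit Types f h u v w z : R -> R.
Hypothesis T0 : 0 < T.
Hypothesis c00 : 0 < c0.
Hypotheses (hV : C11 M V V') (hg : C11 M g g').

Let mD : measurable (D : set (measurableTypeR R)). Proof. exact: measurable_itv. Qed.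

Definition drift w : R -> R := prim T (fun t => c0^-1 * w t).

Lemma drift_L2 w : L2 T w -> L2 T (drift w).
Proof. by move=> wL; apply: prim_L2 => //; exact: L2Z. Qed.

Lemma drift_continuous w : L2 T w -> continuous (drift w).
Proof. by move=> wL; apply: prim_continuous; exact: L2Z. Qed.

Lemma cost_Psi w x u z : L2 T w -> L2 T u ->
  (forall t, 0 <= t <= T -> z t = traj T x (drift w) u t) ->
  cost T c0 V g w z = Psi T c0 V g x (drift w) u - nrm2 w / (2 * c0).
Proof.
move=> wL uL zE; pose v t := u t - c0^-1 * w t.
have cwL := L2Z c0^-1 wL.
have vL : L2 T v by exact: L2B.
have zE' t : 0 <= t <= T -> z t = x + prim T v t.
  by move=> tT; rewrite zE// /traj /v primB// addrA.
have zL : L2 T z by have [] := prim_H1 T0 vL zE'.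
(* Almost everywhere [z' = u - w / c0], and completing the square removes the cross term in
   [u w]. *)
rewrite /cost (@Rintegral_ae_eq _ _ _ (fun t => (c0 / 2 * (u t * u t) + V (z t)) - (2 * c0)^-1 * (w t * w t))); last first.
  have := derive1_prim_ae vL zE'; apply: filterS; first exact: (ae_filter_ringOfSetsType mu).
  by move=> t h tD; rewrite h// /v; field; rewrite gt_eqF.
have ui := L2_mul_intg uL uL; have wi := L2_mul_intg wL wL.
have Vi := L2_intg (V_L2 hV zL).
rewrite RintegralB//; [|by apply: intgD => //; exact: intgZ|exact: intgZ].
rewrite RintegralD//; last exact: intgZ.
rewrite !RintegralZl// /Psi /tcost -/(nrm2 u) -/(nrm2 w).
have -> : \int[mu]_(t in D) V (traj T x (drift w) u t) = \int[mu]_(t in D) V (z t).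
  by apply: eq_Rintegral => t /set_mem/=; rewrite in_itv/= => /andP[t0 tT]; rewrite zE// !ltW.
by rewrite -zE ?lexx ?ltW//; field; rewrite gt_eqF.
Qed.

Lemma admissible_traj w x u z : L2 T w -> L2 T u ->
  (forall t, 0 <= t <= T -> z t = traj T x (drift w) u t) -> admissible T x z.
Proof.
move=> wL uL zE; have cwL := L2Z c0^-1 wL.
have zE' t : 0 <= t <= T -> z t = x + prim T (fun t => u t - c0^-1 * w t) t.
  by move=> tT; rewrite zE// /traj primB// addrA.
split; first by apply: prim_H1 zE' => //; exact: L2B.
by rewrite zE' ?lexx ?ltW// prim_le0// addr0.
Qed.

Lemma admissibleP w x z : L2 T w -> admissible T x z ->
  exists2 u, L2 T u & forall t, 0 <= t <= T -> z t = traj T x (drift w) u t.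
Proof.
move=> wL [/(H1_prim T0)[v vL zE] z0]; have cwL := L2Z c0^-1 wL.
exists (fun t => v t + c0^-1 * w t); first exact: L2D.
by move=> t tT; rewrite zE// z0 /traj /drift primD//; ring.
Qed.

Lemma is_minimizerP w x z : L2 T w -> is_minimizer T c0 V g w x z <->
  exists2 u, is_min T c0 V g x (drift w) u &
    forall t, 0 <= t <= T -> z t = traj T x (drift w) u t.
Proof.
move=> wL; split=> [[az zmin]|[u [uL umin] zE]].
  have [u uL zE] := admissibleP wL az; exists u => //; split=> // v vL.
  have := zmin _ (admissible_traj wL vL (fun t _ => erefl)).
  by rewrite (cost_Psi wL uL zE) (@cost_Psi w x v)// lerD2r.
split; first exact: admissible_traj zE.
move=> y /(admissibleP wL)[v vL yE].
by rewrite (cost_Psi wL uL zE) (cost_Psi wL vL yE) lerD2r umin.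
Qed.

Lemma phi_psi w x : L2 T w ->
  phi T c0 V g w x = psi T c0 V g x (drift w) - nrm2 w / (2 * c0).
Proof.
move=> wL; have [u um] := is_min_exists T0 c00 hV hg x (drift_L2 wL).
have zE t : 0 <= t <= T -> traj T x (drift w) u t = traj T x (drift w) u t by [].
have [az zmin] := (@is_minimizerP w x (traj T x (drift w) u) wL).2 (ex_intro2 _ _ u um zE).
rewrite (psi_min um) -(cost_Psi wL um.1 zE) /phi.
apply/eqP; rewrite eq_le; apply/andP; split.
  apply: ge_inf; last by exists (traj T x (drift w) u).
  by exists (cost T c0 V g w (traj T x (drift w) u)) => _ [y ay <-]; exact: zmin.
apply: lb_le_inf; first by exists (cost T c0 V g w (traj T x (drift w) u)); exists (traj T x (drift w) u).
by move=> _ [y ay <-]; exact: zmin.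
Qed.

End Cost.

(** * Averaging over the population *)

Section Caratheodory.
Context {R : realType} (T : R).
Local Notation mu := (@lebesgue_measure R).
Local Notation RR := (measurableTypeR R).
Hypothesis T0 : 0 < T.

(** Composing with [clamp] extends trajectories by constants outside [0,T], so that measurability
    can be treated on the whole plane. *)
Definition clamp (t : R) : R := Num.max 0 (Num.min t T).

Lemma clamp_itv t : 0 <= clamp t <= T.
Proof. by rewrite /clamp le_max lexx ge_max (ltW T0) ge_min lexx orbT. Qed.

Lemma clamp_id t : 0 <= t <= T -> clamp t = t.
Proof. by move=> /andP[t0 tT]; rewrite /clamp min_l// max_r. Qed.

Lemma clamp_lip a b : `|clamp a - clamp b| <= `|a - b|.
Proof.
rewrite ler_norml; have := ler_norm (a - b); have := ler_norm (b - a).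
rewrite (distrC b) /clamp; have := T0; case: (leP a T) => ?; case: (leP b T) => ?;
case: (leP 0 a) => ?; case: (leP 0 b) => ?; case: (leP 0 T) => ? ? ? ?;
by apply/andP; split; lra.
Qed.

Lemma clamp_continuous : continuous clamp.
Proof. by apply: (@lip_continuous _ 1) => a b; rewrite mul1r clamp_lip. Qed.

Variable F : R -> R -> R.
Hypotheses (Fc : forall x, continuous (F x))
  (Fnd : forall t x y, 0 <= t <= T -> x < y -> F x t <= F y t).

Let F_meas t : 0 <= t <= T -> measurable_fun setT (fun x : RR => F x t).
Proof.
move=> tT; apply: nondecreasing_measurable => // x y.
by rewrite le_eqVlt => /predU1P[->//|/(Fnd tT)].
Qed.

Let node n (k : nat) : R := clamp (k%:R / n.+1%:R).
Let cell n (t : R) : nat := Num.truncn (clamp t * n.+1%:R).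

Let cell_measurable n k : measurable ([set t | cell n t = k] : set RR).
Proof.
have -> : [set t | cell n t = k] = clamp @^-1` `[k%:R / n.+1%:R, k.+1%:R / n.+1%:R[.
  apply/seteqP; split=> t /=; rewrite in_itv/= ler_pdivrMr// ltr_pdivlMr//.
    have /andP[c0 _] := clamp_itv t.
    have x0 : 0 <= clamp t * n.+1%:R by rewrite mulr_ge0.
    by move=> <-; exact: truncn_itv.
  by move=> /truncn_def; rewrite /cell.
rewrite -[X in measurable X]setTI.
by apply: (continuous_measurable_fun clamp_continuous) => //; exact: measurable_itv.
Qed.

(* Monotonicity in [x] makes every slice Borel; continuity in [t] then gives joint measurability by discretizing time. *)
Lemma measurable_clamped :
  measurable_fun setT (fun tx : RR * RR => F tx.2 (clamp tx.1)).
Proof.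
pose Fn n (tx : RR * RR) := F tx.2 (node n (cell n tx.1)).
apply: (@measurable_fun_cvg _ _ _ _ Fn).
  move=> n _ Y mY; rewrite setTI.
  have -> : Fn n @^-1` Y = \bigcup_(k : nat)
      ([set t | cell n t = k] `*` ((fun x => F x (node n k)) @^-1` Y)).
    apply/seteqP; split=> [[t x] /= FY|[t x] [k _ [/= <-]]//].
    by exists (cell n t).
  apply: bigcupT_measurable => k; apply: measurableX; first exact: cell_measurable.
  by rewrite -[X in measurable X]setTI; apply: F_meas => //; exact: clamp_itv.
move=> [t x] _ /=; rewrite /Fn/=.
apply: (@continuous_cvg _ _ _ _ _ _ (F x)); first exact: Fc.
apply/cvgrPdist_le => e e0; near=> n.
rewrite -{1}(clamp_id (clamp_itv t)); apply: le_trans (clamp_lip _ _) _.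
have n0 : 0 < n.+1%:R :> R by rewrite ltr0n.
have /andP[c0 _] := clamp_itv t.
have x0 : 0 <= clamp t * n.+1%:R by rewrite mulr_ge0// ltW.
have /andP[h1 h2] := truncn_itv x0.
rewrite ger0_norm; last by rewrite subr_ge0 ler_pdivrMr.
apply: (@le_trans _ _ n.+1%:R^-1).
  rewrite lerBlDl -[X in _ + X]mul1r -mulrDl ler_pdivlMr// natr1; exact: ltW.
by near: n; have := near_infty_natSinv_lt (PosNum e0); apply: filterS => n /ltW.
Unshelve. all: by end_near. Qed.

End Caratheodory.

(** * A nonnegative, compactly supported version of the density *)

Section Density.
Context {R : realType}.
Local Notation mu := (@lebesgue_measure R).
Local Notation RR := (measurableTypeR R).

Definition weight (rho : R -> R) (B : R) : Prop := [/\ 0 <= B,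
  measurable_fun [set: RR] rho, forall x, 0 <= rho x,
  forall x, B < `|x| -> rho x = 0 &
  (\int[mu]_x (rho x)%:E = 1)%E].

(* The given density is neither assumed nonnegative nor zero off a bounded set; it is modified on a null set. *)
Lemma density_weight (P : probability RR R) (rho0 : R -> R) :
  compactly_supported P -> is_density P rho0 ->
  exists rho B, weight rho B /\ {ae mu, forall x, rho0 x = rho x}.
Proof.
move=> [K cK PK] [mrho0 Prho0].
have mrE : measurable_fun [set: RR] (EFin \o rho0) by exact/measurable_EFinP.
pose A := [set x : RR | rho0 x < 0].
have mA : measurable A.
  have := mrho0 measurableT `]-oo, 0[%classic (measurable_itv _).
  rewrite setTI; congr measurable; apply/seteqP; split=> x /=; by rewrite in_itv.
have rhoN x : A x -> (0 <= (- rho0 x)%:E)%E by move=> Ax; rewrite lee_fin oppr_ge0 ltW.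
(* The integral of [rho0] over [A] is at most 0 by the choice of [A], and at least 0 because it
   equals [P A]. *)
have IA : (\int[mu]_(x in A) (- rho0 x)%:E = 0)%E.
  apply/eqP; rewrite eq_le integral_ge0// andbT.
  have : (0 <= P A)%E by exact: measure_ge0.
  rewrite Prho0//.
  under eq_integral do rewrite -(opprK (rho0 _)) EFinN.
  by rewrite integral_ge0N// oppe_ge0.
have muA : mu A = 0%E.
  have : (\int[mu]_(x in A) `|(- rho0 x)%:E| = 0)%E.
    by rewrite -IA; apply: eq_integral => x /set_mem Ax; rewrite gee0_abs// rhoN.
  move=> /ae_eq_integral_abs; case=> //.
    by apply/measurable_EFinP; apply: measurable_funTS; exact: measurable_funN.
  move=> N [mN N0 sN]; apply: (subset_measure0 mA mN _ N0).
  move=> x Ax; apply: sN => /= /(_ Ax) [] /eqP; rewrite oppr_eq0 => /eqP h.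
  by move: Ax; rewrite /A /= h ltxx.
pose rp x := Num.max 0 (rho0 x).
have mrp : measurable_fun [set: RR] rp by exact: measurable_maxr.
have rpE x : ~ A x -> rho0 x = rp x.
  by move=> /negP; rewrite -leNgt => h; rewrite /rp max_r.
have [B [B0 KB]] : exists B, 0 <= B /\ K `<=` [set x | `|x| <= B].
  have [M [_ HM]] := compact_bounded cK.
  exists (`|M| + 1); split; first by rewrite addr_ge0.
  move=> x Kx; apply: HM => //.
  by rewrite (le_lt_trans (ler_norm M))// ltrDl.
pose C := [set x : RR | B < `|x|].
have mC : measurable C.
  have mn : measurable_fun [set: RR] (fun x : R => `|x|) by exact: measurableT_comp.
  have := mn measurableT `]B, +oo[%classic (measurable_itv _).
  rewrite setTI; congr measurable; apply/seteqP; split=> x /=; by rewrite in_itv/= andbT.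
have PC : P C = 0%E.
  apply/eqP; rewrite eq_le measure_ge0 andbT -PK; apply: le_measure; rewrite ?inE//.
    have clK : closed (K : set R) := compact_closed (@Rhausdorff R) cK.
    exact: (measurableC (closed_measurable clK)).
  move=> x Cx Kx; have /= := KB _ Kx; by rewrite leNgt Cx.
have aeA : {ae mu, forall x, rho0 x = rp x}.
  exists A; split=> // x /=; apply: contra_notP => nAx; exact: rpE.
have int_rp D : measurable D -> (\int[mu]_(x in D) (rp x)%:E = P D)%E.
  move=> mD; rewrite Prho0//; apply: ae_eq_integral => //.
  - by apply/measurable_EFinP; exact: measurable_funTS.
  - by apply/measurable_EFinP; exact: measurable_funTS.
  - by move: aeA; apply: filterS; [exact: (ae_filter_ringOfSetsType mu)|move=> x -> _].
have rp0 x : 0 <= rp x by rewrite /rp le_max lexx.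
have aeC : {ae mu, forall x, C x -> rp x = 0}.
  have : (\int[mu]_(x in C) `|(rp x)%:E| = 0)%E.
    rewrite -PC -int_rp//; apply: eq_integral => x _.
    by rewrite gee0_abs// lee_fin.
  move=> /ae_eq_integral_abs; case=> //.
    by apply/measurable_EFinP; exact: measurable_funTS.
  move=> N [mN N0 sN]; exists N; split=> //.
  apply: subset_trans sN => x /= H H'; apply: H => Cx; by have [] := H' Cx.
pose rho := rp \_ (~` C).
have rhoE x : (C x -> rp x = 0) -> rp x = rho x.
  rewrite /rho patchE; case: ifPn => // /negP nC H; apply: H.
  by apply: contrapT => nCx; apply: nC; apply/mem_set.
have mrho : measurable_fun [set: RR] rho.
  by apply/(measurable_restrictT _ (measurableC mC)); exact: measurable_funTS.
exists rho, B; split; last first.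
  move: aeA aeC; apply: filterS2; first exact: (ae_filter_ringOfSetsType mu).
  by move=> x -> /rhoE.
split=> //.
- by move=> x; rewrite /rho patchE; case: ifP.
- move=> x Bx; rewrite /rho patchE memNset//; by apply.
- rewrite -(probability_setT P) -int_rp//; apply: ae_eq_integral => //.
  - exact/measurable_EFinP.
  - exact/measurable_EFinP.
  - have [N [mN N0 sN]] := aeC; exists N; split=> //.
    apply: subset_trans sN => x /= H H'; apply: H => _.
    by rewrite -(rhoE x H').
Qed.

End Density.

(** * Averages against the weight *)

Section Weighted_mean.
Context {R : realType} (rho : R -> R) (B : R).
Local Notation mu := (@lebesgue_measure R).
Local Notation RR := (measurableTypeR R).
Implicit Types f h : R -> R.
Hypothesis hrho : weight rho B.

Let B0 : 0 <= B. Proof. by have [] := hrho. Qed.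
Let mrho : measurable_fun [set: RR] rho. Proof. by have [] := hrho. Qed.
Let rho0 x : 0 <= rho x. Proof. by have [] := hrho. Qed.
Let rhoB x : B < `|x| -> rho x = 0. Proof. by have [_ _ _ h _] := hrho; exact: h. Qed.

Lemma weight_integrable : mu.-integrable setT (EFin \o rho).
Proof.
apply/integrableP; split; first exact/measurable_EFinP.
have [_ _ _ _ h] := hrho.
under eq_integral do rewrite /= ger0_norm//.
by rewrite h ltry.
Qed.

Definition mean (f : R -> R) : R := \int[mu]_x (f x * rho x).

(** Measurability is required of the product only, because Fubini yields averaged quantities already
    multiplied by [rho]. *)
Definition wmeas f := measurable_fun [set: RR] (fun x => f x * rho x).

Lemma measurable_wmeas f : measurable_fun [set: RR] f -> wmeas f.
Proof. by move=> mf; exact: measurable_funM. Qed.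

Lemma weighted_integrable f (K : R) : wmeas f ->
  (forall x, `|x| <= B -> `|f x| <= K) -> mu.-integrable setT (EFin \o (fun x => f x * rho x)).
Proof.
move=> mf fK; apply: (@integrable_slice _ _ rho K) weight_integrable _ => //.
move=> x; rewrite normrM (ger0_norm (rho0 x)).
have [xB|Bx] := leP `|x| B; first by rewrite ler_wpM2r// fK.
by rewrite rhoB// !mulr0.
Qed.

Lemma mean_cst k : mean (cst k) = k.
Proof.
have [_ _ _ _ h] := hrho; rewrite /mean RintegralZl//; last exact: weight_integrable.
by rewrite /Rintegral h mulr1.
Qed.

Lemma meanD f h (K K' : R) : wmeas f -> wmeas h ->
  (forall x, `|x| <= B -> `|f x| <= K) -> (forall x, `|x| <= B -> `|h x| <= K') ->
  mean (fun x => f x + h x) = mean f + mean h.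
Proof.
move=> mf mh fK hK; rewrite /mean -RintegralD//; [|exact: weighted_integrable fK|exact: weighted_integrable hK].
by apply: eq_Rintegral => x _; rewrite mulrDl.
Qed.

Lemma meanZ k f (K : R) : wmeas f ->
  (forall x, `|x| <= B -> `|f x| <= K) -> mean (fun x => k * f x) = k * mean f.
Proof.
move=> mf fK; rewrite /mean -RintegralZl//; last exact: weighted_integrable fK.
by apply: eq_Rintegral => x _; rewrite mulrA.
Qed.

Lemma mean_le f h (K K' : R) : wmeas f -> wmeas h ->
  (forall x, `|x| <= B -> `|f x| <= K) -> (forall x, `|x| <= B -> `|h x| <= K') ->
  (forall x, `|x| <= B -> f x <= h x) -> mean f <= mean h.
Proof.
move=> mf mh fK hK fh; apply: le_Rintegral => //.
- exact: weighted_integrable fK.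
- exact: weighted_integrable hK.
- move=> x _; have [xB|Bx] := leP `|x| B; first by rewrite ler_wpM2r// fh.
  by rewrite rhoB// !mulr0.
Qed.

Lemma mean_cvg (fn : nat -> R -> R) f (K : R) :
  (forall n, wmeas (fn n)) -> wmeas f ->
  (forall n x, `|x| <= B -> `|fn n x| <= K) ->
  {ae mu, forall x, fn n x @[n --> \oo] --> f x} ->
  mean (fn n) @[n --> \oo] --> mean f.
Proof.
move=> mfn mf fnK fnf.
have mE h : wmeas h -> measurable_fun [set: RR] (fun x => (h x * rho x)%:E).
  by move=> mh; exact/measurable_EFinP.
have /= gi := integrableZl measurableT K weight_integrable.
have [||fi _ cv] := @dominated_convergence _ RR R mu setT measurableT
  (fun n x => (fn n x * rho x)%:E) (fun x => (f x * rho x)%:E) _ (fun n => mE _ (mfn n)) (mE _ mf) _ gi _.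
- move: fnf; apply: filterS; first exact: (ae_filter_ringOfSetsType mu).
  move=> x cx _; apply/fine_cvgP; split; first exact: nearW.
  by apply: cvgM => //; exact: cvg_cst.
- apply: aeW => x n _; rewrite abse_EFin -EFinM lee_fin normrM (ger0_norm (rho0 x)).
  have [xB|Bx] := leP `|x| B; first by rewrite ler_wpM2r// fnK.
  by rewrite rhoB// !mulr0.
by apply: fine_cvg; rewrite fineK//; exact: integrable_fin_num.
Qed.

Lemma mean_bound f (K : R) : wmeas f -> (forall x, `|x| <= B -> `|f x| <= K) ->
  `|mean f| <= K.
Proof.
move=> mf fK; have mc k : wmeas (cst k) by apply: measurable_wmeas.
have ck (k x : R) : `|x| <= B -> `|cst k x : R| <= `|k| by [].
have h1 : mean (cst (- K)) <= mean f.
  by apply: (mean_le (mc (- K)) mf (ck (- K)) fK) => x /fK; rewrite ler_norml => /andP[].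
have h2 : mean f <= mean (cst K).
  by apply: (mean_le mf (mc K) fK (ck K)) => x /fK; rewrite ler_norml => /andP[].
by move: h1 h2; rewrite !mean_cst ler_norml => -> ->.
Qed.

End Weighted_mean.

(** * The averaged momentum and the derivative of the averaged value *)

Section Population.
Context {R : realType} (T c0 M : R) (V V' g g' : R -> R) (rho : R -> R) (B : R).
Local Notation mu := (@lebesgue_measure R).
Local Notation RR := (measurableTypeR R).
Local Notation D := (`]0, T[%classic : set R).
Local Notation intg f := (mu.-integrable D (EFin \o f)).
Local Notation nrm2 f := (ip T f f).
Implicit Types f h v z : R -> R.
Hypothesis T0 : 0 < T.
Hypothesis c00 : 0 < c0.
Hypotheses (hV : C11 M V V') (hg : C11 M g g').
Hypothesis hrho : weight rho B.
Variable W : R -> R.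
Hypotheses (WL : L2 T W) (cW : continuous W).
Variable u : R -> R -> R.
Hypothesis um : forall x, is_min T c0 V g x W (u x).

Local Notation avg := (mean rho).
Local Notation wm := (wmeas rho).

Local Notation dtc := (dtcost T V' g').

Let mD : measurable (D : set RR). Proof. exact: measurable_itv. Qed.
Let M0 : 0 <= M. Proof. by have [] := hV. Qed.
Let V'M (z : R) : `|V' z| <= M. Proof. by have [_ h _ _ _] := hV. Qed.
Let g'M (z : R) : `|g' z| <= M. Proof. by have [_ h _ _ _] := hg. Qed.
Let cV' : continuous V'. Proof. by have [_ _ _ /lip_continuous] := hV. Qed.
Let cg' : continuous g'. Proof. by have [_ _ _ /lip_continuous] := hg. Qed.
Let uL x : L2 T (u x). Proof. by have [] := um x. Qed.
Let mrho : measurable_fun [set: RR] rho. Proof. by have [] := hrho. Qed.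
Let rho0 x : 0 <= rho x. Proof. by have [_ _ h _ _] := hrho; exact: h. Qed.

Definition zmin x : R -> R := traj T x W (u x).
Local Notation Z := (fun x t => zmin x (clamp T t)).

Let zL x : L2 T (zmin x). Proof. exact: traj_L2. Qed.

Lemma zmin_continuous x : continuous (zmin x).
Proof. exact: traj_continuous. Qed.

Lemma zmin_measurable :
  measurable_fun setT (fun tx : RR * RR => zmin tx.2 (clamp T tx.1)).
Proof.
apply: measurable_clamped => //; first exact: zmin_continuous.
by move=> t x y tT xy; exact: (traj_order T0 c00 hV hg WL cW (um x) (um y) xy tT).
Qed.

Let Z_slice t : measurable_fun [set: RR] (fun x : RR => Z x t).
Proof. exact: (measurable_fun_pair2 t zmin_measurable). Qed.

Let DE t : D t -> 0 <= t <= T.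
Proof. by rewrite /= in_itv/= => /andP[t0 tT]; rewrite !ltW. Qed.

Definition force t : R := avg (fun x => V' (Z x t)).
Definition terminal : R := avg (fun x => g' (zmin x T)).
Definition mean_mom t : R := prim T force t - prim T force T - terminal.

Let V'Z_meas t : wm (fun x => V' (Z x t)).
Proof.
apply: (measurable_wmeas hrho).
exact: (measurableT_comp (continuous_measurable_fun cV') (Z_slice t)).
Qed.

Let g'Z_meas : wm (fun x => g' (zmin x T)).
Proof.
apply: (measurable_wmeas hrho).
have h := measurableT_comp (continuous_measurable_fun cg') (Z_slice T).
by apply: eq_measurable_fun h => x _ /=; rewrite clamp_id// lexx ltW.
Qed.

Lemma force_continuous : continuous force.
Proof.
move=> t0.
have := @continuity_under_integral _ _ RR mu (fun t x => V' (Z x t) * rho x) setT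
  measurableT (t0 - 1) (t0 + 1) _ _ (fun x => M * rho x) _ _ t0.
apply.
- by move=> t _; apply: (weighted_integrable hrho (K := M)) => //; exact: V'Z_meas.
- apply: aeW => x _ t _; apply: cvgM; last exact: cvg_cst.
  apply: continuous_comp; last exact: cV'.
  by apply: continuous_comp; [exact: clamp_continuous|exact: zmin_continuous].
- exact: (integrableZl measurableT M (weight_integrable hrho)).
- move=> t _; apply: aeW => x _; rewrite normrM (ger0_norm (rho0 x)).
  by rewrite ler_wpM2r.
- by rewrite inE/= in_itv/= ltrBlDr ltrDl ltr01.
Qed.

Lemma force_L2 : L2 T force.
Proof. by apply: continuous_L2 => //; exact: force_continuous. Qed.

Section Averaging.
Variables (b : R -> R).
Hypothesis bL : L2 T b.

Let F (xt : RR * RR) : R := (V' (Z xt.1 xt.2) * rho xt.1) * (b \_ D) xt.2.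

Let mF : measurable_fun setT F.
Proof.
have bT : measurable_fun [set: RR] (b \_ D).
  by apply/(measurable_restrictT _ mD); exact: L2_meas.
apply: measurable_funM; last by apply: measurableT_comp => //.
apply: measurable_funM; last by apply: measurableT_comp => //.
apply: measurableT_comp; first exact: continuous_measurable_fun.
have := measurableT_comp zmin_measurable (measurable_fun_pair measurable_snd measurable_fst).
exact.
Qed.

Let ai : mu.-integrable setT (EFin \o (fun x => M * rho x)).
Proof. exact: (integrableZl measurableT M (weight_integrable hrho)). Qed.

Let bi : mu.-integrable setT (EFin \o (fun t => `|(b \_ D) t|)).
Proof.
have biT : mu.-integrable setT (EFin \o (b \_ D)).
  by rewrite -restrict_EFin; apply/(integrable_mkcond _ mD); exact: L2_intg.
exact: (integrable_norm biT).
Qed.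

Let Fb x t : `|F (x, t)| <= M * rho x * `|(b \_ D) t|.
Proof.
by rewrite /F/= !normrM (ger0_norm (rho0 x)) ler_wpM2r// ler_wpM2r.
Qed.

Let inner x : \int[mu]_t F (x, t) = ip T (V' \o zmin x) b * rho x.
Proof.
rewrite mulrC /ip -RintegralZl//; last by apply: L2_mul_intg => //; exact: (V'_L2 hV).
rewrite [RHS]Rintegral_mkcond; apply: eq_Rintegral => t _; rewrite /F /= !patchE.
case: ifPn => [/set_mem Dt|_]; last by rewrite mulr0.
by rewrite clamp_id; [ring|exact: DE].
Qed.

Lemma wmeas_ip : wm (fun x => ip T (V' \o zmin x) b).
Proof.
rewrite /wmeas; have := measurable_Rintegral1 mF ai bi Fb.
by under eq_fun do rewrite inner.
Qed.

Lemma mean_ip : avg (fun x => ip T (V' \o zmin x) b) = ip T force b.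
Proof.
have := Rfubini mF ai bi Fb; rewrite /mean.
under eq_Rintegral do rewrite inner.
move=> ->; rewrite /ip [RHS]Rintegral_mkcond; apply: eq_Rintegral => t _.
rewrite patchE; case: ifPn => tD.
  rewrite /force /mean -RintegralZr//; last first.
    by apply: (weighted_integrable hrho (K := M)) => //; exact: V'Z_meas.
  by apply: eq_Rintegral => x _; rewrite /F/= patchE tD.
by apply: Rintegral_eq0 => // x _; rewrite /F/= patchE (negbTE tD) mulr0.
Qed.

Lemma ip_V'_bound x : `|ip T (V' \o zmin x) b| <= M * ip T (cst 1) (fun t => `|b t|).
Proof.
have nL := L2_norm bL.
have V'bi := L2_mul_intg (V'_L2 hV (zL x)) bL.
apply: le_trans (le_normr_Rintegral mD V'bi) _.
rewrite -RintegralZl//; last by apply: L2_mul_intg => //; exact: L2_cst.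
apply: le_Rintegral => //.
- exact: integrable_norm V'bi.
- by apply: intgZ; apply: L2_mul_intg => //; exact: L2_cst.
- by move=> t _ /=; rewrite normrM mul1r; apply: ler_wpM2r => //; exact: V'M.
Qed.

End Averaging.

Lemma mean_momE t : avg (fun x => mom T V' g' (zmin x) t) = mean_mom t.
Proof.
pose N b := M * ip T (cst 1) (fun t => `|b t : R|).
have sL s := step_L2 T s.
have I s x : `|x| <= B -> `|ip T (V' \o zmin x) (step s)| <= N (step s).
  by move=> _; exact: ip_V'_bound.
have dL : L2 T (fun r => step t r - step T r) by exact: L2B.
(* The momentum is a pairing of the force with a fixed function of time, up to its terminal value,
   so that [mean_ip] applies. *)
have -> : (fun x => mom T V' g' (zmin x) t) =
    fun x => ip T (V' \o zmin x) (fun r => step t r - step T r) + (-1) * g' (zmin x T).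
  apply/funext => x; rewrite /mom mulN1r; congr (_ - _).
  by rewrite ipBr//; [rewrite /prim !(ipC T (V' \o zmin x))|exact: (V'_L2 hV)].
have gN : wm (fun x => (-1) * g' (zmin x T)).
  rewrite /wmeas; under eq_fun do rewrite -mulrA.
  by apply: measurable_funM => //; exact: g'Z_meas.
rewrite (meanD hrho (wmeas_ip dL) gN (K := N (fun r => step t r - step T r)) (K' := M)).
- rewrite (mean_ip dL) (meanZ hrho (-1) g'Z_meas (K := M))//.
  rewrite ipBr//; last exact: force_L2.
  by rewrite /mean_mom /prim !(ipC T force) mulN1r.
- by move=> x _; exact: ip_V'_bound.
- by move=> x _; rewrite normrM normrN normr1 mul1r.
Qed.

Lemma wmeas_mom t : wm (fun x => mom T V' g' (zmin x) t).
Proof.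
have dL : L2 T (fun r => step t r - step T r) by apply: L2B; exact: step_L2.
rewrite /wmeas.
have -> : (fun x => mom T V' g' (zmin x) t * rho x) =
    fun x => ip T (V' \o zmin x) (fun r => step t r - step T r) * rho x - g' (zmin x T) * rho x.
  apply/funext => x; rewrite /mom -mulrBl; congr ((_ - _) * _).
  by rewrite ipBr//; [rewrite /prim !(ipC T (V' \o zmin x))|exact: (V'_L2 hV)|exact: step_L2|exact: step_L2].
by apply: measurable_funB; [exact: wmeas_ip|exact: g'Z_meas].
Qed.

Section Variation.
Variable e : R -> R.
Hypothesis eL : L2 T e.
Let H := prim T e.
Let HL : L2 T H. Proof. exact: prim_L2. Qed.
Let Hb : R := 1 + T * nrm2 e.
Let Hb0 : 0 < Hb. Proof. by rewrite ltr_pwDl// mulr_ge0 ?ip_ge0// ltW. Qed.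
Let HHb t : `|H t| <= Hb.
Proof.
apply: prim_norm_le => //; first exact: ltW.
have : 0 <= T * nrm2 e by rewrite mulr_ge0 ?ip_ge0// ltW.
by rewrite /Hb; nra.
Qed.

Lemma dtcost_wmeas : wm (fun x => dtc (zmin x) H).
Proof.
rewrite /wmeas /dtcost.
have -> : (fun x => (ip T (V' \o zmin x) H + g' (zmin x T) * H T) * rho x) =
    fun x => ip T (V' \o zmin x) H * rho x + H T * (g' (zmin x T) * rho x).
  by apply/funext => x; ring.
apply: measurable_funD; first exact: wmeas_ip.
by apply: measurable_funM => //; exact: g'Z_meas.
Qed.

Lemma mean_dtcost : avg (fun x => dtc (zmin x) H) = - ip T e mean_mom.
Proof.
have gH : wm (fun x => H T * g' (zmin x T)).
  rewrite /wmeas; under eq_fun do rewrite -mulrA.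
  by apply: measurable_funM => //; exact: g'Z_meas.
have -> : (fun x => dtc (zmin x) H) =
    fun x => ip T (V' \o zmin x) H + H T * g' (zmin x T).
  by apply/funext => x; rewrite /dtcost (mulrC (g' _)).
rewrite (meanD hrho (wmeas_ip HL) gH (K := M * ip T (cst 1) (fun t => `|H t|)) (K' := Hb * M)).
- rewrite (mean_ip HL) (meanZ hrho _ g'Z_meas (K := M))// mulrC.
  by rewrite ip_prim_mom//; exact: force_L2.
- by move=> x _; exact: ip_V'_bound.
- by move=> x _; rewrite normrM ler_pM.
Qed.

Let C : R := M * (T + 1).
Let C0 : 0 <= C. Proof. by rewrite mulr_ge0// addr_ge0// ltW. Qed.
Let eps (n : nat) : R := n.+1%:R^-1.
Let eps0 n : 0 < eps n. Proof. by rewrite invr_gt0. Qed.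
(** The drift moved in the direction of the primitive of [e]. Positive steps suffice: optimality is
    used as an inequality for all directions. *)
Definition shifted n : R -> R := fun t => W t + eps n * H t.
Let shL n : L2 T (shifted n). Proof. by apply: L2D => //; exact: L2Z. Qed.

Let quot n x : R := (psi T c0 V g x (shifted n) - psi T c0 V g x W) / eps n.

Let quot_bound n x : `|quot n x| <= C * Hb.
Proof.
rewrite normrM normfV (gtr0_norm (eps0 n)) ler_pdivrMr// -mulrA.
apply: (psi_lip T0 c00 hV hg) => //; first by rewrite mulr_ge0 ?ltW.
move=> t _; rewrite /shifted (_ : _ - _ = - (eps n * H t)); last by ring.
by rewrite normrN normrM (gtr0_norm (eps0 n)) mulrC ler_wpM2r// ltW.
Qed.

Let quot_meas n : wm (quot n).
Proof.
apply: (measurable_wmeas hrho); rewrite /quot; apply: measurable_funM => //.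
by apply: measurable_funB; exact: (psi_measurable T0 c00 hV hg).
Qed.

Let traj_shift x n v : traj T x (shifted n) v = fun t => traj T x W v t + (- eps n) * H t.
Proof. by apply/funext => t; rewrite /traj /shifted; ring. Qed.

Let taylor x n v : L2 T v -> `|tcost T V g (traj T x (shifted n) v) - tcost T V g (traj T x W v)
    + eps n * dtc (traj T x W v) H| <= M * (nrm2 H + H T ^+ 2) * eps n ^+ 2.
Proof.
move=> vL; have tL := traj_L2 T0 x WL vL.
have := tcost_taylor hV hg tL (L2Z (- eps n) HL).
rewrite traj_shift.
have -> : dtc (traj T x W v) (fun t => - eps n * H t) = - (eps n * dtc (traj T x W v) H).
  by rewrite /dtcost ipZr//; [ring|exact: (V'_L2 hV)].
rewrite opprK ipZl ?ipZr//; last exact: L2Z.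
by rewrite (_ : M * _ = M * (nrm2 H + H T ^+ 2) * eps n ^+ 2)//; ring.
Qed.

Let dtcost_lip z1 z2 (s : R) : L2 T z1 -> L2 T z2 -> 0 <= s ->
  (forall t, 0 <= t <= T -> `|z1 t - z2 t| <= s) ->
  `|dtc z1 H - dtc z2 H| <= C * Hb * s.
Proof.
move=> z1L z2L s0 z12; rewrite /dtcost.
have k1 := V'_L2 hV z1L; have k2 := V'_L2 hV z2L.
have V'z t : 0 <= t <= T -> `|V' (z1 t) - V' (z2 t)| <= M * s.
  move=> tT; have [_ _ _ l _] := hV; apply: le_trans (l _ _) _.
  by rewrite ler_wpM2l// z12.
have g'z : `|g' (z1 T) - g' (z2 T)| <= M * s.
  have [_ _ _ l _] := hg; apply: le_trans (l _ _) _.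
  by rewrite ler_wpM2l// z12// lexx ltW.
rewrite opprD addrACA -mulrBl -ipBl//.
apply: le_trans (ler_normD _ _) _.
have -> : C * Hb * s = T * (M * s * Hb) + M * s * Hb by rewrite /C; ring.
have Ms : 0 <= M * s by rewrite mulr_ge0.
apply: lerD; last by rewrite normrM ler_pM.
have di := L2_mul_intg (L2B k1 k2) HL.
apply: le_trans (le_normr_Rintegral mD di) _.
have -> : T * (M * s * Hb) = \int[mu]_(t in D) (cst (M * s * Hb) t : R).
  by rewrite Rintegral_cst_D// mulrC.
apply: le_Rintegral => //; [exact: integrable_norm di|exact: intg_cst|].
by move=> t /DE tT; rewrite normrM ler_pM// V'z.
Qed.

(** Envelope argument: the minimizer of either problem competes in the other. Testing [u x] in the
    shifted problem bounds the quotient from above through the derivative at [zmin x]. Testing the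
    shifted minimizer [v] in the original problem bounds it from below through the derivative at the
    path of [v], which uniqueness and stability keep close to [zmin x]. *)
Let quot_cvg x : unique_min T c0 V g W x -> quot n x @[n --> \oo] --> - dtc (zmin x) H.
Proof.
move=> ux; apply/cvgrPdist_le => d d0.
pose K := M * (nrm2 H + H T ^+ 2).
have K0 : 0 <= K by rewrite mulr_ge0// addr_ge0 ?ip_ge0 ?sqr_ge0.
have d20 : 0 < d / 2 by rewrite divr_gt0.
pose L := C * Hb * (1 + T).
have L0 : 0 <= L.
  by apply: mulr_ge0; [apply: mulr_ge0 => //; exact: ltW|rewrite addr_ge0// ltW].
(* If the controls are within [r] in norm, the paths are within [(1 + T) r] uniformly, and the
   derivatives then differ by at most [L r <= d / 2]. *)
pose r := d / 2 / (L + 1).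
have L1 : 0 < L + 1 by rewrite ltr_pwDr.
have r0 : 0 < r by rewrite divr_gt0.
have [q q0 Hq] := is_min_stable T0 c00 hV hg WL (um x)
  (fun v vm => ux v (u x) vm (um x)) (exprn_gt0 2 r0).
(* [A * eps n] bounds the excess of [v] in the original problem: one [C * Hb] for evaluating [v]
   with the other drift, one for the change of the optimal value. *)
pose A := 2 * (C * Hb) + 1.
have A0 : 0 < A by rewrite ltr_pwDr// mulr_ge0// mulr_ge0// ltW.
have K1 : 0 < K + 1 by rewrite ltr_pwDr.
have ev (y : R) : 0 < y -> \forall n \near \oo, eps n <= y.
  by move=> y0; have := near_infty_natSinv_lt (PosNum y0); apply: filterS => n /ltW.
near=> n.
have e0 := eps0 n.
have e1 : A * eps n <= q.
  rewrite mulrC -ler_pdivlMr//; near: n; apply: ev; exact: divr_gt0.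
have e2 : (K + 1) * eps n <= d / 2.
  rewrite mulrC -ler_pdivlMr//; near: n; apply: ev; exact: divr_gt0.
have [v vm] := is_min_exists T0 c00 hV hg x (shL n).
have [vL _] := vm.
have P1 : psi T c0 V g x W = Psi T c0 V g x W (u x) := psi_min (um x).
have P2 : psi T c0 V g x (shifted n) = Psi T c0 V g x (shifted n) v := psi_min vm.
have P3 := psi_le T0 c00 hV hg x (shL n) (uL x).
have P4 := psi_le T0 c00 hV hg x WL vL.
have t1 := taylor x n (uL x); have t2 := taylor x n vL.
have qb := quot_bound n x.
have tcl : `|tcost T V g (traj T x (shifted n) v) - tcost T V g (traj T x W v)| <= C * (Hb * eps n).
  apply: (tcost_lip T0 hV hg) => //; [exact: traj_L2|exact: traj_L2|by rewrite mulr_ge0 ?ltW|].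
  move=> t _; rewrite traj_shift addrAC subrr add0r mulNr normrN normrM (gtr0_norm e0).
  by rewrite mulrC ler_wpM2r// ltW.
have psid : psi T c0 V g x (shifted n) - psi T c0 V g x W <= C * Hb * eps n.
  move: qb; rewrite /quot normrM normfV (gtr0_norm e0) ler_pdivrMr//.
  by apply: le_trans; exact: ler_norm.
have near_min : Psi T c0 V g x W v <= Psi T c0 V g x W (u x) + q.
  rewrite -P1; apply: le_trans (_ : _ <= psi T c0 V g x W + A * eps n) _; last by rewrite lerD2l.
  move: tcl psid; rewrite P2 /Psi ler_norml /A => /andP[h1 _] h2.
  have := e0; lra.
have close := Hq _ vL near_min.
have zclose t : 0 <= t <= T -> `|traj T x W v t - zmin x t| <= (1 + T) * r.
  move=> _; rewrite /zmin /traj (_ : _ - _ = prim T v t - prim T (u x) t); last by ring.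
  rewrite -primB//; apply: prim_norm_le => //; first exact: L2B.
    by rewrite mulr_ge0 ?addr_ge0 ?ltW.
  apply: (@le_trans _ _ (T * r ^+ 2)); first by apply: ler_wpM2l => //; exact: ltW.
  rewrite [leRHS]exprMn; apply: ler_wpM2r; first exact: sqr_ge0.
  by have := T0; nra.
have dd := dtcost_lip (traj_L2 T0 x WL vL) (zL x) _ zclose.
have {}dd : `|dtc (traj T x W v) H - dtc (zmin x) H| <= d / 2.
  apply: le_trans (dd _) _; first by rewrite mulr_ge0 ?addr_ge0 ?ltW.
  rewrite mulrA -/L /r mulrA ler_pdivrMr// mulrC.
  by apply: ler_wpM2l; [exact: ltW|rewrite lerDl].
have Ke : K * eps n <= d / 2.
  by apply: le_trans e2; apply: ler_wpM2r; [exact: ltW|rewrite lerDl].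
rewrite -normrN opprB opprK ler_norml; apply/andP; split.
- rewrite -lerBlDr -(ler_pM2r e0) /quot divfK ?gt_eqF//.
  move: t2 dd P4; rewrite P2 P1 /Psi !ler_norml -/K => /andP[t2 _] /andP[_ dd] P4.
  have : eps n * (dtc (traj T x W v) H - dtc (zmin x) H) <= eps n * (d / 2).
    by rewrite ler_pM2l.
  have : eps n * (K * eps n) <= eps n * (d / 2) by rewrite ler_pM2l.
  move: t2; rewrite expr2; move: (dtc _ H) (dtc _ H) => a b; nra.
- rewrite -lerBrDr -(ler_pM2r e0) /quot divfK ?gt_eqF//.
  move: t1 P3; rewrite P1 /Psi !ler_norml -/K -/(zmin x) => /andP[_ t1] P3.
  have : eps n * (K * eps n) <= eps n * (d / 2) by rewrite ler_pM2l.
  move: t1; rewrite expr2; move: (dtc _ H) => a; nra.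
Unshelve. all: by end_near. Qed.

Definition value (W' : R -> R) : R := avg (fun x => psi T c0 V g x W').

(** Dominated convergence: the quotients converge at points of uniqueness, hence almost everywhere,
    and the Lipschitz bound on [psi] dominates them. *)
Lemma value_derivative :
  (value (shifted n) - value W) / eps n @[n --> \oo] --> ip T e mean_mom.
Proof.
have -> : ip T e mean_mom = avg (fun x => (-1) * dtc (zmin x) H).
  rewrite (meanZ hrho (-1) dtcost_wmeas (K := M * ip T (cst 1) (fun t => `|H t|) + M * Hb)).
    by rewrite mean_dtcost mulN1r opprK.
  move=> x _; apply: le_trans (ler_normD _ _) _; apply: lerD; first exact: ip_V'_bound.
  by rewrite normrM ler_pM.
have -> : (fun n => (value (shifted n) - value W) / eps n) = fun n => avg (quot n).
  apply/funext => n; rewrite /quot /value.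
  have [K1 h1] := psi_bounded T0 c00 hV hg B (shL n).
  have [K2 h2] := psi_bounded T0 c00 hV hg B WL.
  have m1 := measurable_wmeas hrho (psi_measurable T0 c00 hV hg (shL n)).
  have m2 := measurable_wmeas hrho (psi_measurable T0 c00 hV hg WL).
  have mN : wm (fun x => (-1) * psi T c0 V g x W).
    by apply: (measurable_wmeas hrho); apply: measurable_funM => //; exact: (psi_measurable T0 c00 hV hg).
  have mB : wm (fun x => psi T c0 V g x (shifted n) + (-1) * psi T c0 V g x W).
    apply: (measurable_wmeas hrho); apply: measurable_funD; first exact: (psi_measurable T0 c00 hV hg).
    by apply: measurable_funM => //; exact: (psi_measurable T0 c00 hV hg).
  have h2N x : `|x| <= B -> `|(-1) * psi T c0 V g x W| <= K2 by move=> /h2; rewrite normrM normrN1 mul1r.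
  transitivity ((eps n)^-1 * avg (fun x => psi T c0 V g x (shifted n) + (-1) * psi T c0 V g x W)).
    by rewrite (meanD hrho m1 mN h1 h2N) (meanZ hrho (-1) m2 h2) mulN1r mulrC.
  rewrite -(meanZ hrho _ mB (K := K1 + K2)).
    by congr avg; apply/funext => x; rewrite mulN1r mulrC.
  by move=> x xB; apply: le_trans (ler_normD _ _) _; apply: lerD; [exact: h1|exact: h2N].
apply: (mean_cvg hrho (K := C * Hb)) => //.
- rewrite /wmeas; under eq_fun do rewrite -mulrA.
  by apply: measurable_funM => //; exact: dtcost_wmeas.
- have := ae_unique_min T0 c00 hV hg WL cW; apply: filterS; first exact: (ae_filter_ringOfSetsType mu).
  by move=> x ux; rewrite mulN1r; exact: quot_cvg.
Qed.

End Variation.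

End Population.

(** * The equilibrium price *)

Section Price.
Context {R : realType} (T c0 M : R) (V V' g g' : R -> R) (rho0 rho : R -> R) (B : R).
Local Notation mu := (@lebesgue_measure R).
Local Notation RR := (measurableTypeR R).
Local Notation D := (`]0, T[%classic : set R).
Local Notation intg f := (mu.-integrable D (EFin \o f)).
Local Notation nrm2 f := (ip T f f).
Implicit Types f h v w z : R -> R.
Hypothesis T0 : 0 < T.
Hypothesis c00 : 0 < c0.
Hypotheses (hV : C11 M V V') (hg : C11 M g g').
Hypothesis hrho : weight rho B.
Hypothesis rho0E : {ae mu, forall x, rho0 x = rho x}.
Variable Q : R -> R.
Hypothesis QL : L2 T Q.
Local Notation dft := (drift T c0).
Local Notation val := (value T c0 V g rho).

Let mD : measurable (D : set RR). Proof. exact: measurable_itv. Qed.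
Let M0 : 0 <= M. Proof. by have [] := hV. Qed.
Let C : R := M * (T + 1).
Let C0 : 0 <= C. Proof. by rewrite mulr_ge0// addr_ge0// ltW. Qed.
Let i20 : 0 < (2 * c0)^-1. Proof. by rewrite invr_gt0 mulr_gt0. Qed.
Let cQL : L2 T (fun t => c0 * Q t). Proof. exact: L2Z. Qed.

Lemma value_sub W1 W2 (d : R) : L2 T W1 -> L2 T W2 -> 0 <= d ->
  (forall t, 0 <= t <= T -> `|W1 t - W2 t| <= d) -> `|val W1 - val W2| <= C * d.
Proof.
move=> W1L W2L d0 W12.
have [K1 h1] := psi_bounded T0 c00 hV hg B W1L.
have [K2 h2] := psi_bounded T0 c00 hV hg B W2L.
have p1 := psi_measurable T0 c00 hV hg W1L; have p2 := psi_measurable T0 c00 hV hg W2L.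
have pN : measurable_fun [set: RR] (fun x => (-1) * psi T c0 V g x W2).
  exact: measurable_funM.
have h2N (x : R) : `|x| <= B -> `|(-1) * psi T c0 V g x W2| <= K2.
  by move=> /h2; rewrite normrM normrN1 mul1r.
rewrite /value.
have -> : mean rho (fun x => psi T c0 V g x W1) - mean rho (fun x => psi T c0 V g x W2) =
    mean rho (fun x => psi T c0 V g x W1 + (-1) * psi T c0 V g x W2).
  rewrite (meanD hrho (measurable_wmeas hrho p1) (measurable_wmeas hrho pN) h1 h2N).
  by rewrite (meanZ hrho (-1) (measurable_wmeas hrho p2) h2) mulN1r.
apply: (mean_bound hrho).
  by apply: (measurable_wmeas hrho); exact: measurable_funD.
move=> x _; rewrite mulN1r; apply: (psi_lip T0 c00 hV hg) => // t tT.
by rewrite (_ : _ - _ = - (W1 t - W2 t)) ?normrN ?W12//; ring.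
Qed.

Definition reduced_cost w : R := - val (dft w).
Local Notation J := (energy T (2 * c0)^-1 (fun t => c0 * Q t) reduced_cost).

Lemma reduced_cost_lip u v d : L2 T u -> L2 T v -> 0 <= d ->
  (forall t, 0 <= t <= T -> `|prim T u t - prim T v t| <= d) ->
  `|reduced_cost u - reduced_cost v| <= C / c0 * d.
Proof.
move=> uL vL d0 uv; rewrite /reduced_cost -opprD normrN -mulrA.
apply: value_sub; [exact: drift_L2|exact: drift_L2| |].
  by rewrite mulr_ge0// invr_ge0 ltW.
move=> t tT; rewrite /drift !primZ// -mulrBr normrM gtr0_norm ?invr_gt0//.
by rewrite ler_pM2l ?invr_gt0// uv.
Qed.

(* Completing the square: [Q w + w^2/(2 c0) = (w + c0 Q)^2/(2 c0) - c0 Q^2/2]. *)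
Lemma I_functional_energy w : L2 T w ->
  I_functional T c0 V g rho0 Q w = J w - c0 / 2 * nrm2 Q.
Proof.
move=> wL; rewrite /I_functional /energy /reduced_cost.
have dL := drift_L2 c0 T0 wL.
have [K h] := psi_bounded T0 c00 hV hg B dL.
have pm := psi_measurable T0 c00 hV hg dL.
have -> : \int[mu]_x (phi T c0 V g w x * rho0 x) = val (dft w) - nrm2 w / (2 * c0).
  rewrite (@Rintegral_ae_eq _ setT _ (fun x => (psi T c0 V g x (dft w) + cst (- (nrm2 w / (2 * c0))) x) * rho x)).
    rewrite -/(mean rho _) (meanD hrho (K := K) (K' := `|- (nrm2 w / (2 * c0))|))//.
    - by rewrite (mean_cst hrho).
    - exact: (measurable_wmeas hrho).
    - exact: (measurable_wmeas hrho).
  move: rho0E; apply: filterS; first exact: (ae_filter_ringOfSetsType mu).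
  by move=> x -> _; rewrite (phi_psi T0 c00 hV hg).
have -> : nrm2 (fun t => w t + c0 * Q t) = nrm2 w + 2 * c0 * ip T w Q + c0 ^+ 2 * nrm2 Q.
  exact: ip_sqrD.
rewrite -/(ip T Q w) (ipC T Q w); field.
by rewrite gt_eqF.
Qed.

Lemma minimizes_I_energy w : minimizes_I T c0 V g rho0 Q w <->
  L2 T w /\ forall v, L2 T v -> J w <= J v.
Proof.
split=> -[wL wmin]; (split; first exact: wL) => v vL; have h := wmin v vL.
  rewrite (I_functional_energy wL) (I_functional_energy vL) in h.
  by rewrite (lerD2r (- (c0 / 2 * nrm2 Q))) in h.
rewrite (I_functional_energy wL) (I_functional_energy vL).
by apply: lerD; [exact: h|exact: lexx].
Qed.

Lemma minimizer_I_exists : exists w, minimizes_I T c0 V g rho0 Q w.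
Proof.
have Cc0 : 0 <= C / c0 by rewrite divr_ge0// ltW.
have [w wL wmin] := energy_min_exists T0 i20 Cc0 cQL reduced_cost_lip.
by exists w; apply/minimizes_I_energy.
Qed.

Section Optimality.
Variable w : R -> R.
Hypothesis wmin : minimizes_I T c0 V g rho0 Q w.
Let wL : L2 T w. Proof. by have [] := wmin. Qed.
Let dL : L2 T (dft w). Proof. exact: drift_L2. Qed.
Let dc : continuous (dft w). Proof. exact: drift_continuous. Qed.
Variable u : R -> R -> R.
Hypothesis um : forall x, is_min T c0 V g x (dft w) (u x).
Local Notation pbar := (mean_mom T V' g' rho (dft w) u).

Let fL : L2 T (force T V' rho (dft w) u).
Proof. exact: (force_L2 T0 c00 hV hg hrho dL dc um). Qed.
Let fc : continuous (force T V' rho (dft w) u).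
Proof. exact: (force_continuous T0 c00 hV hg hrho dL dc um). Qed.

Lemma mean_mom_continuous : continuous pbar.
Proof.
move=> t; apply: cvgB; last exact: cvg_cst.
by apply: cvgB; [exact: prim_continuous|exact: cvg_cst].
Qed.

Lemma mean_mom_C1 : C1_0T T pbar.
Proof.
have d t : t \in `]0, T[ -> is_derive t 1 pbar (force T V' rho (dft w) u t).
  move=> tD; have h := prim_is_derive fL tD (fc (x:=t)).
  have := is_deriveB (is_deriveB h (is_derive_cst (prim T (force T V' rho (dft w) u) T) t 1))
    (is_derive_cst (terminal T g' rho (dft w) u) t 1).
  by rewrite !subr0.
split.
  split.
  - by move=> t /d[].
  - by apply: cvg_at_right_filter; exact: mean_mom_continuous.
  - by apply: cvg_at_left_filter; exact: mean_mom_continuous.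
exists (force T V' rho (dft w) u); first by apply: continuous_subspaceT; exact: fc.
by move=> t /[!inE] /d[_ dt]; rewrite derive1E dt.
Qed.

Lemma mean_mom_L2 : L2 T pbar.
Proof. by apply: continuous_L2 => //; exact: mean_mom_continuous. Qed.

Lemma optimality_ineq e : L2 T e ->
  0 <= ip T (fun t => w t + c0 * Q t - pbar t) e.
Proof.
move=> eL; pose ce t := c0^-1 * e t.
have ceL : L2 T ce by exact: L2Z.
pose a t := w t + c0 * Q t.
have aL : L2 T a by exact: L2D.
have [_ Jmin] := (minimizes_I_energy w).1 wmin.
have cv := value_derivative T0 c00 hV hg hrho dL dc um ceL.
pose eps (n : nat) : R := n.+1%:R^-1.
have eps0 n : 0 < eps n by rewrite invr_gt0.
have ev n : (val (shifted T (dft w) ce n) - val (dft w)) / eps n <=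
    c0^-1 * ip T a e + (2 * c0)^-1 * nrm2 e * eps n.
  have sL : L2 T (fun t => w t + eps n * e t) by apply: L2D => //; exact: L2Z.
  have := Jmin _ sL; rewrite /energy /reduced_cost.
  have -> : dft (fun t => w t + eps n * e t) = shifted T (dft w) ce n.
    apply/funext => t; rewrite /shifted /drift -[X in _ + X]primZ// -primD//; [|exact: L2Z..].
    by apply: eq_ip => // s _; rewrite /ce mulrDr (mulrCA c0^-1).
  have -> : nrm2 (fun t => w t + eps n * e t + c0 * Q t) =
      nrm2 a + 2 * eps n * ip T a e + eps n ^+ 2 * nrm2 e.
    by rewrite -ip_sqrD//; apply: eq_ip => t _; rewrite /a; ring.
  rewrite -/a -/(nrm2 a) ler_pdivrMr// => h.
  have -> : (c0^-1 * ip T a e + (2 * c0)^-1 * nrm2 e * eps n) * eps n =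
      (2 * c0)^-1 * (nrm2 a + 2 * eps n * ip T a e + eps n ^+ 2 * nrm2 e) - (2 * c0)^-1 * nrm2 a.
    by field; rewrite gt_eqF.
  lra.
have lim : c0^-1 * ip T a e + (2 * c0)^-1 * nrm2 e * eps n @[n --> \oo] -->
    c0^-1 * ip T a e + (2 * c0)^-1 * nrm2 e * 0.
  apply: cvgD; first exact: cvg_cst.
  by apply: cvgM; [exact: cvg_cst|exact: cvg_harmonic].
have : ip T ce pbar <= c0^-1 * ip T a e + (2 * c0)^-1 * nrm2 e * 0.
  by apply: (ler_cvg_to cv lim); exact: nearW.
rewrite mulr0 addr0 ipZl//; last exact: mean_mom_L2.
rewrite ler_pM2l ?invr_gt0// => h.
by rewrite ipBl// ?subr_ge0 1?(ipC T pbar)//; exact: mean_mom_L2.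
Qed.

Lemma optimal_price_ae : {ae mu, forall t, t \in `]0, T[ -> w t + c0 * Q t = pbar t}.
Proof.
have rL : L2 T (fun t => w t + c0 * Q t - pbar t).
  by apply: L2B; [exact: L2D|exact: mean_mom_L2].
have := optimality_ineq (L2N rL); rewrite ipNr// oppr_ge0 => r0.
have r00 : nrm2 (fun t => w t + c0 * Q t - pbar t) = 0.
  by apply/eqP; rewrite eq_le r0 ip_ge0.
have := ip_eq0_ae rL r00; apply: filterS; first exact: (ae_filter_ringOfSetsType mu).
by move=> t h tD; apply/eqP; rewrite -subr_eq0 h.
Qed.

Lemma optimal_price_C1 : equal_ae_C1 T (fun t => w t + c0 * Q t).
Proof.
exists pbar; first exact: mean_mom_C1.
have := optimal_price_ae; apply: filterS; first exact: (ae_filter_ringOfSetsType mu).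
by move=> t h tD; apply: h; move: tD; rewrite inE.
Qed.

Lemma optimal_price_clears zs :
  (forall x t, 0 <= t <= T -> zs x t = traj T x (dft w) (u x) t) ->
  market_clearing T rho0 Q zs.
Proof.
move=> zsE; have cwL := L2Z c0^-1 wL.
have := optimal_price_ae; have := prim_derivable_ae cwL.
rewrite /market_clearing; apply: filterS2; first exact: (ae_filter_ringOfSetsType mu).
move=> t hw hp /[!inE] tD.
have [dw dwE] := hw tD; have pE := hp tD.
pose m x := mom T V' g' (zmin T (dft w) u x) t.
have zL x : L2 T (zmin T (dft w) u x) by apply: traj_L2 => //; have [] := um x.
have dzs x : derive1 (zs x) t = c0^-1 * m x - c0^-1 * w t.
  have cmL : L2 T (fun t => c0^-1 * mom T V' g' (zmin T (dft w) u x) t).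
    by apply: L2Z; exact: (mom_L2 T0 hV hg (zL x)).
  have cmc : {for t, continuous (fun t => c0^-1 * mom T V' g' (zmin T (dft w) u x) t)}.
    by apply: cvgM; [exact: cvg_cst|exact: (mom_continuous hV (zL x))].
  have zE s : 0 <= s <= T -> zs x s = x + prim T (fun t => u x t - c0^-1 * w t) s.
    by move=> sT; rewrite zsE// /traj /drift primB ?addrA//; have [] := um x.
  rewrite (derive1_prim_near zE tD).
  have -> : prim T (fun t => u x t - c0^-1 * w t) =
      prim T (fun t => c0^-1 * mom T V' g' (zmin T (dft w) u x) t) - prim T (fun t => c0^-1 * w t).
    apply/funext => s; rewrite primB//; last by have [] := um x.
    by rewrite (is_min_prim T0 c00 hV hg dL (um x)).
  have dm := prim_is_derive cmL tD cmc.
  have dw' : is_derive t 1 (prim T (fun t => c0^-1 * w t)) (c0^-1 * w t).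
    by apply: DeriveDef; [exact: dw|rewrite -dwE derive1E].
  by have [_ dd] := is_deriveB dm dw'; rewrite derive1E dd.
have mm : wmeas rho m := wmeas_mom T0 c00 hV hg hrho dL dc um t.
have mb (x : R) : `|x| <= B -> `|m x| <= M * (1 + 2 * T).
  by move=> _; exact: (mom_bound T0 hV hg t (zL x)).
have cm : wmeas rho (fun x => c0^-1 * m x).
  rewrite /wmeas; under eq_fun do rewrite -mulrA.
  by apply: measurable_funM => //; exact: mm.
have cb (x : R) : `|x| <= B -> `|c0^-1 * m x| <= c0^-1 * (M * (1 + 2 * T)).
  by move=> /mb mx; rewrite normrM gtr0_norm ?invr_gt0// ler_pM2l ?invr_gt0.
have kb (x : R) : `|x| <= B -> `|cst (- (c0^-1 * w t)) x : R| <= `|- (c0^-1 * w t)| by [].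
have km : wmeas rho (cst (- (c0^-1 * w t))) by exact: (measurable_wmeas hrho).
have am : wmeas rho (fun x => c0^-1 * m x + cst (- (c0^-1 * w t)) x).
  rewrite /wmeas; under eq_fun do rewrite mulrDl.
  by apply: measurable_funD.
have ai : mu.-integrable setT (EFin \o (fun x => (c0^-1 * m x + cst (- (c0^-1 * w t)) x) * rho x)).
  apply: (weighted_integrable hrho am (K := c0^-1 * (M * (1 + 2 * T)) + `|- (c0^-1 * w t)|)).
  by move=> x xB; apply: le_trans (ler_normD _ _) _; apply: lerD; [exact: cb|exact: kb].
have := @integral_ae_eq_fin _ setT (fun x => derive1 (zs x) t * rho0 x)
  (fun x => (c0^-1 * m x + cst (- (c0^-1 * w t)) x) * rho x).
move=> ->; last first.
  move: rho0E; apply: filterS; first exact: (ae_filter_ringOfSetsType mu).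
  by move=> x -> _; rewrite dzs.
rewrite -[LHS]fineK; last by apply: integrable_fin_num.
congr (_%:E); rewrite -/(Rintegral mu setT _) -/(mean rho _).
rewrite (meanD hrho cm km cb kb) (mean_cst hrho) (meanZ hrho _ mm mb).
rewrite (mean_momE T0 c00 hV hg hrho dL dc um) -pE.
by field; rewrite gt_eqF.
Qed.

End Optimality.

Lemma minimizer_is_equilibrium w : minimizes_I T c0 V g rho0 Q w ->
  equilibrium_price T c0 V g rho0 Q w /\ equal_ae_C1 T (fun t => w t + c0 * Q t).
Proof.
move=> wmin; have [wL _] := wmin.
have dL := drift_L2 c0 T0 wL; have dc : continuous (dft w) := drift_continuous wL.
have [u um] := choice (fun x => is_min_exists T0 c00 hV hg x dL).
split; last exact: (optimal_price_C1 wmin um).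
split=> //.
- exists (zmin T (dft w) u); split.
    move=> x; apply: (is_minimizerP g T0 c00 hV x _ wL).2.
    by exists (u x).
  have := zmin_measurable T0 c00 hV hg dL dc um.
  move=> mz; apply: (eq_measurable_fun (fun tx : RR * RR =>
    zmin T (dft w) u tx.2 (clamp T tx.1))); last exact: measurable_funTS.
  move=> [t x]; rewrite inE /= => -[+ _]; rewrite in_itv/= => tT.
  by rewrite clamp_id.
- move=> zs [zsmin _].
  have vP x : exists v, is_min T c0 V g x (dft w) v /\
      forall t, 0 <= t <= T -> zs x t = traj T x (dft w) v t.
    by have [v vm vE] := (is_minimizerP g T0 c00 hV x (zs x) wL).1 (zsmin x); exists v.
  have [v vP'] := choice vP.
  by apply: (optimal_price_clears wmin (fun x => (vP' x).1)) => x t tT; exact: (vP' x).2.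
Qed.

End Price.

Unset Implicit Arguments.

Theorem theorem3p3 (R : realType) (T c0 : R) (V g : R -> R)
    (P : probability (measurableTypeR R) R) (rho0 : R -> R)
    (T_gt0 : 0 < T) (c0_gt0 : 0 < c0)
    (hV : bounded_derivatives2 V) (hg : bounded_derivatives2 g)
    (P_compact : compactly_supported P)
    (P_ac : P `<< @lebesgue_measure R)
    (P_density : is_density P rho0) :
  forall Q : R -> R, L2 T Q ->
  [/\ exists w, minimizes_I T c0 V g rho0 Q w,
      forall w, minimizes_I T c0 V g rho0 Q w ->
        equal_ae_C1 T (fun t => w t + c0 * Q t)
    & exists w, equilibrium_price T c0 V g rho0 Q w /\
        equal_ae_C1 T (fun t => w t + c0 * Q t)].
Proof.
move=> Q QL; have [M1 hV1] := bounded_derivatives2_C11 hV.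
have [M2 hg2] := bounded_derivatives2_C11 hg.
have hVM : C11 (Num.max M1 M2) V (derive1 V) by apply: C11_le hV1; rewrite le_max lexx.
have hgM : C11 (Num.max M1 M2) g (derive1 g) by apply: C11_le hg2; rewrite le_max lexx orbT.
have [rho [B [hrho rho0E]]] := density_weight P_compact P_density.
have eq w := @minimizer_is_equilibrium R T c0 _ V _ g _ rho0 rho B T_gt0 c0_gt0 hVM hgM hrho rho0E Q QL w.
have ex := @minimizer_I_exists R T c0 _ V _ g _ rho0 rho B T_gt0 c0_gt0 hVM hgM hrho rho0E Q QL.
split=> //; first by move=> w /eq[].
by have [w /eq wE] := ex; exists w.
Qed.
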